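(* Let $D\subset\mathbb{R}^d$ be a nonempty open convex domain with $\partial D\neq\varnothing$, let $x_\ast\in D$ be fixed, and let $b:\mathbb{R}^d\to\mathbb{R}^d$ and $\sigma:\mathbb{R}^d\to\mathbb{R}^{d\times m}$ be continuous functions for which there exist constants $L>0$, $\eta>\frac12$, $q_b\ge 0$, $q_\sigma\ge 0$ such that for all $x,y\in\mathbb{R}^d$ $$\langle x-y,b(x)-b(y)\rangle+\eta\|\sigma(x)-\sigma(y)\|_{\mathrm{HS}}^2\le L|x-y|^2,$$ $$|b(x)-b(y)|\le L(1+|x|^{q_b}+|y|^{q_b})|x-y|,\qquad \|\sigma(x)-\sigma(y)\|_{\mathrm{HS}}\le L(1+|x|^{q_\sigma}+|y|^{q_\sigma})|x-y|.$$ Let $p_\ast:=\eta+\frac12$, $V(x):=1+|x-x_\ast|^2$, let $x_0\in\overline D$ be deterministic, and let $(X_h,K_h)$ be the coupled tamed Euler--Peano approximation with stepsize $h$ (defined in the context). Let $p\ge1$ and assume that there exists an exponent $P$ such that $\max\{p,2\}<P<p_\ast$. Then for every $T>0$ there exists a constant $C_{p,P,T}>0$, independent of $h\in(0,1]$, such that $$\sup_{0<h\le1}\mathbb{E}\Big[\sup_{0\le t\le T}V^p(X_h(t))\Big]\le C_{p,P,T}V^p(x_0).$$ Consequently, $$\sup_{0<h\le1}\mathbb{E}\Big[\sup_{0\le t\le T}|X_h(t)|^{2p}\Big]\le C_{p,P,T}\big(1+|x_0|^{2p}\big).$$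
   Context: $\langle\cdot,\cdot\rangle$ and $|\cdot|$ are the Euclidean inner product and norm, $\|\cdot\|_{\mathrm{HS}}$ is the Hilbert--Schmidt norm, $B(x,r)$ is the open ball of radius $r$ about $x$. $(\Omega,\mathcal F,\{\mathcal F_t\}_{t\ge0},\mathbb P)$ is a complete filtered probability space satisfying the usual conditions and $W$ is an $m$-dimensional standard Brownian motion with respect to $\{\mathcal F_t\}$. For $x\in\partial D$, the set of inward unit normal vectors is $N_x:=\bigcup_{r>0}\{\mathbf n\in\mathbb R^d:|\mathbf n|=1,\ B(x-r\mathbf n,r)\cap D=\varnothing\}$; for convex $D$ this equals $\{\mathbf n:|\mathbf n|=1,\ \langle y-x,\mathbf n\rangle\ge0\text{ for every }y\in\overline D\}$. For a continuous function $\phi$ of bounded variation, $|\phi|_{[s,t]}$ is its total variation over $[s,t]$ and $d|\phi|$ the variation measure. Coupled tamed Euler--Peano approximation: $h$ ranges over the values $h=T/N\in(0,1]$ with $N\in\mathbb N$; let $t_k=kh$ and $\kappa_h(t):=t_k$ for $t\in[t_k,t_{k+1})$, $k=0,\dots,N-1$ (the value at the single time $T$ plays no role). Let $$G(x):=|b(x)|+\|\sigma(x)\|_{\mathrm{HS}}^2,\quad \lambda_h(x):=\frac1{1+h^{1/2}G(x)},\quad b_h(x):=\lambda_h(x)b(x),\quad \sigma_h(x):=\lambda_h(x)^{1/2}\sigma(x).$$ $(X_h,K_h)$ is the unique pair with $X_h$ an $\overline D$-valued continuous adapted process, $K_h$ a continuous adapted process of bounded variation, $K_h(0)=0$, $$X_h(t)=x_0+\int_0^t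 b_h(\overline X_h(s))\,ds+\int_0^t\sigma_h(\overline X_h(s))\,dW(s)+K_h(t),\quad \overline X_h(s):=X_h(\kappa_h(s)),\quad t\in[0,T],$$ and a progressively measurable $\mathbf n_h:[0,T]\times\Omega\to\mathbb R^d$ such that $K_h(t)=\int_0^t\mathbf n_h(s)\,d|K_h|(s)$, $\mathbf n_h(s)\in N_{X_h(s)}$ $d|K_h|$-a.e., and $|K_h|_{[0,t]}=\int_0^t\mathbf 1_{\{X_h(s)\in\partial D\}}\,d|K_h|(s)$. Constants may depend on the indicated parameters and on the fixed structural constants of the problem (such as the dimension, the domain, the coefficients and $x_\ast$), but not on $h$. *)

(* Defs.v *)
From HB Require Import structures.
From mathcomp Require Import all_boot all_order all_algebra.
From mathcomp Require Import all_classical all_reals all_analysis.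
Import Order.TTheory GRing.Theory Num.Theory.
Import numFieldNormedType.Exports.

Set Implicit Arguments.
Unset Strict Implicit.
Unset Printing Implicit Defensive.

Local Open Scope classical_set_scope.
Local Open Scope ring_scope.

Section Euclidean.
Context {R : realType}.

(* Hilbert--Schmidt norm; on column vectors it is the Euclidean norm. The
   library's [`|A|] on matrices is the sup-norm, which induces the same
   topology (hence [closure], [open], [continuous] below are the library's). *)
Definition hsnorm (m n : nat) (A : 'M[R]_(m, n)) : R :=
  Num.sqrt (\sum_i \sum_j A i j ^+ 2).

Definition dotv (d : nat) (u v : 'cV[R]_d) : R := \sum_i u i 0 * v i 0.

Definition eball (d : nat) (x : 'cV[R]_d) (r : R) : set 'cV[R]_d :=
  [set y | hsnorm (y - x) < r].

Definition frontier (d : nat) (D : set 'cV[R]_d) : set 'cV[R]_d :=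
  closure D `\` interior D.

Definition inward_normals (d : nat) (D : set 'cV[R]_d) (x : 'cV[R]_d) :
    set 'cV[R]_d :=
  \bigcup_(r in [set r : R | 0 < r])
    [set n | hsnorm n = 1 /\ eball (x - r *: n) r `&` D = set0].

End Euclidean.

Section Variation.
Context {R : realType}.

(* Same partitions as the library's [total_variation] (which is restricted to
   real-valued functions), with the Euclidean norm of the increments. *)
Definition total_variationv (d : nat) (a b : R) (phi : R -> 'cV[R]_d) : \bar R :=
  ereal_sup [set (\sum_(0 <= k < size s)
                    hsnorm (phi (nth b (a :: s) k.+1) - phi (nth b (a :: s) k)))%:E
            | s in itv_partition a b].

(* For [phi] continuous and of bounded variation on [0, T] there is exactly one
   such [mu], namely d|phi| (extended by 0 outside [0, T]). *)
Definition variation_measure (d : nat) (T : R) (phi : R -> 'cV[R]_d)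
    (mu : {measure set (measurableTypeR R) -> \bar R}) : Prop :=
  mu (~` `[0, T]%classic) = 0%E /\
  (forall s t, 0 <= s -> s <= t -> t <= T ->
     mu `[s, t]%classic = total_variationv s t phi).

Definition integralv (d : nat) (mu : {measure set (measurableTypeR R) -> \bar R}) (J : set R)
    (f : R -> 'cV[R]_d) : 'cV[R]_d :=
  \col_i \int[mu]_(s in J) f s i 0.

(* The path [k] is the reflection term of the path [x] of the closure of [D]
   on [0, T], with direction [n]. *)
Definition reflected_path (d : nat) (D : set 'cV[R]_d) (T : R)
    (x k n : R -> 'cV[R]_d) : Prop :=
  [/\ {within `[0, T], continuous x},
      (forall t, 0 <= t -> t <= T -> closure D (x t)),
      {within `[0, T], continuous k} /\ k 0 = 0,
      (total_variationv 0 T k < +oo)%E &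
      exists mu : {measure set (measurableTypeR R) -> \bar R},
        [/\ variation_measure T k mu,
            (forall t, 0 <= t -> t <= T -> k t = integralv mu `[0, t] n),
            {ae mu, forall s, 0 <= s -> s <= T -> inward_normals D (x s) (n s)} &
            forall t, 0 <= t -> t <= T ->
              total_variationv 0 t k =
              (\int[mu]_(s in `[0%R, t]) (\1_(frontier D) (x s))%:E)%E]].

End Variation.

Section Processes.
Context {R : realType} {dO : measure_display} {Omega : measurableType dO}.

Definition usual_conditions (Pr : probability Omega R)
    (F : R -> set (set Omega)) : Prop :=
  [/\ measure_is_complete Pr,
      (forall t, 0 <= t -> sigma_algebra setT (F t) /\ F t `<=` measurable),
      (forall s t, 0 <= s -> s <= t -> F s `<=` F t),
      (forall t, 0 <= t -> F t = \bigcap_(s in [set s | t < s]) F s) &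
      (forall A, Pr.-negligible A -> F 0 A)].

Definition sigma_vec (k : nat) (Y : Omega -> 'cV[R]_k) : set (set Omega) :=
  <<s \bigcup_i preimage_set_system setT (fun w => Y w i 0) measurable >>.

Definition adapted (k : nat) (J : set R) (F : R -> set (set Omega))
    (Y : R -> Omega -> 'cV[R]_k) : Prop :=
  forall t, J t -> sigma_vec (Y t) `<=` F t.

(* For every t in [0, T], the restriction to [0, t] x Omega is measurable with
   respect to Borel([0, t]) (x) F t. *)
Definition progressive (k : nat) (T : R) (F : R -> set (set Omega))
    (Y : R -> Omega -> 'cV[R]_k) : Prop :=
  forall t, 0 <= t -> t <= T -> forall i,
    preimage_set_system (`[0, t] `*` setT)
      (fun z : R * Omega => Y z.1 z.2 i 0) measurable `<=`
    <<s `[0, t] `*` setT,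
        [set A `*` B | A in [set A : set R | measurable A /\ A `<=` `[0, t]]
                     & B in F t] >>.

Definition brownian_motion (m : nat) (Pr : probability Omega R)
    (F : R -> set (set Omega)) (W : R -> Omega -> 'cV[R]_m) : Prop :=
  [/\ adapted [set t | 0 <= t] F W,
      {ae Pr, forall w, W 0 w = 0 /\
         {within [set t | 0 <= t], continuous (W ^~ w)}},
      (* law N(0, (t - s) I); [normal_prob] takes the standard deviation *)
      (forall s t, 0 <= s -> s < t ->
       forall A : 'I_m -> set R, (forall i, measurable (A i)) ->
         Pr [set w | forall i, A i ((W t w - W s w) i 0)] =
         (\prod_(i < m) normal_prob 0%R (Num.sqrt (t - s)%R) (A i))%E) &
      (forall s t, 0 <= s -> s < t ->
       forall A B, F s A -> sigma_vec (fun w => W t w - W s w) B ->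
         Pr (A `&` B) = (Pr A * Pr B)%E)].

(* The supremum is taken in [\bar R], where it is never a junk value. *)
Definition expected_sup (Pr : probability Omega R) (T : R)
    (Y : R -> Omega -> R) : \bar R :=
  (\int[Pr]_w ereal_sup [set (Y t w)%:E | t in `[0%R, T]])%E.

End Processes.

Section TamedEulerPeano.
Context {R : realType} {d m : nat}.
Variables (b : 'cV[R]_d -> 'cV[R]_d) (sigma : 'cV[R]_d -> 'M[R]_(d, m)).

Definition growth (x : 'cV[R]_d) : R := hsnorm (b x) + hsnorm (sigma x) ^+ 2.

Definition taming (h : R) (x : 'cV[R]_d) : R :=
  (1 + Num.sqrt h * growth x)^-1.

Definition tamed_drift (h : R) (x : 'cV[R]_d) : 'cV[R]_d :=
  taming h x *: b x.

Definition tamed_diffusion (h : R) (x : 'cV[R]_d) : 'M[R]_(d, m) :=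
  Num.sqrt (taming h x) *: sigma x.

(* [kappa h t = k h] for [t] in [k h, (k+1) h). *)
Definition kappa (h t : R) : R := (Num.floor (t / h))%:~R * h.

(* Ito integral over [0, t] of the simple process equal to [Z (k h)] on
   [k h, (k+1) h), k < N, against [W]. *)
Definition simple_ito (h : R) (N : nat) (Z : R -> 'M[R]_(d, m))
    (W : R -> 'cV[R]_m) (t : R) : 'cV[R]_d :=
  \sum_(k < N) Z (k%:R * h) *m
    (W (Num.min t (k.+1%:R * h)) - W (Num.min t (k%:R * h))).

(* The integrand s |-> sigma_h (X (kappa_h s)) is a (bounded) simple process,
   so its stochastic integral is given by [simple_ito]. *)
Definition tamed_euler_peano (dO : measure_display) (Omega : measurableType dO)
    (Pr : probability Omega R) (F : R -> set (set Omega))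
    (W : R -> Omega -> 'cV[R]_m) (D : set 'cV[R]_d) (x0 : 'cV[R]_d)
    (T : R) (N : nat) (X K : R -> Omega -> 'cV[R]_d) : Prop :=
  let h := T / N%:R in
  exists n : R -> Omega -> 'cV[R]_d,
    [/\ adapted `[0, T] F X, adapted `[0, T] F K, progressive T F n &
        {ae Pr, forall w,
           reflected_path D T (X ^~ w) (K ^~ w) (n ^~ w) /\
           (forall t, 0 <= t -> t <= T ->
              X t w = x0
                + integralv lebesgue_measure `[0, t]
                    (fun s => tamed_drift h (X (kappa h s) w))
                + simple_ito h N (fun s => tamed_diffusion h (X (kappa h s) w))
                    (W ^~ w) t
                + K t w)}].

End TamedEulerPeano.

(* The numbers N of steps for which the stepsize T / N lies in (0, 1]. *)
Definition admissible_steps {R : realType} (T : R) : set nat :=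
  [set N | (0 < N)%N /\ T / N%:R <= 1].

Definition lyapunov {R : realType} (d : nat) (xs x : 'cV[R]_d) : R :=
  1 + hsnorm (x - xs) ^+ 2.

(* Main.v *)
(* On a step starting at [t_k] with frozen drift [a], distances are measured from
   the moving centre [xs - theta (t_(k+1) - t) a], which cancels the drift. Taming
   gives [h |a| <= sqrt h], so for small [h] ([theta = 1]) the centre stays in
   [D], and by convexity the reflection can only decrease the distance to it; for
   the other [h] the drift is bounded and the fixed centre [xs] ([theta = 0])
   is good enough.
   Each step is subdivided into [M] pieces. A second-order expansion of
   [(k + |z + v|^2)^P] and the independence of the Gaussian increments make the
   [P]-th power of the energy (squared distance plus the remaining quadratic
   variation, weighted by [kap] with [2 P - 1 < kap < 2 eta]) a supermartingale up
   to factors whose product is bounded uniformly in [h] and [M]; at the start of a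
   step the weighted quadratic variation is absorbed by monotonicity. On the grid
   the reflection only decreases the distance up to a defect, which is paid from a
   budget and tends to 0 pathwise as [M] grows, the reflection having finite
   variation. A maximal inequality for the exponents [p < P] and Fatou's lemma for
   [M -> oo] conclude. *)

(* Within a step the coefficients are frozen at [X (t_k)] while the position moves, so coercivity,
   which pairs [x - xs] with [b x], is available only at [t_k]. Cancelling the drift by the moving
   centre concentrates its whole effect in the jump of the centre at [t_k], where it appears as
   [2 h <y, a>] next to [kap h |S|^2], the quadratic variation of the step entered in the energy in
   advance: this is the combination that coercivity bounds by [C h V]. The leftover [h^2 |a|^2] is
   at most [h] by taming. The constant [2 P - 1] belongs to the second-order expansion, [2 eta] to
   the monotonicity condition, and [P < eta + 1/2] says precisely that some [kap] fits strictly
   between them. The gap below [kap] pays the third-order error of the Gaussian increments, the gap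
   above it pays Young's inequality around [xs]. Instead of conditional expectations, one-step
   estimates are integrated against arbitrary nonnegative weights [Q] measurable with respect to the
   past. *)
Require Import Defs.
From HB Require Import structures.
From mathcomp Require Import all_boot all_order all_algebra.
From mathcomp Require Import all_classical all_reals all_analysis.
From mathcomp Require Import measurable_realfun.
From mathcomp Require Import ring lra.
Import Order.TTheory GRing.Theory Num.Theory.
Import numFieldNormedType.Exports.

Set Implicit Arguments.
Unset Strict Implicit.
Unset Printing Implicit Defensive.

Local Open Scope classical_set_scope.
Local Open Scope ring_scope.

(** * Power inequalities *)

Section scalar.
Context {R : realType}.
Implicit Types a b x y t p q P : R.

(** Young's inequality for [x * 1], with [p] and its conjugate exponent. *)
Lemma bernoulli_powR x p : 0 <= x -> 1 <= p -> 1 + p * (x - 1) <= x `^ p.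
Proof.
move=> x0; rewrite le_eqVlt => /predU1P[<-|p1]; first by rewrite powRr1//; lra.
have p0 : 0 < p by lra.
have q0 : 0 < 1 - p^-1 by rewrite subr_gt0 invf_lt1.
have q1 : 0 < (1 - p^-1)^-1 by rewrite invr_gt0.
have e1 : p^-1 + ((1 - p^-1)^-1)^-1 = 1 by rewrite invrK; ring.
have := conjugate_powR x0 ler01 p0 q1 e1.
rewrite powR1 mulr1 mul1r invrK -(ler_pM2l p0) mulrDr mulrBr mulr1.
rewrite mulrCA divff ?gt_eqF// mulr1; lra.
Qed.

Lemma ge0_derive_le (f df : R -> R) a b : a <= b ->
  (forall x, a <= x <= b -> is_derive x (1 : R) f (df x)) ->
  (forall x, a <= x <= b -> 0 <= df x) -> f a <= f b.
Proof.
move=> ab fd d0.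
have [c cab] : exists2 c, c \in `[a, b]%R & f b - f a = df c * (b - a).
  apply: MVT_segment => //.
    by move=> x; rewrite in_itv/= => /andP[/ltW ? /ltW ?]; apply: fd; apply/andP.
  apply: derivable_within_continuous => x; rewrite in_itv/= => xab.
  by have [] := fd x xab.
move: cab; rewrite in_itv/= => cab E.
by rewrite -subr_ge0 E mulr_ge0 ?d0// subr_ge0.
Qed.

(** The difference of the two sides vanishes at 1, and its derivative has a sign by Bernoulli's
    inequality with exponent [P - 1]; this is where [2 <= P] enters. *)
Lemma powR_taylor2_lt1 x P : 0 <= x <= 1 -> 2 <= P ->
  x `^ P <= 1 + P * (x - 1) + P * (P - 1) / 2 * (x - 1) ^+ 2.
Proof.
move=> /andP[+ x1] P2; rewrite le_eqVlt => /predU1P[<-|x0].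
  by rewrite powR0 ?gt_eqF//; nra.
rewrite -subr_ge0.
pose f := fun y : R => y `^ P - (1 + P * (y - 1) + P * (P - 1) / 2 * (y - 1) ^+ 2).
pose df := fun y : R => P * (y `^ (P - 1) - (1 + (P - 1) * (y - 1))).
have fd y : x <= y <= 1 -> is_derive y (1 : R) f (df y).
  move=> /andP[xy _]; have y0 : 0 < y by apply: lt_le_trans xy.
  have Hb := is_deriveB (is_derive_id y (1:R)) (is_derive_cst (1:R) y (1:R)).
  have H := is_deriveB (is_derive1_powR P y0) (is_deriveD
    (is_deriveD (is_derive_cst (1:R) y (1:R)) (is_deriveZ P Hb))
    (is_deriveZ (P * (P - 1) / 2) (is_deriveX 2 Hb))).
  refine (is_derive_eq H _).
  by rewrite /df /GRing.scale/= !fctE expr1; field.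
have : f x <= f 1.
  apply: (ge0_derive_le x1 fd) => y /andP[xy y1].
  by rewrite mulr_ge0//; [lra|rewrite subr_ge0 bernoulli_powR//; lra].
by rewrite /f powR1 subrr expr0n /= !mulr0 !addr0 subrr -oppr_ge0 opprB.
Qed.

(** Dividing by [x^P] and setting [y = 1 / x] brings the claim to the interval from [1 / x] to 1,
    where the derivative of the difference factors as [P (P - 1) (1 - y) (1 - y^(P - 2))]. *)
Lemma powR_taylor2_gt1 x P : 1 <= x -> 2 <= P ->
  x `^ P <= 1 + P * (x - 1) + P * (P - 1) / 2 * (x - 1) ^+ 2 * x `^ (P - 2).
Proof.
move=> x1 P2; have x0 : 0 < x by lra.
pose f := fun y : R => - (y `^ P + P * ((1 - y) * y `^ (P - 1))
                          + P * (P - 1) / 2 * (1 - y) ^+ 2).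
pose df := fun y : R => P * (P - 1) * (1 - y) * (1 - y `^ (P - 2)).
have xV1 : x^-1 <= 1 by rewrite invf_le1.
have fd y : x^-1 <= y <= 1 -> is_derive y (1 : R) f (df y).
  move=> /andP[xy _].
  have y0 : 0 < y by apply: lt_le_trans xy; rewrite invr_gt0.
  have Hb := is_deriveB (is_derive_cst (1:R) y (1:R)) (is_derive_id y (1:R)).
  have H := is_deriveN (is_deriveD (is_deriveD (is_derive1_powR P y0)
    (is_deriveZ P (is_deriveM Hb (is_derive1_powR (P - 1) y0))))
    (is_deriveZ (P * (P - 1) / 2) (is_deriveX 2 Hb))).
  refine (is_derive_eq H _).
  rewrite /df /GRing.scale/= !fctE expr1.
  have -> : y `^ (P - 1 - 1) = y `^ (P - 2) by congr powR; ring.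
  have -> : y `^ (P - 1) = y * y `^ (P - 2).
    by rewrite -(@mulr_powRB1 _ y (P - 1)) ?ltW//; [congr (_ * powR _ _); ring|lra].
  by field.
have : f x^-1 <= f 1.
  apply: (ge0_derive_le xV1 fd) => y /andP[xy y1].
  have y0 : 0 < y by apply: lt_le_trans xy; rewrite invr_gt0.
  rewrite !mulr_ge0//; try lra.
  have : y `^ (P - 2) <= 1 `^ (P - 2) by apply: ge0_ler_powR; rewrite ?nnegrE; lra.
  by rewrite powR1 subr_ge0.
rewrite /f powR1 subrr mul0r expr0n/= !mulr0 !addr0 lerN2 => H.
have E a : x^-1 `^ a = (x `^ a)^-1 by rewrite -powR_inv1 ?ltW// -powRrM mulN1r powRN.
have pP : 0 < x `^ (P - 2) by rewrite powR_gt0.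
have E1 : x `^ (P - 1) = x * x `^ (P - 2).
  by rewrite -(@mulr_powRB1 _ x (P - 1)) ?ltW//; [congr (_ * powR _ _); ring|lra].
have E2 : x `^ P = x * (x * x `^ (P - 2)).
  by rewrite -E1 mulr_powRB1// ?ltW//; lra.
move: H; rewrite !E E1 E2; set z := x `^ (P - 2) in pP *.
have xz : 0 < x * (x * z) by rewrite !mulr_gt0.
rewrite -(ler_pM2l xz) mulr1 => /le_trans; apply.
rewrite le_eqVlt; apply/orP; left; apply/eqP.
by field; rewrite !gt_eqF.
Qed.

(* [s] is a running maximum and [u] the current value; [c = p / (P - p)] is the
   least constant for which the inequality survives at [s = u]. *)
Lemma running_max_powR s u p P : 1 <= s -> 0 <= u -> 1 <= p -> p < P ->
  Num.max s u `^ p + p / (P - p) * Num.max s u `^ (p - P) * u `^ P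
    <= s `^ p + p / (P - p) * s `^ (p - P) * u `^ P.
Proof.
move=> s1 u0 p1 pP; have s0 : 0 < s by lra.
have c0 : 0 < p / (P - p) by rewrite divr_gt0; lra.
case: (leP u s) => [//|su].
have u1 : 0 < u by lra.
have E : u `^ (p - P) * u `^ P = u `^ p.
  by rewrite -powRD; [congr powR; ring|rewrite (gt_eqF u1) implybT].
rewrite -mulrA E.
have sE : s `^ (p - P) = s `^ p * (s `^ P)^-1.
  by rewrite -powRN -powRD// (gt_eqF s0) implybT.
(* For [a = s^p] and [b = u^p] the claim is Bernoulli's inequality for [b / a] with exponent [k];
   the constant [c] satisfies [c k = 1 + c], which makes the terms in [a] cancel. *)
pose k := P / p; have k1 : 1 <= k by rewrite /k ler_pdivlMr; lra.
have uP : u `^ P = (u `^ p) `^ k.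
  by rewrite -powRrM; congr powR; rewrite /k; field; lra.
have sP : s `^ P = (s `^ p) `^ k.
  by rewrite -powRrM; congr powR; rewrite /k; field; lra.
have sp : 0 < s `^ p by rewrite powR_gt0.
have up : 0 <= u `^ p by rewrite powR_ge0.
rewrite sE uP sP; set a := s `^ p in sp *; set b := u `^ p in up *.
have ba : (b / a) `^ k = b `^ k * (a `^ k)^-1.
  by rewrite powRM ?invr_ge0// ?ltW// -powR_inv1 ?(ltW sp)// -powRrM mulN1r powRN.
have ap : 0 < a `^ k by rewrite powR_gt0.
have bap : 0 <= b / a by rewrite divr_ge0// ltW.
have := bernoulli_powR bap k1.
rewrite ba => H.
have -> : a + p / (P - p) * (a * (a `^ k)^-1) * b `^ k =
          a + p / (P - p) * a * (b `^ k * (a `^ k)^-1) by ring.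
apply: le_trans (_ : a + p / (P - p) * a * (1 + k * (b / a - 1)) <= _); last first.
  by rewrite lerD2l ler_wpM2l// mulr_ge0// ltW.
have ck : p / (P - p) * k = 1 + p / (P - p).
  have Pp0 : P - p != 0 by rewrite subr_eq0 gt_eqF.
  have p0 : p != 0 by rewrite gt_eqF// (lt_le_trans ltr01).
  by rewrite /k; clear -Pp0 p0; field; rewrite p0 Pp0.
have aa : a * (b / a - 1) = b - a by rewrite mulrBr mulr1 mulrCA divff ?gt_eqF// mulr1.
have -> : a + p / (P - p) * a * (1 + k * (b / a - 1)) =
    a + p / (P - p) * a + p / (P - p) * k * (a * (b / a - 1)) by ring.
rewrite aa ck; set c := p / (P - p).
by rewrite le_eqVlt; apply/orP; left; apply/eqP; ring.
Qed.

End scalar.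

(** * Euclidean geometry *)

Section euclidean.
Context {R : realType}.

Lemma cauchy_schwarz_sum (I : finType) (f g : I -> R) :
  (\sum_i f i * g i) ^+ 2 <= (\sum_i f i ^+ 2) * (\sum_i g i ^+ 2).
Proof.
set a := \sum_i f i ^+ 2; set b := \sum_i f i * g i; set c := \sum_i g i ^+ 2.
have c0 : 0 <= c by apply: sumr_ge0 => i _; apply: sqr_ge0.
have H t : 0 <= a - 2 * t * b + t ^+ 2 * c.
  have -> : a - 2 * t * b + t ^+ 2 * c = \sum_i (f i - t * g i) ^+ 2.
    rewrite /a /b /c !mulr_sumr -sumrN -!big_split/=.
    by apply: eq_bigr => i _; ring.
  by apply: sumr_ge0 => i _; apply: sqr_ge0.
move: c0; rewrite le_eqVlt => /predU1P[c0|c0].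
  have g0 i : g i = 0.
    have /eqP := esym c0; rewrite psumr_eq0; last by move=> j _; apply: sqr_ge0.
    by move=> /allP /(_ i); rewrite mem_index_enum sqrf_eq0 => /(_ isT)/eqP.
  by rewrite /b -c0 mulr0 big1 ?expr0n// => i _; rewrite g0 mulr0.
have := H (b / c); rewrite -(pmulr_rge0 _ c0).
have -> : c * (a - 2 * (b / c) * b + (b / c) ^+ 2 * c) = a * c - b ^+ 2.
  by field; rewrite gt_eqF.
by rewrite subr_ge0.
Qed.

Lemma hsnorm_ge0 m n (A : 'M[R]_(m, n)) : 0 <= hsnorm A.
Proof. exact: sqrtr_ge0. Qed.

Lemma sqr_hsnorm m n (A : 'M[R]_(m, n)) : hsnorm A ^+ 2 = \sum_i \sum_j A i j ^+ 2.
Proof.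
rewrite sqr_sqrtr//; apply: sumr_ge0 => i _; apply: sumr_ge0 => j _.
exact: sqr_ge0.
Qed.

Lemma sqr_hsnorm_cV d (u : 'cV[R]_d) : hsnorm u ^+ 2 = \sum_i u i 0 ^+ 2.
Proof. by rewrite sqr_hsnorm; apply: eq_bigr => i _; rewrite big_ord1. Qed.

Lemma sqr_hsnorm_dotv d (u : 'cV[R]_d) : hsnorm u ^+ 2 = dotv u u.
Proof. by rewrite sqr_hsnorm_cV; apply: eq_bigr => i _; rewrite expr2. Qed.

Lemma hsnorm_entry m n (A : 'M[R]_(m, n)) i j : `|A i j| <= hsnorm A.
Proof.
rewrite -(@ler_sqr _ `|A i j|) ?nnegrE ?hsnorm_ge0// sqr_hsnorm real_normK ?num_real//.
rewrite (bigD1 i)//= (bigD1 j)//= -addrA lerDl addr_ge0//.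
  by apply: sumr_ge0 => l _; apply: sqr_ge0.
by apply: sumr_ge0 => k _; apply: sumr_ge0 => l _; apply: sqr_ge0.
Qed.

Lemma hsnormZ m n a (A : 'M[R]_(m, n)) : hsnorm (a *: A) = `|a| * hsnorm A.
Proof.
rewrite /hsnorm -sqrtr_sqr -sqrtrM ?sqr_ge0//; congr Num.sqrt.
rewrite mulr_sumr; apply: eq_bigr => i _; rewrite mulr_sumr.
by apply: eq_bigr => j _; rewrite mxE exprMn.
Qed.

Lemma hsnormN m n (A : 'M[R]_(m, n)) : hsnorm (- A) = hsnorm A.
Proof. by rewrite -scaleN1r hsnormZ normrN1 mul1r. Qed.

Lemma hsnormBC m n (A B : 'M[R]_(m, n)) : hsnorm (A - B) = hsnorm (B - A).
Proof. by rewrite -hsnormN opprB. Qed.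

Lemma hsnorm0 m n : hsnorm (0 : 'M[R]_(m, n)) = 0.
Proof. by rewrite -(scale0r (0 : 'M[R]_(m, n))) hsnormZ normr0 mul0r. Qed.

Lemma hsnorm_mulmx m n (A : 'M[R]_(m, n)) (v : 'cV[R]_n) :
  hsnorm (A *m v) <= hsnorm A * hsnorm v.
Proof.
rewrite -(@ler_sqr _ (hsnorm _)) ?nnegrE ?mulr_ge0 ?hsnorm_ge0// exprMn.
rewrite !sqr_hsnorm_cV sqr_hsnorm mulr_suml; apply: ler_sum => i _.
by rewrite mxE; apply: cauchy_schwarz_sum.
Qed.

Variable d : nat.
Implicit Types u v w : 'cV[R]_d.

Lemma dotvC u v : dotv u v = dotv v u.
Proof. by apply: eq_bigr => i _; rewrite mulrC. Qed.

Lemma dotvDl u v w : dotv (u + v) w = dotv u w + dotv v w.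
Proof. by rewrite /dotv -big_split/=; apply: eq_bigr => i _; rewrite mxE mulrDl. Qed.

Lemma dotvZl a u w : dotv (a *: u) w = a * dotv u w.
Proof. by rewrite /dotv mulr_sumr; apply: eq_bigr => i _; rewrite mxE mulrA. Qed.

Lemma dotvNl u w : dotv (- u) w = - dotv u w.
Proof. by rewrite -scaleN1r dotvZl mulN1r. Qed.

Lemma dotvDr u v w : dotv w (u + v) = dotv w u + dotv w v.
Proof. by rewrite dotvC dotvDl !(dotvC w). Qed.

Lemma dotvZr a u w : dotv w (a *: u) = a * dotv w u.
Proof. by rewrite dotvC dotvZl (dotvC w). Qed.

Lemma dotvNr u w : dotv w (- u) = - dotv w u.
Proof. by rewrite dotvC dotvNl (dotvC w). Qed.

Lemma dotvBr u v w : dotv w (u - v) = dotv w u - dotv w v.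
Proof. by rewrite dotvDr dotvNr. Qed.

Lemma sqr_hsnormD u v :
  hsnorm (u + v) ^+ 2 = hsnorm u ^+ 2 + 2 * dotv u v + hsnorm v ^+ 2.
Proof. by rewrite !sqr_hsnorm_dotv dotvDl !dotvDr (dotvC v u); ring. Qed.

Lemma sqr_hsnormB u v :
  hsnorm (u - v) ^+ 2 = hsnorm u ^+ 2 - 2 * dotv u v + hsnorm v ^+ 2.
Proof. by rewrite sqr_hsnormD dotvNr hsnormN mulrN. Qed.

Lemma ler_norm_dotv u v : `|dotv u v| <= hsnorm u * hsnorm v.
Proof.
rewrite -(@ler_sqr _ `|_|) ?nnegrE ?mulr_ge0 ?hsnorm_ge0// exprMn.
rewrite real_normK ?num_real// !sqr_hsnorm_cV.
exact: cauchy_schwarz_sum.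
Qed.

Lemma ler_dotv u v : dotv u v <= hsnorm u * hsnorm v.
Proof. exact: le_trans (ler_norm _) (ler_norm_dotv u v). Qed.

Lemma ler_hsnormD u v : hsnorm (u + v) <= hsnorm u + hsnorm v.
Proof.
rewrite -(@ler_sqr _ (hsnorm _)) ?nnegrE ?addr_ge0 ?hsnorm_ge0// sqr_hsnormD.
have := ler_dotv u v; nra.
Qed.

Lemma ler_sqr_hsnormD u v : hsnorm (u + v) ^+ 2 <= 2 * (hsnorm u ^+ 2 + hsnorm v ^+ 2).
Proof.
have := ler_hsnormD u v; have := hsnorm_ge0 (u + v).
have := hsnorm_ge0 u; have := hsnorm_ge0 v.
set a := hsnorm u; set b := hsnorm v; set c := hsnorm (u + v) => *.
by have := sqr_ge0 (a - b); nra.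
Qed.

Lemma hsnorm_ler_bound u e : (forall i, `|u i 0| <= e) -> 0 <= e ->
  hsnorm u <= d%:R * e.
Proof.
move=> ue e0; rewrite -(@ler_sqr _ (hsnorm _)) ?nnegrE ?mulr_ge0 ?hsnorm_ge0//.
rewrite sqr_hsnorm_cV exprMn.
apply: (@le_trans _ _ (\sum_(i < d) e ^+ 2)).
  apply: ler_sum => i _; rewrite -(real_normK (num_real _)).
  by rewrite ler_sqr ?nnegrE.
rewrite sumr_const card_ord -[leLHS]mulr_natl ler_wpM2r ?sqr_ge0// -natrX ler_nat.
by case: (d) => // k; rewrite leq_pmulr.
Qed.

(* Only second-order information survives: the linear term has mean zero for a
   centred increment [v], and the constant [2 P - 1] is attained when [v] is
   parallel to [z]. *)
Lemma powR_sqr_hsnormD k P z v (A := k + hsnorm z ^+ 2) : 1 <= k -> 2 <= P ->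
  (k + hsnorm (z + v) ^+ 2) `^ P <=
    A `^ P + P * A `^ (P - 1) * (2 * dotv z v +
      (2 * P - 1) * (hsnorm v ^+ 2 * (1 + hsnorm v) `^ (2 * P - 2))).
Proof.
move=> k1 P2.
have A1 : 1 <= A by rewrite /A; have := sqr_ge0 (hsnorm z); lra.
have A0 : 0 < A by lra.
have v0 := hsnorm_ge0 v.
set n := hsnorm v in v0 *.
pose y := 2 * dotv z v + n ^+ 2.
have E : k + hsnorm (z + v) ^+ 2 = A * (1 + y / A).
  by rewrite mulrDr mulr1 mulrCA divff ?gt_eqF// mulr1 sqr_hsnormD -/n /A /y; ring.
have x0 : 0 <= 1 + y / A.
  by rewrite -(pmulr_rge0 _ A0) -E; have := sqr_ge0 (hsnorm (z + v)); lra.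
pose N := (1 + n) `^ (2 * P - 2).
have sA : exists2 q, 1 <= q & q ^+ 2 = A.
  exists (Num.sqrt A); last by rewrite sqr_sqrtr ?ltW.
  by have := ler_wsqrtr A1; rewrite sqrtr1.
have [q q1 qA] := sA.
have zq : hsnorm z <= q.
  rewrite -(@ler_sqr _ (hsnorm z)) ?nnegrE ?hsnorm_ge0//; last lra.
  by rewrite qA /A; lra.
have dq : `|dotv z v| <= q * n.
  by apply: le_trans (ler_norm_dotv z v) _; rewrite ler_wpM2r.
have xn : 1 + y / A <= (1 + n) ^+ 2.
  rewrite -(ler_pM2l A0) -E sqr_hsnormD -/n.
  have := ler_dotv z v; rewrite -/n => zv.
  have : 2 * dotv z v <= A * (2 * n).
    have : dotv z v <= q * n by apply: le_trans zv _; rewrite ler_wpM2r.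
    have : q * n <= q ^+ 2 * n by rewrite ler_wpM2r// expr2 ler_peMl//; lra.
    by rewrite -qA; lra.
  have : 0 <= (A - 1) * n ^+ 2 by rewrite mulr_ge0 ?sqr_ge0// subr_ge0.
  have -> : k + (hsnorm z ^+ 2 + 2 * dotv z v + n ^+ 2) = A + 2 * dotv z v + n ^+ 2.
    by rewrite /A; ring.
  by lra.
have N1 : 1 <= N.
  by rewrite -[leLHS](powRr0 (1 + n)) ler_powR; lra.
have Nn : (1 + n) `^ 2 * (1 + n) `^ (2 * P - 4) = N.
  by rewrite -powRD; [congr powR; ring | rewrite (@gt_eqF _ _ (1 + n)) ?implybT//; lra].
(* The ratio [x = 1 + y / A] is at most [(1 + n)^2], so the weight [x^(P - 2)] of the expansion
   above 1 is at most [(1 + n)^(2 P - 4)]. *)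
have K : (1 + y / A) `^ P <= 1 + P * (y / A) + P * (P - 1) / 2 * (y / A) ^+ 2 *
           (1 + n) `^ (2 * P - 4).
  have c0 : 0 <= P * (P - 1) / 2 * (y / A) ^+ 2.
    by rewrite mulr_ge0 ?sqr_ge0//; nra.
  have n4 : 1 <= (1 + n) `^ (2 * P - 4) by rewrite -[leLHS](powRr0 (1 + n)) ler_powR; lra.
  have e1 : 1 + y / A - 1 = y / A by rewrite addrAC subrr add0r.
  case: (leP (1 + y / A) 1) => x1.
    have := powR_taylor2_lt1 (x := 1 + y / A) (P := P).
    rewrite x0 x1 => /(_ isT P2); rewrite e1 => /le_trans; apply.
    by rewrite lerD2l ler_peMr.
  have := powR_taylor2_gt1 (ltW x1) P2.
  rewrite e1 => /le_trans; apply.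
  rewrite lerD2l ler_wpM2l//.
  have -> : 2 * P - 4 = 2 * (P - 2) by ring.
  rewrite powRrM powR_mulrn; last lra.
  by apply: ge0_ler_powR; rewrite ?nnegrE ?sqr_ge0//; lra.
rewrite E powRM ?(ltW A0)//.
have AP : A `^ P = A * A `^ (P - 1) by rewrite mulr_powRB1 ?ltW//; lra.
have AP0 : 0 < A `^ (P - 1) by rewrite powR_gt0.
apply: le_trans (ler_wpM2l (powR_ge0 _ _) K) _.
rewrite [leLHS]mulrDr (mulrDr (A `^ P) 1) mulr1 -addrA lerD2l.
(* [y] is of first order in [v]: its square costs [4 A n^2], which gives [(P - 1) / 2 * 4 = 2 P - 2]
   below. The missing 1 of [2 P - 1] is the term [n^2] contained in [y]. *)
have y2 : y ^+ 2 <= A * (4 * n ^+ 2 * (1 + n) ^+ 2).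
  have ly : `|y| <= 2 * q * n * (1 + n).
    apply: le_trans (ler_normD _ _) _; rewrite normrM (ger0_norm (sqr_ge0 n)) ger0_norm//.
    by nra.
  rewrite -(real_normK (num_real y)) -qA.
  have -> : q ^+ 2 * (4 * n ^+ 2 * (1 + n) ^+ 2) = (2 * q * n * (1 + n)) ^+ 2 by ring.
  by rewrite ler_sqr ?nnegrE// !mulr_ge0//; lra.
have -> : A `^ P * (P * (y / A)) = P * A `^ (P - 1) * y.
  by rewrite AP; field; rewrite gt_eqF.
have -> : A `^ P * (P * (P - 1) / 2 * (y / A) ^+ 2 * (1 + n) `^ (2 * P - 4)) =
   P * A `^ (P - 1) * ((P - 1) / 2 * (1 + n) `^ (2 * P - 4) * (y ^+ 2 / A)).
  by rewrite AP; field; rewrite gt_eqF.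
rewrite -!mulrDr ler_wpM2l//; first by rewrite mulr_ge0 ?ltW//; lra.
rewrite -/n -/N /y -addrA lerD2l.
have : (P - 1) / 2 * (1 + n) `^ (2 * P - 4) * (y ^+ 2 / A) <= 2 * (P - 1) * (n ^+ 2 * N).
  rewrite -Nn powR_mulrn; last lra.
  have -> : 2 * (P - 1) * (n ^+ 2 * ((1 + n) ^+ 2 * (1 + n) `^ (2 * P - 4))) =
    (P - 1) / 2 * (1 + n) `^ (2 * P - 4) * (4 * n ^+ 2 * (1 + n) ^+ 2) by field.
  rewrite ler_wpM2l//; first by rewrite mulr_ge0 ?powR_ge0//; lra.
  by rewrite ler_pdivrMr// mulrC.
have := sqr_ge0 n; rewrite /y; nra.
Qed.

End euclidean.

(** * Measurability with respect to a sub-sigma-algebra *)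

Section sub_measurable.
Context {R : realType} {dT : measure_display} {T : measurableType dT}.
Implicit Types (G H : set (set T)) (Y Z : T -> R).

(** Measurability on the space carrying the generated sigma-algebra, so that closure properties are
    instances of the ordinary ones; for a sigma-algebra [G] this is the usual notion by
    [measurable_wrtP]. *)
Definition measurable_wrt G Y : Prop :=
  measurable_fun [set: g_sigma_algebraType G] (Y : g_sigma_algebraType G -> R).

Lemma measurable_wrtP G Y : sigma_algebra setT G ->
  measurable_wrt G Y <-> (forall B, measurable B -> G (Y @^-1` B)).
Proof.
move=> sG; have E : <<s G >> = G by apply: sigma_algebra_id.
split=> [mY B mB|GY _ B mB].
  by have := mY measurableT B mB; rewrite setTI /measurable/= E.
by rewrite setTI /measurable/= E; apply: GY.
Qed.

Lemma sub_measurable_wrt G H Y : G `<=` H -> measurable_wrt G Y -> measurable_wrt H Y.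
Proof.
move=> GH mY _ B mB; have := mY measurableT B mB.
by rewrite /measurable/=; apply: sub_sigma_algebra2.
Qed.

Lemma measurable_wrt_measurable G Y : G `<=` measurable ->
  measurable_wrt G Y -> measurable_fun setT Y.
Proof.
move=> GH mY _ B mB; have := mY measurableT B mB.
have E : <<s (@measurable _ T) >> = measurable.
  by apply: sigma_algebra_id; exact: sigma_algebra_measurable.
move=> GB; rewrite -E; move: GB.
by rewrite /measurable/=; apply: sub_sigma_algebra2.
Qed.

Lemma measurable_wrt_cst G a : measurable_wrt G (fun=> a).
Proof. exact: measurable_cst. Qed.

Lemma measurable_wrtD G Y Z : measurable_wrt G Y -> measurable_wrt G Z ->
  measurable_wrt G (fun w => Y w + Z w).
Proof. exact: measurable_funD. Qed.

Lemma measurable_wrtB G Y Z : measurable_wrt G Y -> measurable_wrt G Z ->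
  measurable_wrt G (fun w => Y w - Z w).
Proof. exact: measurable_funB. Qed.

Lemma measurable_wrtM G Y Z : measurable_wrt G Y -> measurable_wrt G Z ->
  measurable_wrt G (fun w => Y w * Z w).
Proof. exact: measurable_funM. Qed.

Lemma measurable_wrt_max G Y Z : measurable_wrt G Y -> measurable_wrt G Z ->
  measurable_wrt G (fun w => Num.max (Y w) (Z w)).
Proof. exact: measurable_maxr. Qed.

Lemma measurable_wrt_comp G (f : R -> R) Y : measurable_fun setT f ->
  measurable_wrt G Y -> measurable_wrt G (fun w => f (Y w)).
Proof. exact: measurableT_comp. Qed.

Lemma measurable_wrt_powR G p Y : measurable_wrt G Y ->
  measurable_wrt G (fun w => Y w `^ p).
Proof. by apply: (@measurable_wrt_comp G (fun x => x `^ p)); exact: measurable_powR. Qed.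

Lemma measurable_wrtX G n Y : measurable_wrt G Y ->
  measurable_wrt G (fun w => Y w ^+ n).
Proof.
apply: (@measurable_wrt_comp G (fun x => x ^+ n)).
by apply: continuous_measurable_fun; exact: exprn_continuous.
Qed.

Lemma measurable_wrt_sum G (I : Type) (s : seq I) (f : I -> T -> R) :
  (forall i, measurable_wrt G (f i)) -> measurable_wrt G (fun w => \sum_(i <- s) f i w).
Proof. by move=> mf; exact: measurable_sum. Qed.

Lemma measurable_wrt_sqr_hsnorm G m n (A : T -> 'M[R]_(m, n)) :
  (forall i j, measurable_wrt G (fun w => A w i j)) ->
  measurable_wrt G (fun w => hsnorm (A w) ^+ 2).
Proof.
move=> mA; rewrite (_ : (fun w => _) = fun w => \sum_i \sum_j A w i j ^+ 2).
  by do 2 (apply: measurable_wrt_sum => ?); apply: measurable_wrtX.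
by apply/funext => w; rewrite sqr_hsnorm.
Qed.

Lemma measurable_wrt_mulmx G m n (A : T -> 'M[R]_(m, n)) (v : T -> 'cV[R]_n) :
  (forall i j, measurable_wrt G (fun w => A w i j)) ->
  (forall i, measurable_wrt G (fun w => v w i 0)) ->
  forall i, measurable_wrt G (fun w => (A w *m v w) i 0).
Proof.
move=> mA mv i.
rewrite (_ : (fun w => _) = fun w => \sum_j A w i j * v w j 0).
  by apply: measurable_wrt_sum => j; apply: measurable_wrtM.
by apply/funext => w; rewrite mxE.
Qed.

Lemma mem_bigsetI (U : Type) (d : nat) (F : 'I_d -> set U) (w : U) :
  (\big[setI/setT]_(i < d) F i) w <-> forall i, F i w.
Proof.
rewrite -bigcap_seq; split=> [H i|H i _]; last exact: H.
by apply: H; rewrite /= mem_index_enum.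
Qed.

Lemma cvg_entries (d : nat) (u : nat -> 'cV[R]_d) (v : 'cV[R]_d) :
  (forall i, u n i 0 @[n --> \oo] --> v i 0) -> u n @[n --> \oo] --> v.
Proof.
move=> uv; apply/cvg_ballP => e e0.
have H i : \forall n \near \oo, ball (v i 0) e (u n i 0).
  by move/cvg_ballP : (uv i); apply.
change (\forall n \near \oo, ball v e (u n)).
apply: filterS (filter_forall _ H) => n Hn; split => // i j.
by rewrite ord1; exact: Hn.
Qed.

(** The vector is known only through its coordinates. Rounding each of them down to a multiple of
    [1 / (n + 1)] leaves countably many values, for which a preimage is a countable union of boxes;
    continuity of [f] then allows passing to the limit. *)
Lemma measurable_wrt_continuous G (d : nat) (f : 'cV[R]_d -> R) (X : T -> 'cV[R]_d) :
  continuous f -> (forall i, measurable_wrt G (fun w => X w i 0)) ->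
  measurable_wrt G (fun w => f (X w)).
Proof.
move=> cf mX.
pose q n (x : 'cV[R]_d) : 'cV[R]_d :=
  \col_i ((Num.floor (x i 0 * n.+1%:R))%:~R / n.+1%:R).
apply: (@measurable_fun_cvg _ (g_sigma_algebraType G) R setT (fun n w => f (q n (X w)))).
- move=> n _ B mB; rewrite setTI.
  pose c (k : {ffun 'I_d -> int}) : 'cV[R]_d := \col_i ((k i)%:~R / n.+1%:R).
  have -> : (fun w => f (q n (X w))) @^-1` B =
     \bigcup_(k in [set k : {ffun 'I_d -> int} | B (f (c k))])
       \big[setI/setT]_(i < d)
         ((fun w => X w i 0 * n.+1%:R) @^-1` `[(k i)%:~R, (k i)%:~R + 1[%classic).
    apply/seteqP; split=> [w Bw|w [k /= Bk]].
      exists [ffun i => Num.floor (X w i 0 * n.+1%:R)] => /=.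
        suff -> : c [ffun i => Num.floor (X w i 0 * n.+1%:R)] = q n (X w) by [].
        by apply/matrixP => i j; rewrite !mxE ffunE.
      apply/mem_bigsetI => i /=.
      by rewrite ffunE in_itv/=; have := floor_itv (X w i 0 * n.+1%:R); rewrite intrD.
    move/mem_bigsetI => H /=.
    suff -> : q n (X w) = c k by [].
    apply/matrixP => i j; rewrite !mxE; congr (_%:~R / _).
    have := H i; rewrite /= in_itv/= => ki.
    by apply: floor_def; rewrite intrD.
  rewrite bigcup_mkcond.
  apply: (@countable_bigcupT_measurable _ (g_sigma_algebraType G)) => // k.
  case: ifPn => // _; apply: bigsetI_measurable => i _.
  have := measurable_wrtM (mX i) (measurable_wrt_cst n.+1%:R).
  by move=> /(_ measurableT _ (measurable_itv `[(k i)%:~R, (k i)%:~R + 1[)); rewrite setTI.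
- move=> w _; apply: continuous_cvg; first exact: cf.
  apply: cvg_entries => i.
  apply/cvgrPdist_le => e e0; near=> n.
  rewrite mxE; set x := X w i 0; have /andP[f1 f2] := floor_itv (x * n.+1%:R).
  have n0 : (0 : R) < n.+1%:R by rewrite ltr0n.
  have [g1 g2] : (Num.floor (x * n.+1%:R))%:~R / n.+1%:R <= x /\
    x <= (Num.floor (x * n.+1%:R))%:~R / n.+1%:R + n.+1%:R^-1.
    split; first by rewrite ler_pdivrMr.
    by rewrite -[X in _ + X]mul1r -mulrDl ler_pdivlMr// ltW//; move: f2; rewrite intrD.
  rewrite ger0_norm ?subr_ge0// lerBlDl.
  apply: le_trans g2 _; rewrite lerD2l.
  by apply: ltW; near: n; exact: (near_infty_natSinv_lt (PosNum e0)).
Unshelve. all: by end_near.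
Qed.

End sub_measurable.

(** * Independence and Gaussian integrals *)

Section independence.
Context {R : realType} {dT : measure_display} {T : measurableType dT}.
Variable Pr : probability T R.
Local Open Scope ereal_scope.

(** The joint law agrees with the product of the marginal laws on rectangles, hence everywhere, and
    Fubini's theorem computes the integral. *)
Lemma integralM_indep (Y Z : T -> R) :
  measurable_fun setT Y -> measurable_fun setT Z ->
  (forall A B : set R, measurable A -> measurable B ->
     Pr (Y @^-1` A `&` Z @^-1` B) = Pr (Y @^-1` A) * Pr (Z @^-1` B)) ->
  Pr.-integrable setT (EFin \o Y) -> Pr.-integrable setT (EFin \o Z) ->
  Pr.-integrable setT (fun w => (Y w * Z w)%:E) /\
  \int[Pr]_w (Y w * Z w)%:E = (\int[Pr]_w (Y w)%:E) * (\int[Pr]_w (Z w)%:E).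
Proof.
move=> mY mZ ind iY iZ.
pose Y' : {mfun T >-> R} := HB.pack Y (isMeasurableFun.Build _ _ _ _ _ mY).
pose Z' : {mfun T >-> R} := HB.pack Z (isMeasurableFun.Build _ _ _ _ _ mZ).
pose phi w := (Y w, Z w).
have mphi : measurable_fun setT phi by apply: measurable_fun_pair.
pose phi' : {mfun T >-> (R * R)%type} :=
  HB.pack phi (isMeasurableFun.Build _ _ _ _ _ mphi).
pose mu := distribution Pr phi'.
pose m1 := distribution Pr Y'.
pose m2 := distribution Pr Z'.
have E : forall X : set (R * R), measurable X -> (m1 \x m2) X = mu X.
  by apply: product_measure_unique => A B mA mB; exact: ind.
pose f (z : R * R) := (z.1 * z.2)%:E.
have mf : measurable_fun setT f.
  apply/measurable_EFinP; exact: measurable_funM.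
have iY1 : m1.-integrable setT (EFin : R -> \bar R).
  by apply: (integrable_pushforward mY).
have iZ1 : m2.-integrable setT (EFin : R -> \bar R).
  by apply: (integrable_pushforward mZ).
have fi : (m1 \x m2).-integrable setT f.
  apply/(integrable12ltyP _ _ mf).
  under eq_integral => x _.
    under eq_integral => y _ do rewrite /f/= normrM EFinM.
    rewrite ge0_integralZl//=; last by apply: measurableT_comp.
    over.
  have /integrableP[_ /= ltZ] := iZ1.
  have /integrableP[_ /= ltY] := iY1.
  rewrite ge0_integralZr//=; last by apply: integral_ge0.
    by rewrite lte_mul_pinfty// ?integral_ge0// ge0_fin_numE ?integral_ge0.
  by apply/measurable_EFinP; exact: normr_measurable.
have fi' : mu.-integrable setT f.
  apply/integrableP; split => //.
  rewrite (eq_measure_integral (m1 \x m2)); last by move=> A mA _; apply: esym; exact: E.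
  by have /integrableP[] := fi.
have fphi : Pr.-integrable setT (f \o phi).
  apply/integrableP; split; first exact: measurableT_comp.
  have /integrableP[_] := fi'.
  by rewrite /mu /distribution ge0_integral_pushforward//; exact: measurableT_comp.
split; first exact: fphi.
transitivity (\int[mu]_z f z).
  by rewrite /mu /distribution (integral_pushforward mphi).
rewrite (eq_measure_integral (m1 \x m2)); last by move=> A mA _; apply: esym; exact: E.
rewrite -(integral12_prod_meas1 fi) /fubini_F.
transitivity (\int[m1]_x (x%:E * \int[m2]_y y%:E)).
  by apply: eq_integral => x _; rewrite -integralZl.
rewrite -(fineK (integrable_fin_num measurableT iZ1)) integralZr//.
by congr (_ * _); rewrite ?(fineK (integrable_fin_num measurableT iZ1));
  rewrite /distribution integral_pushforward.
Qed.

Import HBNNSimple.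

(* [f] need not be measurable: its integral is a supremum over the simple
   functions below [f]. *)
Lemma ae_ge0_le_integralT (f g : T -> \bar R) :
  (forall w, 0 <= f w) -> (forall w, 0 <= g w) -> measurable_fun setT g ->
  {ae Pr, forall w, f w <= g w} -> \int[Pr]_w f w <= \int[Pr]_w g w.
Proof.
move=> f0 g0 mg fg; rewrite ge0_integralTE//.
apply: ge_ereal_sup => _ [h /= hf <-].
rewrite -integralT_nnsfun; apply: ae_ge0_le_integral => //.
- by move=> w _; rewrite lee_fin.
- by apply/measurable_EFinP; exact: measurable_funP.
- by apply: filterS fg => w fgw _; apply: le_trans fgw; exact: hf.
Qed.

End independence.

(** * Moments of the centred normal law *)

Section gaussian.
Context {R : realType}.
Local Notation mu := (@lebesgue_measure R).

(** The Radon-Nikodym derivative of [normal_prob] agrees almost everywhere with [normal_pdf], since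
    both have the same integral over every measurable set. *)
Lemma ge0_integral_normal_prob (s : R) (f : R -> R) : measurable_fun setT f ->
  (forall x, 0 <= f x) ->
  (\int[normal_prob 0 s]_x (f x)%:E = \int[mu]_x (f x * normal_pdf 0 s x)%:E)%E.
Proof.
move=> mf f0.
have dom := normal_prob_dominates 0 s.
rewrite -(Radon_Nikodym_SigmaFinite.change_of_variables dom)//=; last first.
  exact/measurable_EFinP.
under [RHS]eq_integral do rewrite EFinM.
have mg := measurable_int _ (Radon_Nikodym_SigmaFinite.f_integrable dom).
apply: ae_eq_integral => //.
- by apply: emeasurable_funM => //; exact/measurable_EFinP.
- apply: emeasurable_funM; first exact/measurable_EFinP.
  by apply/measurable_EFinP; exact: measurable_normal_pdf.
- apply: ae_eqe_mul2l => /=.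
  apply: integral_ae_eq => //=.
  + exact: Radon_Nikodym_SigmaFinite.f_integrable.
  + by apply/measurable_EFinP; exact: measurable_normal_pdf.
  + by move=> E _ mE; rewrite -Radon_Nikodym_SigmaFinite.f_integral.
Qed.

Lemma normal_pdf0N (s x : R) : s != 0 -> normal_pdf 0 s (- x) = normal_pdf 0 s x.
Proof. by move=> s0; rewrite !normal_pdfE// /normal_fun !subr0 sqrrN. Qed.

Lemma normal_probN (s : R) (f : R -> R) : s != 0 -> measurable_fun setT f ->
  (forall x, 0 <= f x) ->
  (\int[normal_prob 0 s]_x (f (- x))%:E = \int[normal_prob 0 s]_x (f x)%:E)%E.
Proof.
move=> s0 mf f0; rewrite !ge0_integral_normal_prob//; last first.
  by apply: measurableT_comp.
pose g x := (f x * normal_pdf 0 s x)%:E.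
have mN : measurable_fun [set: measurableTypeR R] (-%R : measurableTypeR R -> measurableTypeR R).
  exact: oppr_measurable.
have mg : measurable_fun setT g.
  by apply/measurable_EFinP; apply: measurable_funM => //; exact: measurable_normal_pdf.
have g0 x : (0 <= g x)%E by rewrite lee_fin mulr_ge0// normal_pdf_ge0.
transitivity (\int[mu]_x g (- x)%R)%E.
  by apply: eq_integral => x _; rewrite /g normal_pdf0N.
rewrite -[LHS](ge0_integral_pushforward mN _ (D := setT) (f := g))//.
by apply: eq_measure_integral => A mA _; exact: lebesgue_measureN.
Qed.

Lemma normal_peakE (s : R) : 0 < s -> normal_peak s = (s * Num.sqrt (pi *+ 2))^-1.
Proof.
by move=> s0; rewrite /normal_peak -mulrnAr sqrtrM ?sqr_ge0// sqrtr_sqr gtr0_norm.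
Qed.

(** The inequality [1 + c x^2 <= exp (c x^2)] with [c = (s^-2 - t^-2) / 2] bounds [1 + c x^2] times
    the density for [s] by [t / s] times the density for [t > s]. Integrating gives
    [1 + c m2 <= t / s], that is [m2 <= 2 s t^2 / (t + s)], which tends to [s^2] as [t] decreases to
    [s]. The sharp constant matters: [one_step_le] has only the factor [1 + eta] to spare. *)
Lemma normal_prob_sqr_le (s : R) : 0 < s ->
  (\int[normal_prob 0 s]_x (x ^+ 2)%:E <= (s ^+ 2)%:E)%E.
Proof.
move=> s0.
have mX : measurable_fun setT (fun x : R => x ^+ 2).
  by apply: continuous_measurable_fun; exact: exprn_continuous.
have H t : s < t -> (\int[normal_prob 0 s]_x (x ^+ 2)%:E
    <= (2 * s * t ^+ 2 / (t + s))%:E)%E.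
  move=> st; have t0 : 0 < t by apply: lt_trans st.
  pose c := 2^-1 * (s ^- 2 - t ^- 2).
  have c0 : 0 < c.
    by rewrite mulr_gt0// subr_gt0 ltf_pV2 ?posrE ?exprn_gt0// ltr_pXn2r ?nnegrE ?ltW.
  have pw x : c * (x ^+ 2 * normal_pdf 0 s x) + normal_pdf 0 s x
      <= t / s * normal_pdf 0 t x.
    rewrite !normal_pdfE ?gt_eqF//.
    have tpk : t / s * normal_peak t = normal_peak s.
      rewrite !normal_peakE//; field.
      by rewrite !gt_eqF// sqrtr_gt0 mulrn_wgt0// pi_gt0.
    rewrite [leRHS]mulrA tpk.
    have -> : c * (x ^+ 2 * (normal_peak s * normal_fun 0 s x)) +
       normal_peak s * normal_fun 0 s x =
       normal_peak s * ((1 + c * x ^+ 2) * normal_fun 0 s x) by ring.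
    rewrite ler_wpM2l ?normal_peak_ge0// /normal_fun.
    have -> : - (x - 0) ^+ 2 / (t ^+ 2 *+ 2) = c * x ^+ 2 + - (x - 0) ^+ 2 / (s ^+ 2 *+ 2).
      rewrite /c subr0 -(mulr_natl (t ^+ 2)) -(mulr_natl (s ^+ 2)); field.
      by rewrite !gt_eqF.
    by rewrite expRD ler_wpM2r ?expR_ge0// expR_ge1Dx.
  rewrite ge0_integral_normal_prob//; last by move=> x; exact: sqr_ge0.
  set m2 := (\int[mu]_x _)%E.
  have ms u : measurable_fun setT (normal_pdf 0 u : R -> R).
    exact: measurable_normal_pdf.
  have : (c%:E * m2 + 1 <= (t / s)%:E)%E.
    have <- : (\int[mu]_x (t / s * normal_pdf 0 t x)%:E = (t / s)%:E)%E.
      under eq_integral do rewrite EFinM.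
      rewrite ge0_integralZl_EFin//=.
      + by rewrite integral_normal_pdf mule1.
      + by move=> x _; rewrite lee_fin normal_pdf_ge0.
      + by apply/measurable_EFinP; exact: ms.
      + by rewrite divr_ge0// ltW.
    rewrite -(integral_normal_pdf 0 s) /m2 -ge0_integralZl_EFin//=; last 3 first.
    + by move=> x _; rewrite lee_fin mulr_ge0 ?sqr_ge0 ?normal_pdf_ge0.
    + by apply/measurable_EFinP; apply: measurable_funM => //; exact: ms.
    + exact: ltW.
    rewrite -ge0_integralD//=; last 4 first.
    + move=> x _; rewrite -EFinM lee_fin; apply: mulr_ge0; first exact: ltW.
      by rewrite mulr_ge0 ?sqr_ge0 ?normal_pdf_ge0.
    + apply: measurable_funeM; apply/measurable_EFinP.
      by apply: measurable_funM => //; exact: ms.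
    + by move=> x _; rewrite lee_fin normal_pdf_ge0.
    + by apply/measurable_EFinP; exact: ms.
    apply: ge0_le_integral => //=.
    + move=> x _; rewrite -EFinM -EFinD lee_fin addr_ge0 ?normal_pdf_ge0//.
      by apply: mulr_ge0; [exact: ltW|rewrite mulr_ge0 ?sqr_ge0 ?normal_pdf_ge0].
    + apply: emeasurable_funD; last by apply/measurable_EFinP; exact: ms.
      apply: measurable_funeM; apply/measurable_EFinP.
      by apply: measurable_funM => //; exact: ms.
    + by apply/measurable_EFinP; apply: measurable_funM => //; exact: ms.
    + by move=> x _; rewrite -EFinM -EFinD lee_fin.
  have m20 : (0 <= m2)%E.
    by apply: integral_ge0 => x _; rewrite lee_fin mulr_ge0 ?sqr_ge0 ?normal_pdf_ge0.
  case: m2 m20 => [r| |] //= r0; last by rewrite gt0_muley// ?lte_fin//=.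
  rewrite -EFinM -EFinD !lee_fin => cr.
  have {}cr : r <= (t / s - 1) / c by rewrite ler_pdivlMr// mulrC; lra.
  apply: le_trans cr _; rewrite le_eqVlt; apply/orP; left; apply/eqP.
  rewrite /c; field.
  have st2 : s ^+ 2 < t ^+ 2 by rewrite ltr_pXn2r ?nnegrE ?ltW.
  by rewrite mulN1r subr_eq0 (gt_eqF st2) !gt_eqF ?addr_gt0.
apply/lee_addgt0Pr => e e0.
pose t := s + Num.min s (e / (3 * s)).
have mt0 : 0 < Num.min s (e / (3 * s)) by rewrite lt_min s0 divr_gt0// mulr_gt0.
apply: le_trans (H t _) _; first by rewrite /t ltrDl.
rewrite -EFinD lee_fin ler_pdivrMr /t; last by lra.
set z := Num.min s _ in mt0 *.
have zs : z <= s by rewrite /z ge_min lexx.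
have ze : 3 * s * z <= e.
  by rewrite mulrC -ler_pdivlMr ?mulr_gt0// /z ge_min lexx orbT.
nra.
Qed.

(* Substituting [x = s t], the density of [N(0, s^2)] beats the integrand down to
   a multiple of the density of [N(0, 2 s^2)]. *)
Lemma normal_prob_cubic (q a : R) : 0 <= q -> 0 <= a ->
  exists C : R, 0 <= C /\ forall s : R, 0 < s <= 1 ->
  (\int[normal_prob 0 s]_x (x ^+ 2 * ((1 + a * `|x|) `^ q - 1))%:E
    <= (C * s ^+ 3)%:E)%E.
Proof.
(* With [u = |x| / s], the bound [u^3 <= exp (3 u)] accounts for the 3. Then [b u <= b^2 + u^2 / 4]
   produces the factor [exp (b^2)] of [C], and [sqrt 2] is the ratio of the two normalizing
   constants. *)
move=> q0 a0; pose b := 3 + q * a.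
pose C := q * a * expR (b ^+ 2) * Num.sqrt 2.
have C0 : 0 <= C by rewrite !mulr_ge0 ?expR_ge0.
exists C; split => // s /andP[s0 s1].
have s20 : 0 < Num.sqrt 2 :> R by rewrite sqrtr_gt0.
pose t := Num.sqrt 2 * s; have t0 : 0 < t by rewrite mulr_gt0.
pose f x := x ^+ 2 * ((1 + a * `|x|) `^ q - 1).
have ge1 x : 1 <= 1 + a * `|x| by rewrite lerDl mulr_ge0.
have f0 x : 0 <= f x.
  rewrite mulr_ge0 ?sqr_ge0// subr_ge0 -[leLHS](powRr0 (1 + a * `|x|)).
  exact: ler_powR.
have mf : measurable_fun setT f.
  apply: measurable_funM.
    by apply: continuous_measurable_fun; exact: exprn_continuous.
  apply: measurable_funB => //.
  apply: (measurableT_comp (measurable_powR q)).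
  by apply: measurable_funD => //; apply: measurable_funM => //; exact: normr_measurable.
have pw x : f x * normal_pdf 0 s x <= C * s ^+ 3 * normal_pdf 0 t x.
  pose u := `|x| / s; have u0 : 0 <= u by rewrite divr_ge0// ltW.
  have xu : `|x| = s * u by rewrite /u mulrCA divff ?gt_eqF// mulr1.
  have x2 : x ^+ 2 = (s * u) ^+ 2 by rewrite -xu real_normK ?num_real.
  clearbody u; have sge0 := ltW s0.
  have fE : f x <= q * a * s ^+ 3 * expR (b * u).
    have v0 : 0 <= q * (a * `|x|) by rewrite !mulr_ge0.
    have h1 : (1 + a * `|x|) `^ q <= expR (q * (a * `|x|)).
      rewrite (mulrC q) expRM; apply: ge0_ler_powR; rewrite ?nnegrE ?expR_ge0//.
        by rewrite (le_trans ler01).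
      exact: expR_ge1Dx.
    have h2 : expR (q * (a * `|x|)) - 1 <= q * (a * `|x|) * expR (q * (a * `|x|)).
      set v := q * _ in v0 *.
      have : 1 - v <= expR (- v) by exact: expR_ge1Dx.
      rewrite expRN -(ler_pM2r (expR_gt0 v)) mulVf ?gt_eqF ?expR_gt0//; lra.
    have h3 : q * (a * `|x|) * expR (q * (a * `|x|)) <= q * a * s * u * expR (q * a * u).
      rewrite xu; have -> : q * (a * (s * u)) = q * a * s * u by ring.
      apply: ler_wpM2l; first by rewrite !mulr_ge0.
      by rewrite ler_expR ler_wpM2r// ler_piMr ?mulr_ge0.
    have h4 : u ^+ 3 * expR (q * a * u) <= expR (b * u).
      have -> : b * u = 3%:R * u + q * a * u by rewrite /b; ring.
      rewrite expRD expRM_natl ler_wpM2r ?expR_ge0//.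
      rewrite ler_pXn2r ?nnegrE ?expR_ge0//.
      by apply: le_trans (expR_ge1Dx u); rewrite lerDr.
    rewrite /f x2; apply: le_trans (_ : (s * u) ^+ 2 * (q * a * s * u * expR (q * a * u)) <= _).
      by rewrite ler_wpM2l ?sqr_ge0//; lra.
    have -> : (s * u) ^+ 2 * (q * a * s * u * expR (q * a * u)) =
       q * a * s ^+ 3 * (u ^+ 3 * expR (q * a * u)) by ring.
    by rewrite ler_wpM2l// !mulr_ge0// exprn_ge0// ltW.
  have hb : expR (b * u) <= expR (b ^+ 2) * expR (u ^+ 2 / 4).
    by rewrite -expRD ler_expR; have := sqr_ge0 (b - u / 2); nra.
  have pk : normal_peak s = Num.sqrt 2 * normal_peak t.
    rewrite !normal_peakE// /t; field.
    by rewrite !gt_eqF// sqrtr_gt0 mulrn_wgt0// pi_gt0.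
  have fs : normal_fun 0 s x = expR (- (u ^+ 2 / 2)).
    rewrite /normal_fun subr0 x2 -(mulr_natl (s ^+ 2)); congr expR; field.
    by rewrite gt_eqF.
  have ft : normal_fun 0 t x = expR (- (u ^+ 2 / 4)).
    have t2 : t ^+ 2 = 2 * s ^+ 2 by rewrite /t exprMn sqr_sqrtr.
    rewrite /normal_fun subr0 x2 -(mulr_natl (t ^+ 2)) t2; congr expR; field.
    by rewrite gt_eqF.
  rewrite !normal_pdfE ?gt_eqF// fs ft pk.
  apply: le_trans (_ : q * a * s ^+ 3 * (expR (b ^+ 2) * expR (u ^+ 2 / 4)) *
     (Num.sqrt 2 * normal_peak t * expR (- (u ^+ 2 / 2))) <= _).
    rewrite ler_wpM2r ?mulr_ge0 ?normal_peak_ge0 ?expR_ge0// (le_trans fE)//.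
    by rewrite ler_wpM2l// !mulr_ge0// exprn_ge0// ltW.
  have -> : expR (- (u ^+ 2 / 4)) = expR (u ^+ 2 / 4) * expR (- (u ^+ 2 / 2)).
    by rewrite -expRD; congr expR; field.
  by rewrite /C le_eqVlt; apply/orP; left; apply/eqP; ring.
rewrite ge0_integral_normal_prob//.
have ms : measurable_fun setT (normal_pdf 0 t : R -> R) by exact: measurable_normal_pdf.
apply: le_trans (_ : \int[mu]_x (C * s ^+ 3 * normal_pdf 0 t x)%:E <= _)%E.
  apply: ge0_le_integral => //=.
  - by move=> x _; rewrite lee_fin mulr_ge0 ?f0 ?normal_pdf_ge0.
  - apply/measurable_EFinP; apply: measurable_funM; first exact: mf.
    exact: measurable_normal_pdf.
  - by apply/measurable_EFinP; apply: measurable_funM.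
  - by move=> x _; rewrite lee_fin pw.
under eq_integral do rewrite EFinM.
rewrite ge0_integralZl_EFin//=.
- by rewrite integral_normal_pdf mule1.
- by move=> x _; rewrite lee_fin normal_pdf_ge0.
- exact/measurable_EFinP.
- by rewrite mulr_ge0// exprn_ge0 ?ltW.
Qed.

End gaussian.

Section integral_bounds.
Context {R : realType} {dT : measure_display} {T : measurableType dT}.
Variable Pr : probability T R.
Implicit Types f g : T -> R.

(** Integrability is bundled with the inequality because the terms to be added include ones without
    a sign, linear in the increments. *)
Definition integral_le f g :=
  [/\ Pr.-integrable setT (fun w => (f w)%:E), Pr.-integrable setT (fun w => (g w)%:E) &
      (\int[Pr]_w (f w)%:E <= \int[Pr]_w (g w)%:E)%E].

Lemma integral_le_refl f : Pr.-integrable setT (fun w => (f w)%:E) -> integral_le f f.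
Proof. by split. Qed.

Lemma integral_leD f f' g g' : integral_le f g -> integral_le f' g' ->
  integral_le (fun w => f w + f' w) (fun w => g w + g' w).
Proof.
move=> [fi gi fg] [fi' gi' fg']; split.
- exact: (integrableD measurableT fi fi').
- exact: (integrableD measurableT gi gi').
- by rewrite (integralD measurableT fi fi') (integralD measurableT gi gi') leeD.
Qed.

Lemma integral_le_sum (I : Type) (s : seq I) (F H : I -> T -> R) :
  (forall i, integral_le (F i) (H i)) ->
  integral_le (fun w => \sum_(i <- s) F i w) (fun w => \sum_(i <- s) H i w).
Proof.
have E (K : I -> T -> R) i s' : (fun w => \sum_(j <- i :: s') K j w) =
    fun w => K i w + \sum_(j <- s') K j w.
  by apply/funext => w; rewrite big_cons.
move=> FH; elim: s => [|i s IH]; last by rewrite !E; exact: integral_leD.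
rewrite (_ : (fun w => _) = fun=> 0); last by apply/funext => w; rewrite big_nil.
rewrite (_ : (fun w => \sum_(i <- _) H i w) = fun=> 0); last first.
  by apply/funext => w; rewrite big_nil.
by apply: integral_le_refl; exact: integrable0.
Qed.

Lemma integrable_dominated f g : measurable_fun setT f ->
  (forall w, `|f w| <= g w) -> Pr.-integrable setT (fun w => (g w)%:E) ->
  Pr.-integrable setT (fun w => (f w)%:E).
Proof.
move=> mf fg; apply: le_integrable => //; first exact/measurable_EFinP.
by move=> w _; rewrite lee_fin (le_trans (fg w))// ler_norm.
Qed.

End integral_bounds.

(** * One Gaussian step *)

Section gaussian_increment.
Context {R : realType} {dT : measure_display} {T : measurableType dT}.
Variables (Pr : probability T R) (G : set (set T)) (m : nat).
Variables (Delta : T -> 'cV[R]_m) (s : R).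
Hypothesis G_sigma : sigma_algebra setT G.
Hypothesis G_measurable : G `<=` measurable.
Hypothesis s_gt0 : 0 < s.
Hypothesis mDelta : forall i, measurable_fun setT (fun w => Delta w i 0%R).
Hypothesis law : forall A : 'I_m -> set R, (forall i, measurable (A i)) ->
  Pr [set w | forall i, A i (Delta w i 0%R)] = (\prod_(i < m) normal_prob 0%R s (A i))%E.
Hypothesis indep : forall A B, G A -> sigma_vec Delta B ->
  Pr (A `&` B) = (Pr A * Pr B)%E.

Let Delta_wrt i : measurable_wrt (sigma_vec Delta) (fun w => Delta w i 0%R).
Proof.
have sS : sigma_algebra setT (sigma_vec Delta) by apply: smallest_sigma_algebra.
apply/(measurable_wrtP _ sS) => B mB; apply: sub_sigma_algebra.
by exists i => //; exists B => //; rewrite setTI.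
Qed.

Lemma increment_law i (B : set R) : measurable B ->
  Pr ((fun w => Delta w i 0%R) @^-1` B) = normal_prob 0 s B.
Proof.
move=> mB; pose A j := if j == i then B else setT.
have mA j : measurable (A j) by rewrite /A; case: ifP.
transitivity (Pr [set w | forall j, A j (Delta w j 0%R)]).
  congr (Pr _); apply/seteqP; split => w /= H.
    by move=> j; rewrite /A; case: eqP => [->|].
  by have := H i; rewrite /A eqxx.
rewrite law// (bigD1 i)//= /A eqxx big1 ?mule1// => j /negbTE ->.
exact: (@probability_setT _ _ _ (normal_prob 0 s)).
Qed.

Lemma increment_pair_law i j (A B : set R) : i != j -> measurable A -> measurable B ->
  Pr ((fun w => Delta w i 0%R) @^-1` A `&` (fun w => Delta w j 0%R) @^-1` B) =
  (Pr ((fun w => Delta w i 0%R) @^-1` A) * Pr ((fun w => Delta w j 0%R) @^-1` B))%E.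
Proof.
move=> ij mA mB; rewrite !increment_law//.
pose C k := if k == i then A else if k == j then B else setT.
have mC k : measurable (C k) by rewrite /C; do 2 case: ifP => //.
transitivity (Pr [set w | forall j, C j (Delta w j 0%R)]).
  congr (Pr _); apply/seteqP; split => w /=.
    by move=> [HA HB] k; rewrite /C; case: eqP => [->//|_]; case: eqP => [->|].
  move=> H; split; first by have := H i; rewrite /C eqxx.
  by have := H j; rewrite /C eq_sym (negbTE ij) eqxx.
rewrite law// (bigD1 i)//= (bigD1 j)/=; last by rewrite eq_sym.
rewrite /C eqxx eq_sym (negbTE ij) eqxx.
rewrite [X in (_ * (_ * X))%E]big1 ?mule1// => k /andP[/negbTE -> /negbTE ->].
exact: (@probability_setT _ _ _ (normal_prob 0 s)).
Qed.

Lemma ge0_integral_increment i (f : R -> R) : measurable_fun setT f ->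
  (forall x, 0 <= f x) ->
  (\int[Pr]_w (f (Delta w i 0%R))%:E = \int[normal_prob 0 s]_x (f x)%:E)%E.
Proof.
move=> mf f0.
have mD : measurable_fun setT (fun w => Delta w i 0 : measurableTypeR R) := mDelta i.
transitivity (\int[pushforward Pr (fun w => Delta w i 0%R : measurableTypeR R)]_x (f x)%:E)%E.
  rewrite (ge0_integral_pushforward mD)//=.
    exact/measurable_EFinP.
  by move=> x _; rewrite lee_fin.
by apply: eq_measure_integral => A mA _; exact: increment_law.
Qed.

Lemma increment_sqr i : Pr.-integrable setT (fun w => (Delta w i 0%R ^+ 2)%:E) /\
  (\int[Pr]_w (Delta w i 0%R ^+ 2)%:E <= (s ^+ 2)%:E)%E.
Proof.
have mX : measurable_fun setT (fun x : R => x ^+ 2).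
  by apply: continuous_measurable_fun; exact: exprn_continuous.
have H : (\int[Pr]_w (Delta w i 0%R ^+ 2)%:E <= (s ^+ 2)%:E)%E.
  rewrite (ge0_integral_increment i mX) ?normal_prob_sqr_le// => x.
  exact: sqr_ge0.
split => //; apply/integrableP; split.
  apply/measurable_EFinP; exact: (measurableT_comp mX).
under eq_integral do rewrite /= ger0_norm ?sqr_ge0//.
exact: le_lt_trans H (ltry _).
Qed.

Lemma increment_integrable i : Pr.-integrable setT (fun w => (Delta w i 0%R)%:E).
Proof.
apply: (@integrable_dominated _ _ _ _ _ (fun w => 1 + Delta w i 0%R ^+ 2)) => //.
  by move=> w; rewrite ler_norml; apply/andP; split; nra.
have [fi _] := increment_sqr i.
have c1 : Pr.-integrable setT (fun=> 1%:E : \bar R) by exact: finite_measure_integrable_cst.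
by apply: (integrableD measurableT c1 fi).
Qed.

(** By symmetry of the law the positive and the negative part have the same integral, which is
    finite. *)
Lemma increment_mean i : (\int[Pr]_w (Delta w i 0%R)%:E = 0)%E.
Proof.
have fi := increment_integrable i.
have mp : measurable_fun setT (fun x : R => Num.max x 0).
  exact: measurable_maxr.
have E1 : (\int[Pr]_w ((fun w => (Delta w i 0%R)%:E)^\+ w) =
    \int[normal_prob 0 s]_x (Num.max x 0)%:E)%E.
  rewrite -(ge0_integral_increment i mp); last by move=> x; rewrite le_max lexx orbT.
  by apply: eq_integral => w _; rewrite funeposE EFin_max.
have mn : measurable_fun setT (fun x : R => Num.max (- x) 0).
  by apply: measurable_maxr => //; exact: oppr_measurable.
have E2 : (\int[Pr]_w ((fun w => (Delta w i 0%R)%:E)^\- w) =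
    \int[normal_prob 0 s]_x (Num.max (- x) 0)%:E)%E.
  rewrite -(ge0_integral_increment i mn); last by move=> x; rewrite le_max lexx orbT.
  by apply: eq_integral => w _; rewrite funenegE EFin_max EFinN.
rewrite integralE E1 E2 (@normal_probN _ s (fun x => Num.max x 0))//; last 2 first.
- by rewrite gt_eqF.
- by move=> x; rewrite le_max lexx orbT.
rewrite -E1 subee//.
apply: (@integrable_fin_num _ _ _ Pr setT measurableT).
exact: (integrable_funepos measurableT fi).
Qed.

Lemma increment_cross i j : i != j ->
  Pr.-integrable setT (fun w => (Delta w i 0%R * Delta w j 0%R)%:E) /\
  (\int[Pr]_w (Delta w i 0%R * Delta w j 0%R)%:E = 0)%E.
Proof.
move=> ij.
have [fi fE] := integralM_indep (mDelta i) (mDelta j)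
  (fun A B mA mB => increment_pair_law ij mA mB)
  (increment_integrable i) (increment_integrable j).
by rewrite fE !increment_mean mul0e.
Qed.

Lemma increment_indep (Y Z : T -> R) : measurable_wrt G Y ->
  measurable_wrt (sigma_vec Delta) Z ->
  Pr.-integrable setT (EFin \o Y) -> Pr.-integrable setT (EFin \o Z) ->
  Pr.-integrable setT (fun w => (Y w * Z w)%:E) /\
  (\int[Pr]_w (Y w * Z w)%:E = (\int[Pr]_w (Y w)%:E) * (\int[Pr]_w (Z w)%:E))%E.
Proof.
move=> mY mZ iY iZ; apply: integralM_indep => //.
- exact: measurable_wrt_measurable mY.
- by move/measurable_int : iZ => /measurable_EFinP.
- move=> A B mA mB; apply: indep; first by apply: (measurable_wrtP Y G_sigma).1.
  have sS : sigma_algebra setT (sigma_vec Delta) by apply: smallest_sigma_algebra.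
  by apply: (measurable_wrtP Z sS).1.
Qed.

Section one_step.
Variables (d : nat) (P eta sig C : R).
Variables (Q k : T -> R) (z : T -> 'cV[R]_d) (S : T -> 'M[R]_(d, m)).
Let q := 2 * P - 2.
Let r x : R := x ^+ 2 * ((1 + sig * m%:R * `|x|) `^ q - 1).
Hypotheses (P_ge2 : 2 <= P) (sig_ge0 : 0 <= sig) (eta_ge0 : 0 <= eta).
Hypothesis cubic : (\int[normal_prob 0 s]_x (r x)%:E <= (C * s ^+ 3)%:E)%E.
Hypothesis s_small : m%:R ^+ 3 * C * s <= eta.
Hypotheses (mQ : measurable_wrt G Q) (mk : measurable_wrt G k).
Hypothesis mz : forall i, measurable_wrt G (fun w => z w i 0).
Hypothesis mS : forall i j, measurable_wrt G (fun w => S w i j).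
Hypotheses (Q_ge0 : forall w, 0 <= Q w) (k_ge1 : forall w, 1 <= k w).
Hypothesis S_le : forall w, hsnorm (S w) <= sig.

Let A w := k w + hsnorm (z w) ^+ 2.
Let B w := Q w * A w `^ (P - 1).
(** The coefficients of the expansion: each is [G]-measurable and will multiply a function of the
    increment alone, the form in which independence applies term by term. *)
Let f1 j w := 2 * P * B w * \sum_(a < d) z w a 0 * S w a j.
Let f2 j l w := P * (2 * P - 1) * B w * \sum_(a < d) S w a j * S w a l.
Let f3 w := P * (2 * P - 1) * B w * (m%:R ^+ 2 * hsnorm (S w) ^+ 2).

Let P_ge1 : 1 <= P. Proof. by apply: le_trans P_ge2; rewrite ler1n. Qed.

Let q_ge0 : 0 <= q.
Proof. by rewrite /q subr_ge0 ler_peMr// P_ge1. Qed.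

Let P_ge0 : 0 <= P. Proof. exact: le_trans ler01 P_ge1. Qed.

Let P21_ge0 : 0 <= 2 * P - 1.
Proof. by rewrite subr_ge0 (le_trans P_ge1)// ler_peMl// ler1n. Qed.

Let A_ge1 w : 1 <= A w.
Proof. by rewrite /A -[leLHS]addr0 lerD ?sqr_ge0. Qed.

Let B_ge0 w : 0 <= B w.
Proof. by rewrite mulr_ge0// powR_ge0. Qed.

Let r_ge0 x : 0 <= r x.
Proof.
rewrite /r mulr_ge0 ?sqr_ge0// subr_ge0.
have h : 1 <= 1 + sig * m%:R * `|x| by rewrite lerDl !mulr_ge0.
by rewrite -[leLHS](powRr0 (1 + sig * m%:R * `|x|)) ler_powR.
Qed.

Let mr : measurable_fun setT r.
Proof.
apply: measurable_funM.
  by apply: continuous_measurable_fun; exact: exprn_continuous.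
apply: measurable_funB => //.
apply: (measurableT_comp (measurable_powR q)).
by apply: measurable_funD => //; apply: measurable_funM => //; exact: normr_measurable.
Qed.

(** The left side does not split over coordinates. The norm is at most [m] times the largest
    coordinate, whence [sig * m] inside [r] and the factor [m^2]; the maximum is then bounded by the
    sum. A largest coordinate exists only for [0 < m]. *)
Let error_le (u : 'cV[R]_m) : hsnorm u ^+ 2 * ((1 + sig * hsnorm u) `^ q - 1)
  <= m%:R ^+ 2 * \sum_i r (u i 0).
Proof.
have u0 := hsnorm_ge0 u.
have sum0 : 0 <= m%:R ^+ 2 * \sum_i r (u i 0).
  by rewrite mulr_ge0 ?sqr_ge0// sumr_ge0.
case: (pselect (exists i : 'I_m, True)) => [[i0 _]|mN]; last first.
  suff -> : hsnorm u = 0 by rewrite expr0n/= mul0r.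
  apply/eqP; rewrite eq_le u0 andbT.
  have := @hsnorm_ler_bound R m u 0; rewrite mulr0; apply => // i.
  by case: mN; exists i.
case: (@Order.TotalTheory.arg_maxP _ _ _ i0 predT (fun i => `|u i 0|) isT) => i _ imax.
have ui : hsnorm u <= m%:R * `|u i 0| by apply: hsnorm_ler_bound => // j; exact: imax.
apply: (@le_trans _ _ (m%:R ^+ 2 * r (u i 0))); last first.
  by rewrite ler_wpM2l ?sqr_ge0// (bigD1 i)//= lerDl sumr_ge0.
rewrite /r mulrA -[X in _ <= _ * X * _](real_normK (num_real _)) -exprMn.
have h1 : 1 <= 1 + sig * hsnorm u by rewrite lerDl mulr_ge0.
have h2 : 1 <= (1 + sig * hsnorm u) `^ q.
  by rewrite -[leLHS](powRr0 (1 + sig * hsnorm u)) ler_powR.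
apply: ler_pM; rewrite ?sqr_ge0 ?subr_ge0//.
  by rewrite ler_sqr ?nnegrE// mulr_ge0.
rewrite lerD2r; apply: ge0_ler_powR; rewrite ?nnegrE//; first by rewrite (le_trans ler01).
  by rewrite addr_ge0// !mulr_ge0.
by rewrite lerD2l -mulrA ler_wpM2l.
Qed.

Let dotv_mulmx w : dotv (z w) (S w *m Delta w) =
  \sum_j (\sum_(a < d) z w a 0 * S w a j) * Delta w j 0.
Proof.
under [RHS]eq_bigr do rewrite mulr_suml.
rewrite exchange_big; apply: eq_bigr => a _.
by rewrite mxE mulr_sumr; apply: eq_bigr => j _; rewrite mulrA.
Qed.

Let sqr_mulmx w : hsnorm (S w *m Delta w) ^+ 2 =
  \sum_j \sum_l (\sum_(a < d) S w a j * S w a l) * (Delta w j 0 * Delta w l 0).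
Proof.
rewrite sqr_hsnorm_cV.
under [RHS]eq_bigr => j _ do under eq_bigr => l _ do rewrite mulr_suml.
under [RHS]eq_bigr => j _ do rewrite exchange_big.
rewrite [RHS]exchange_big; apply: eq_bigr => a _.
rewrite mxE expr2 mulr_suml; apply: eq_bigr => j _.
by rewrite mulr_sumr; apply: eq_bigr => l _; ring.
Qed.

Let pathwise w : Q w * (k w + hsnorm (z w + S w *m Delta w) ^+ 2) `^ P <=
  Q w * A w `^ P + (\sum_j f1 j w * Delta w j 0 +
    (\sum_j \sum_l f2 j l w * (Delta w j 0 * Delta w l 0) +
     \sum_i f3 w * r (Delta w i 0))).
Proof.
have := powR_sqr_hsnormD (z w) (S w *m Delta w) (k_ge1 w) P_ge2.
rewrite -/(A w); set v := S w *m Delta w => H.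
have v0 := hsnorm_ge0 v; have n0 := hsnorm_ge0 (Delta w).
have S0 := hsnorm_ge0 (S w).
have vS : hsnorm v <= hsnorm (S w) * hsnorm (Delta w) by exact: hsnorm_mulmx.
have vs : hsnorm v <= sig * hsnorm (Delta w).
  by apply: le_trans vS _; rewrite ler_wpM2r.
have E : hsnorm v ^+ 2 * (1 + hsnorm v) `^ q <= hsnorm v ^+ 2 +
    hsnorm (S w) ^+ 2 * (m%:R ^+ 2 * \sum_i r (Delta w i 0)).
  have -> : hsnorm v ^+ 2 * (1 + hsnorm v) `^ q = hsnorm v ^+ 2 +
    hsnorm v ^+ 2 * ((1 + hsnorm v) `^ q - 1) by ring.
  rewrite lerD2l; apply: (@le_trans _ _ (hsnorm (S w) ^+ 2 *
    (hsnorm (Delta w) ^+ 2 * ((1 + sig * hsnorm (Delta w)) `^ q - 1)))).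
    rewrite mulrA -exprMn.
    have h2 : 1 <= (1 + hsnorm v) `^ q.
      by rewrite -[leLHS](powRr0 (1 + hsnorm v)) ler_powR// lerDl.
    apply: ler_pM; rewrite ?sqr_ge0 ?subr_ge0//.
      by rewrite ler_sqr ?nnegrE// mulr_ge0.
    rewrite lerD2r; apply: (ge0_ler_powR q_ge0); rewrite ?nnegrE ?addr_ge0 ?mulr_ge0//.
    by rewrite lerD2l.
  by rewrite ler_wpM2l ?sqr_ge0.
apply: le_trans (ler_wpM2l (Q_ge0 w) H) _; rewrite mulrDr lerD2l.
have -> : \sum_j f1 j w * Delta w j 0 = P * B w * (2 * dotv (z w) v).
  by rewrite dotv_mulmx !mulr_sumr; apply: eq_bigr => j _; rewrite /f1; ring.
have -> : \sum_j \sum_l f2 j l w * (Delta w j 0 * Delta w l 0) =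
    P * B w * ((2 * P - 1) * hsnorm v ^+ 2).
  rewrite sqr_mulmx !mulr_sumr; apply: eq_bigr => j _.
  by rewrite !mulr_sumr; apply: eq_bigr => l _; rewrite /f2; ring.
have -> : \sum_i f3 w * r (Delta w i 0) = P * B w * ((2 * P - 1) *
    (hsnorm (S w) ^+ 2 * (m%:R ^+ 2 * \sum_i r (Delta w i 0)))).
  by rewrite !mulr_sumr; apply: eq_bigr => i _; rewrite /f3; ring.
rewrite -!mulrDr -/q.
have -> (x : R) : Q w * (P * A w `^ (P - 1) * x) = P * B w * x by rewrite /B; ring.
by apply: ler_wpM2l; [exact: mulr_ge0|rewrite lerD2l ler_wpM2l].
Qed.

Let mA : measurable_wrt G A.
Proof.
apply: measurable_wrtD => //.
by apply: measurable_wrt_sqr_hsnorm => i j; rewrite (ord1 j).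
Qed.

Let mB : measurable_wrt G B.
Proof. by apply: measurable_wrtM => //; exact: measurable_wrt_powR. Qed.

Let mf1 j : measurable_wrt G (f1 j).
Proof.
apply: measurable_wrtM; last first.
  by apply: measurable_wrt_sum => a; apply: measurable_wrtM.
by apply: measurable_wrtM => //; exact: measurable_wrt_cst.
Qed.

Let mf2 j l : measurable_wrt G (f2 j l).
Proof.
apply: measurable_wrtM; last first.
  by apply: measurable_wrt_sum => a; apply: measurable_wrtM.
by apply: measurable_wrtM => //; exact: measurable_wrt_cst.
Qed.

Let mf3 : measurable_wrt G f3.
Proof.
apply: measurable_wrtM.
  by apply: measurable_wrtM => //; exact: measurable_wrt_cst.
apply: measurable_wrtM; first exact: measurable_wrt_cst.
exact: measurable_wrt_sqr_hsnorm.
Qed.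

Let nS_ge0 w : 0 <= hsnorm (S w). Proof. exact: hsnorm_ge0. Qed.

Let s_ge0 : 0 <= s. Proof. exact: ltW. Qed.

Let pA_ge0 w : 0 <= A w `^ (P - 1). Proof. exact: powR_ge0. Qed.

Let BA w : B w * A w = Q w * A w `^ P.
Proof.
have A0 : 0 <= A w by apply: le_trans (A_ge1 w).
rewrite /B -mulrA (mulrC _ (A w)) mulr_powRB1//.
by apply: lt_le_trans P_ge1.
Qed.

Let B_le w : B w <= Q w * A w `^ P.
Proof. by rewrite -BA ler_peMr. Qed.

Let z_le w a : `|z w a 0| <= A w.
Proof.
apply: le_trans (hsnorm_entry (z w) a 0) _; set n := hsnorm (z w).
have n0 : 0 <= n by apply: hsnorm_ge0.
apply: (@le_trans _ _ (1 + n ^+ 2)); last by rewrite lerD2r.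
have [n1|/ltW n1] := leP n 1; first by rewrite (le_trans n1)// lerDl sqr_ge0.
by rewrite expr2 (le_trans (ler_peMl n0 n1))// lerDr.
Qed.

Let S_entry_le w i j : `|S w i j| <= sig.
Proof. exact: le_trans (hsnorm_entry _ _ _) (S_le w). Qed.

Let f1_le j w : `|f1 j w| <= 2 * P * (d%:R * sig) * (Q w * A w `^ P).
Proof.
rewrite /f1 normrM -BA ger0_norm ?mulr_ge0//.
have -> : 2 * P * (d%:R * sig) * (B w * A w) = 2 * P * B w * (d%:R * (A w * sig)) by ring.
apply: ler_wpM2l; first by rewrite !mulr_ge0.
apply: le_trans (ler_norm_sum _ _ _) _.
rewrite -[d in leRHS]card_ord mulr_natl -sumr_const; apply: ler_sum => a _.
by rewrite normrM ler_pM.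
Qed.

Let f2_le j l w : `|f2 j l w| <= P * (2 * P - 1) * (d%:R * sig ^+ 2) * (Q w * A w `^ P).
Proof.
rewrite /f2 normrM ger0_norm ?mulr_ge0//.
have -> : P * (2 * P - 1) * (d%:R * sig ^+ 2) * (Q w * A w `^ P) =
  P * (2 * P - 1) * (Q w * A w `^ P) * (d%:R * (sig * sig)) by ring.
apply: ler_pM; rewrite ?mulr_ge0//; first by rewrite ler_wpM2l ?mulr_ge0// B_le.
apply: le_trans (ler_norm_sum _ _ _) _.
rewrite -[d in leRHS]card_ord mulr_natl -sumr_const; apply: ler_sum => a _.
by rewrite normrM ler_pM.
Qed.

Let f3_ge0 w : 0 <= f3 w.
Proof. by rewrite !mulr_ge0. Qed.

Let f3_le w : `|f3 w| <= P * (2 * P - 1) * (m%:R ^+ 2 * sig ^+ 2) * (Q w * A w `^ P).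
Proof.
rewrite ger0_norm// /f3.
have -> : P * (2 * P - 1) * (m%:R ^+ 2 * sig ^+ 2) * (Q w * A w `^ P) =
  P * (2 * P - 1) * (Q w * A w `^ P) * (m%:R ^+ 2 * sig ^+ 2) by ring.
apply: ler_pM; rewrite ?mulr_ge0 ?sqr_ge0//; first by rewrite ler_wpM2l ?mulr_ge0// B_le.
by rewrite ler_wpM2l ?sqr_ge0// ler_sqr ?nnegrE ?hsnorm_ge0.
Qed.

Let mQA : measurable_wrt G (fun w => Q w * A w `^ P).
Proof. by apply: measurable_wrtM => //; exact: measurable_wrt_powR. Qed.

Let dominated (Y : T -> R) c : Pr.-integrable setT (fun w => (Q w * A w `^ P)%:E) ->
  measurable_wrt G Y -> (forall w, `|Y w| <= c * (Q w * A w `^ P)) ->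
  Pr.-integrable setT (fun w => (Y w)%:E).
Proof.
move=> iQ mY Yc; apply: integrable_dominated Yc _.
  exact: measurable_wrt_measurable mY.
exact: (integrableZl measurableT c iQ).
Qed.

Let r_integral i : Pr.-integrable setT (fun w => (r (Delta w i 0))%:E) /\
  (\int[Pr]_w (r (Delta w i 0%R))%:E <= (C * s ^+ 3)%:E)%E.
Proof.
have H : (\int[Pr]_w (r (Delta w i 0%R))%:E <= (C * s ^+ 3)%:E)%E.
  by rewrite (ge0_integral_increment i mr r_ge0).
split => //; apply/integrableP; split.
  by apply/measurable_EFinP; exact: (measurableT_comp mr).
under eq_integral do rewrite /= ger0_norm//.
exact: le_lt_trans H (ltry _).
Qed.

Let rhs w := Q w * A w `^ P + (\sum_(j < m) 0 +
  (\sum_(j < m) \sum_(l < m) (if j == l then s ^+ 2 * f2 j l w else 0) +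
   \sum_(i < m) C * s ^+ 3 * f3 w)).

(** Bernoulli's inequality, read backwards, reassembles the expansion into a single [P]-th power.
    The third-order terms carry the relative factor [m^3 C s], which [s_small] bounds by [eta]. *)
Let rhs_le w : rhs w <=
  Q w * (k w + hsnorm (z w) ^+ 2 + (2 * P - 1) * (1 + eta) * s ^+ 2 * hsnorm (S w) ^+ 2) `^ P.
Proof.
rewrite -/(A w) /rhs big1// add0r.
have -> : \sum_j \sum_l (if j == l then s ^+ 2 * f2 j l w else 0) =
    \sum_j s ^+ 2 * f2 j j w.
  apply: eq_bigr => j _; rewrite (bigD1 j)//= eqxx big1 ?addr0// => l.
  by rewrite eq_sym => /negbTE ->.
rewrite sumr_const card_ord -[X in _ + (_ + X)]mulr_natl.
have -> : \sum_j s ^+ 2 * f2 j j w = s ^+ 2 * (P * (2 * P - 1) * B w * hsnorm (S w) ^+ 2).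
  rewrite -mulr_sumr -mulr_sumr; congr (_ * (_ * _)).
  rewrite exchange_big sqr_hsnorm; apply: eq_bigr => a _.
  by apply: eq_bigr => j _; rewrite expr2.
have A0 : 0 < A w by apply: lt_le_trans (A_ge1 w).
set y := (2 * P - 1) * (1 + eta) * s ^+ 2 * hsnorm (S w) ^+ 2.
have y0 : 0 <= y by rewrite /y !mulr_ge0 ?sqr_ge0// addr_ge0.
have HB : A w `^ P + P * A w `^ (P - 1) * y <= (A w + y) `^ P.
  have E : A w + y = A w * (1 + y / A w).
    by rewrite mulrDr mulr1 mulrCA divff ?gt_eqF// mulr1.
  have x0 : 0 <= 1 + y / A w by rewrite addr_ge0// divr_ge0// ltW.
  rewrite E (powRM _ (ltW A0) x0).
  have := bernoulli_powR x0 P_ge1; rewrite addrAC subrr add0r => H.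
  apply: le_trans _ (ler_wpM2l (powR_ge0 _ _) H).
  have -> : A w `^ P = A w * A w `^ (P - 1).
    by rewrite mulr_powRB1 ?ltW//; apply: lt_le_trans P_ge1.
  by rewrite le_eqVlt; apply/orP; left; apply/eqP; field; rewrite gt_eqF.
apply: le_trans _ (ler_wpM2l (Q_ge0 w) HB); rewrite [leRHS]mulrDr lerD2l.
have -> : s ^+ 2 * (P * (2 * P - 1) * B w * hsnorm (S w) ^+ 2) +
     m%:R * (C * s ^+ 3 * f3 w) =
   P * (2 * P - 1) * B w * hsnorm (S w) ^+ 2 * s ^+ 2 * (1 + m%:R ^+ 3 * C * s).
  by rewrite /f3; ring.
have -> : Q w * (P * A w `^ (P - 1) * y) =
   P * (2 * P - 1) * B w * hsnorm (S w) ^+ 2 * s ^+ 2 * (1 + eta) by rewrite /y /B; ring.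
apply: ler_wpM2l; first by rewrite !mulr_ge0 ?sqr_ge0.
by rewrite lerD2l.
Qed.

(** A conditional moment estimate given [G], tested against the weight [Q]: the linear and mixed
    terms of the expansion have mean zero, the squares contribute [s^2] and the remainder is of
    order [s^3]. Here [eta] is the relative slack above the constant [2 P - 1], not the constant of
    the monotonicity condition. *)
Lemma one_step_le :
  (\int[Pr]_w (Q w * (k w + hsnorm (z w + S w *m Delta w) ^+ 2) `^ P)%:E <=
   \int[Pr]_w (Q w * (k w + hsnorm (z w) ^+ 2 +
      (2 * P - 1) * (1 + eta) * s ^+ 2 * hsnorm (S w) ^+ 2) `^ P)%:E)%E.
Proof.
set target := (X in (_ <= X)%E).
have mG Y : measurable_wrt G Y -> measurable_fun setT Y.
  exact: measurable_wrt_measurable.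
have mtarget : measurable_wrt G (fun w => Q w * (k w + hsnorm (z w) ^+ 2 +
      (2 * P - 1) * (1 + eta) * s ^+ 2 * hsnorm (S w) ^+ 2) `^ P).
  apply: measurable_wrtM => //; apply: measurable_wrt_powR.
  apply: measurable_wrtD => //; apply: measurable_wrtM; first exact: measurable_wrt_cst.
  exact: measurable_wrt_sqr_hsnorm.
(* If the right side is infinite there is nothing to prove; otherwise it dominates [Q A^P], and with
   it every coefficient, which supplies all the integrability needed. *)
have [->|tfin] := eqVneq target +oo%E; first by rewrite leey.
have iQ : Pr.-integrable setT (fun w => (Q w * A w `^ P)%:E).
  apply/integrableP; split; first by apply/measurable_EFinP; exact: mG.
  apply: (@le_lt_trans _ _ target); last by rewrite lt_neqAle tfin leey.
  apply: ge0_le_integral => //=.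
  - by apply/measurable_EFinP; apply: measurableT_comp => //; exact: mG.
  - by apply/measurable_EFinP; exact: mG.
  - move=> w _; rewrite lee_fin ger0_norm ?mulr_ge0 ?powR_ge0//.
    rewrite ler_wpM2l//; apply: ge0_ler_powR => //; rewrite ?nnegrE.
    + exact: le_trans ler01 (A_ge1 w).
    + rewrite addr_ge0//; first exact: le_trans ler01 (A_ge1 w).
      by rewrite !mulr_ge0 ?sqr_ge0// addr_ge0.
    + by rewrite lerDl !mulr_ge0 ?sqr_ge0// addr_ge0.
have L0 : integral_le Pr (fun w => Q w * A w `^ P) (fun w => Q w * A w `^ P).
  exact: integral_le_refl.
have i1 j : Pr.-integrable setT (fun w => (f1 j w)%:E) by apply: (dominated iQ (mf1 j)).
have i2 j l : Pr.-integrable setT (fun w => (f2 j l w)%:E).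
  exact: (dominated iQ (mf2 j l)).
have i3 : Pr.-integrable setT (fun w => (f3 w)%:E) by apply: (dominated iQ mf3).
have scale c f : Pr.-integrable setT (fun w => (f w)%:E) ->
    Pr.-integrable setT (fun w => (c * f w)%:E).
  by move=> fi; exact: (integrableZl measurableT c fi).
have L1 j : integral_le Pr (fun w => f1 j w * Delta w j 0) (fun=> 0).
  have [p1 p2] := increment_indep (mf1 j) (Delta_wrt j) (i1 j) (increment_integrable j).
  by split; rewrite ?p2 ?increment_mean ?mule0 ?integral0//; exact: integrable0.
have L2 j l : integral_le Pr (fun w => f2 j l w * (Delta w j 0 * Delta w l 0))
    (fun w => if j == l then s ^+ 2 * f2 j l w else 0).
  have [<-|jl] := eqVneq j l.
    have [s1 s2] := increment_sqr j.
    have sq : Pr.-integrable setT (EFin \o (fun w => Delta w j 0 * Delta w j 0)).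
      by apply: eq_integrable s1 => // w _; rewrite /= expr2.
    have [p1 p2] := increment_indep (mf2 j j)
      (measurable_wrtM (Delta_wrt j) (Delta_wrt j)) (i2 j j) sq.
    split => //; first exact: scale.
    rewrite p2; under [leRHS]eq_integral do rewrite EFinM.
    rewrite (integralZl measurableT (i2 j j)) muleC; apply: lee_pmul => //.
    + by apply: integral_ge0 => w _; rewrite lee_fin -expr2 sqr_ge0.
    + apply: integral_ge0 => w _; rewrite lee_fin !mulr_ge0// sumr_ge0// => a _.
      by rewrite -expr2 sqr_ge0.
  have [c1 c2] := increment_cross jl.
  have [p1 p2] := increment_indep (mf2 j l)
    (measurable_wrtM (Delta_wrt j) (Delta_wrt l)) (i2 j l) c1.
  by split; rewrite ?p2 ?c2 ?mule0 ?integral0//; exact: integrable0.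
have L3 i : integral_le Pr (fun w => f3 w * r (Delta w i 0)) (fun w => C * s ^+ 3 * f3 w).
  have [r1 r2] := r_integral i.
  have [p1 p2] := increment_indep mf3 (measurable_wrt_comp mr (Delta_wrt i)) i3 r1.
  split => //; first exact: scale.
  rewrite p2; under [leRHS]eq_integral do rewrite EFinM.
  rewrite (integralZl measurableT i3) muleC; apply: lee_pmul => //.
  + by apply: integral_ge0 => w _; rewrite lee_fin.
  + by apply: integral_ge0 => w _; rewrite lee_fin.
have [j1 j2 j3] := integral_leD L0 (integral_leD (integral_le_sum (index_enum 'I_m) L1)
  (integral_leD (integral_le_sum (index_enum 'I_m)
     (fun j => integral_le_sum (index_enum 'I_m) (L2 j)))
     (integral_le_sum (index_enum 'I_m) L3))).
apply: (@le_trans _ _ (\int[Pr]_w (rhs w)%:E)%E); last first.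
  apply: le_integral => //; last by move=> w _; rewrite lee_fin; exact: rhs_le.
  apply/integrableP; split; first by apply/measurable_EFinP; exact: mG.
  under eq_integral => w _ do rewrite /= ger0_norm ?mulr_ge0 ?powR_ge0//.
  by rewrite lt_neqAle tfin leey.
apply: le_trans j3; apply: ae_ge0_le_integralT.
- by move=> w; rewrite lee_fin mulr_ge0// powR_ge0.
- move=> w; rewrite lee_fin; apply: le_trans (pathwise w).
  by rewrite mulr_ge0// powR_ge0.
- exact: measurable_int j1.
- by apply: aeW => w; rewrite lee_fin; exact: pathwise.
Qed.

End one_step.

End gaussian_increment.

(** * Maximal inequality *)

Fixpoint running_max {R : realType} (U : nat -> R) (i : nat) : R :=
  if i is j.+1 then Num.max (running_max U j) (U j.+1) else U 0%N.

Lemma le_running_max {R : realType} (U : nat -> R) i j : (j <= i)%N ->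
  U j <= running_max U i.
Proof.
elim: i => [|i IH]; first by rewrite leqn0 => /eqP ->.
rewrite leq_eqVlt => /predU1P[->|ji] /=; first by rewrite le_max lexx orbT.
by rewrite le_max IH.
Qed.

Section maximal_inequality.
Context {R : realType} {dT : measure_display} {T : measurableType dT}.
Variables (Pr : probability T R) (G : nat -> set (set T)) (n : nat).
Variables (A : nat -> T -> bool) (U : nat -> T -> R) (g : nat -> R) (p P : R).
Hypothesis GS : forall i, (i < n)%N -> G i `<=` G i.+1.
Hypothesis Gm : forall i, (i <= n)%N -> G i `<=` measurable.
Hypothesis mA : forall i, (i <= n)%N -> measurable_wrt (G i) (fun w => (A i w)%:R : R).
Hypothesis mU : forall i, (i <= n)%N -> measurable_wrt (G i) (U i).
Hypothesis AS : forall i w, A i.+1 w -> A i w.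
Hypothesis U_ge1 : forall i w, 1 <= U i w.
Hypothesis g_ge1 : forall i, 1 <= g i.
Hypotheses (p_ge1 : 1 <= p) (pP : p < P).
Hypothesis step : forall i, (i < n)%N -> forall Q : T -> R,
  measurable_wrt (G i) Q -> (forall w, 0 <= Q w) ->
  (\int[Pr]_w (Q w * ((A i.+1 w)%:R * U i.+1 w `^ P))%:E <=
   (g i)%:E * \int[Pr]_w (Q w * U i w `^ P)%:E)%E.

Let S i w := running_max (U ^~ w) i.
Let c := p / (P - p).
Let F i w := S i w `^ p + c * S i w `^ (p - P) * U i w `^ P.

Let S_ge1 i w : 1 <= S i w.
Proof. by apply: le_trans (U_ge1 0 w) _; exact: (@le_running_max _ (U ^~ w)). Qed.

Let c_ge0 : 0 <= c.
Proof. by rewrite divr_ge0 ?subr_ge0 ?(ltW pP)// (le_trans ler01). Qed.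

Let mS i : (i <= n)%N -> measurable_wrt (G i) (S i).
Proof.
elim: i => [|i IH] lin; first exact: (mU lin).
apply: measurable_wrt_max; last exact: mU.
exact: sub_measurable_wrt (GS lin) (IH (ltnW lin)).
Qed.

(** The functional [F = S^p + c S^(p - P) U^P] does the work of Doob's inequality. By
    [running_max_powR], updating the running maximum can only lower it, so [step] with the weight
    [c S_i^(p - P)] on [A i], known at time [i], propagates its mean with the factor [g i]. At time
    0 it equals [(1 + c) U_0^p]. *)
Lemma running_max_bound :
  (\int[Pr]_w ((A n w)%:R * S n w `^ p)%:E <=
   (\prod_(i < n) g i)%:E * \int[Pr]_w ((1 + c) * U 0%N w `^ p)%:E)%E.
Proof.
have mG i (Y : T -> R) : (i <= n)%N -> measurable_wrt (G i) Y ->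
    measurable_fun setT (fun w => (Y w)%:E).
  by move=> lin mY; apply/measurable_EFinP; exact: measurable_wrt_measurable (Gm lin) mY.
have SP0 i q w : 0 <= S i w `^ q by exact: powR_ge0.
have UP0 i w : 0 <= U i w `^ P by exact: powR_ge0.
have b0 (b : bool) : 0 <= b%:R :> R by exact: ler0n.
have mSp i q : (i <= n)%N -> measurable_wrt (G i) (fun w => S i w `^ q).
  by move=> lin; apply: measurable_wrt_powR; exact: mS.
have mcS i q : (i <= n)%N -> measurable_wrt (G i) (fun w => c * S i w `^ q).
  by move=> lin; apply: measurable_wrtM; [exact: measurable_wrt_cst|exact: mSp].
have mF i : (i <= n)%N -> measurable_wrt (G i) (F i).
  move=> lin; apply: measurable_wrtD; first exact: mSp.
  apply: measurable_wrtM; first exact: mcS.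
  by apply: measurable_wrt_powR; exact: mU.
have F0 i w : 0 <= F i w by rewrite /F addr_ge0// mulr_ge0// mulr_ge0.
have main i : (i <= n)%N -> (\int[Pr]_w ((A i w)%:R * F i w)%:E <=
    (\prod_(j < i) g j)%:E * \int[Pr]_w (F 0%N w)%:E)%E.
  elim: i => [_|i IH lin].
    rewrite big_ord0 mul1e; apply: ge0_le_integral => //.
    - by move=> w _; rewrite lee_fin mulr_ge0.
    - by apply: (@mG 0%N) => //; apply: measurable_wrtM; [exact: mA|exact: mF].
    - by apply: (@mG 0%N) => //; exact: mF.
    - move=> w _; rewrite lee_fin ler_piMl//.
      by case: (A 0%N w); rewrite ?lexx// ler01.
  have lin' := ltnW lin.
  pose Q w := (A i w)%:R * (c * S i w `^ (p - P)).
  have Q0 w : 0 <= Q w by rewrite /Q mulr_ge0// mulr_ge0.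
  have mQ : measurable_wrt (G i) Q by apply: measurable_wrtM; [exact: mA|exact: mcS].
  have mAS : measurable_wrt (G i) (fun w => (A i w)%:R * S i w `^ p).
    by apply: measurable_wrtM; [exact: mA|exact: mSp].
  have mQU : measurable_wrt (G i) (fun w => Q w * U i w `^ P).
    by apply: measurable_wrtM => //; apply: measurable_wrt_powR; exact: mU.
  have mQU1 : measurable_wrt (G i.+1) (fun w => Q w * ((A i.+1 w)%:R * U i.+1 w `^ P)).
    apply: measurable_wrtM; first exact: sub_measurable_wrt (GS lin) mQ.
    by apply: measurable_wrtM; [exact: mA|apply: measurable_wrt_powR; exact: mU].
  have pw w : (A i.+1 w)%:R * F i.+1 w <=
      (A i w)%:R * S i w `^ p + Q w * ((A i.+1 w)%:R * U i.+1 w `^ P).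
    case E : (A i.+1 w); last first.
      by rewrite !mul0r mulr0 addr0 mulr_ge0.
    rewrite /Q (AS E) !mul1r.
    apply: running_max_powR => //; first exact: S_ge1.
    exact: le_trans ler01 (U_ge1 _ _).
  apply: (@le_trans _ _ (\int[Pr]_w ((A i w)%:R * S i w `^ p +
      Q w * ((A i.+1 w)%:R * U i.+1 w `^ P))%:E)%E).
    apply: ge0_le_integral => //.
    - by move=> w _; rewrite lee_fin mulr_ge0.
    - by apply: (@mG i.+1) => //; apply: measurable_wrtM; [exact: mA|exact: mF].
    - apply: (@mG i.+1) => //; apply: measurable_wrtD => //.
      exact: sub_measurable_wrt (GS lin) mAS.
    - by move=> w _; rewrite lee_fin.
  under eq_integral do rewrite EFinD.
  rewrite ge0_integralD//=; last 4 first.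
  - by move=> w _; rewrite lee_fin mulr_ge0.
  - exact: (@mG i).
  - by move=> w _; rewrite lee_fin mulr_ge0// mulr_ge0.
  - exact: (@mG i.+1).
  apply: (@le_trans _ _ ((g i)%:E * \int[Pr]_w ((A i w)%:R * F i w)%:E)%E).
    have -> : (\int[Pr]_w ((A i w)%:R * F i w)%:E =
        \int[Pr]_w ((A i w)%:R * S i w `^ p)%:E + \int[Pr]_w (Q w * U i w `^ P)%:E)%E.
      rewrite -ge0_integralD//=.
      - by apply: eq_integral => w _; rewrite -EFinD; congr EFin; rewrite /F /Q; ring.
      - by move=> w _; rewrite lee_fin mulr_ge0.
      - exact: (@mG i).
      - by move=> w _; rewrite lee_fin mulr_ge0// mulr_ge0.
      - exact: (@mG i).
    rewrite ge0_muleDr; last 2 first.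
    - by apply: integral_ge0 => w _; rewrite lee_fin mulr_ge0.
    - by apply: integral_ge0 => w _; rewrite lee_fin mulr_ge0.
    (* The part [S^p] takes no part in the step and is merely enlarged by [1 <= g i]. *)
    apply: leeD; last exact: step.
    rewrite -[leLHS]mul1e; apply: lee_wpmul2r; last by rewrite lee_fin.
    by apply: integral_ge0 => w _; rewrite lee_fin mulr_ge0.
  rewrite big_ord_recr/= mulrC EFinM -muleA.
  by apply: lee_wpmul2l; [rewrite lee_fin; exact: le_trans ler01 (g_ge1 i)|exact: IH].
have F0E w : F 0%N w = (1 + c) * U 0%N w `^ p.
  rewrite /F /S/= -mulrA -powRD; last first.
    by rewrite (@gt_eqF _ _ (U 0%N w)) ?implybT// (lt_le_trans ltr01).
  by rewrite subrK mulrDl mul1r.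
under [X in (_ <= _ * X)%E]eq_integral do rewrite -F0E.
apply: le_trans (main n (leqnn n)).
apply: ge0_le_integral => //.
- by move=> w _; rewrite lee_fin mulr_ge0.
- by apply: (@mG n) => //; apply: measurable_wrtM; [exact: mA|exact: mSp].
- by apply: (@mG n) => //; apply: measurable_wrtM; [exact: mA|exact: mF].
- by move=> w _; rewrite lee_fin ler_wpM2l// lerDl mulr_ge0// mulr_ge0.
Qed.

End maximal_inequality.

(** * Paths and reflection *)

Section paths.
Context {R : realType}.

Lemma convex_set_segment (d : nat) (D : set 'cV[R]_d) x y t :
  convex_set (M := 'cV[R]_d) D -> D x -> D y -> 0 <= t -> t <= 1 ->
  D (x + t *: (y - x)).
Proof.
move=> cD Dx Dy t0 t1.
have := cD y x (Itv01 t0 t1) (mem_set Dy) (mem_set Dx).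
rewrite inE; congr D; change (t *: y + (1 - t) *: x = x + t *: (y - x)).
by apply/matrixP => i j; rewrite !mxE; ring.
Qed.

Lemma closure_hsnorm (d : nat) (D : set 'cV[R]_d) x e : closure D x -> 0 < e ->
  exists2 y, D y & hsnorm (y - x) < e.
Proof.
move=> Dx e0; pose e' := e / (d%:R + 1).
have d1 : (0 : R) < d%:R + 1 by rewrite ltr_wpDl.
have e'0 : 0 < e' by rewrite divr_gt0.
have [y [Dy [_ yx]]] := Dx _ (nbhsx_ballx x e' e'0).
exists y => //; apply: (@le_lt_trans _ _ (d%:R * e')).
  apply: hsnorm_ler_bound; last exact: ltW.
  by move=> i; have := yx i 0; rewrite !mxE distrC => /ltW.
by rewrite /e' mulrA ltr_pdivrMr// mulrC ltr_pM2l// ltrDl.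
Qed.

(** Otherwise a small move from [x] towards [c] enters the ball around [x - r n]: the first-order
    gain [2 t r beta] beats the second-order term [t^2 |c - x|^2]. As [x] lies only in the closure,
    the move starts from a nearby [y] in [D], and convexity keeps it in [D]. *)
Lemma inward_normals_dotv (d : nat) (D : set 'cV[R]_d) x c n :
  convex_set (M := 'cV[R]_d) D -> closure D x -> D c -> inward_normals D x n ->
  dotv (x - c) n <= 0.
Proof.
move=> cD Dx Dc [r /= r0 [n1 nD]]; rewrite leNgt; apply/negP => b0.
set beta := dotv (x - c) n in b0.
pose q := hsnorm (c - x) ^+ 2.
have q0 : 0 <= q by exact: sqr_ge0.
pose t := Num.min 1 (r * beta / (q + 1)).
have q1 : 0 < q + 1 by rewrite ltr_wpDl.
have t0 : 0 < t by rewrite lt_min ltr01 divr_gt0// mulr_gt0.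
have t1 : t <= 1 by rewrite ge_min lexx.
have tq : t * q <= r * beta.
  have : t * (q + 1) <= r * beta by rewrite -ler_pdivlMr// ge_min lexx orbT.
  by rewrite mulrDr mulr1; lra.
pose v := t *: (c - x) + r *: n.
have vr : hsnorm v < r.
  rewrite -(@ltr_sqr _ (hsnorm v)) ?nnegrE ?hsnorm_ge0// ?(ltW r0)//.
  rewrite sqr_hsnormD !hsnormZ !exprMn n1 expr1n mulr1 -/q dotvZl dotvZr.
  have -> : dotv (c - x) n = - beta by rewrite -dotvNl opprB.
  rewrite !real_normK ?num_real//.
  have : t ^+ 2 * q <= t * (r * beta) by rewrite expr2 -mulrA ler_wpM2l// ltW.
  have : 0 < t * (r * beta) by rewrite !mulr_gt0.
  lra.
have [y Dy yx] := @closure_hsnorm d D x (r - hsnorm v) Dx ltac:(by rewrite subr_gt0).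
have : (eball (x - r *: n) r `&` D) (y + t *: (c - y)).
  split; last exact: convex_set_segment (ltW t0) t1.
  rewrite /eball/=.
  have -> : y + t *: (c - y) - (x - r *: n) = (1 - t) *: (y - x) + v.
    rewrite /v; apply/matrixP => i j; rewrite !mxE; ring.
  apply: le_lt_trans (ler_hsnormD _ _) _.
  rewrite hsnormZ ger0_norm ?subr_ge0//.
  have : (1 - t) * hsnorm (y - x) <= hsnorm (y - x).
    by rewrite ler_piMl ?hsnorm_ge0// gerBl ltW.
  lra.
by rewrite nD.
Qed.

(** Makes each path of the direction process measurable in time, without which its integral against
    the variation measure could not be manipulated. The sets whose section at [w] is measurable form
    a sigma-algebra containing the generating rectangles. *)
Lemma progressive_section (dO : measure_display) (Omega : measurableType dO)
    (k : nat) (T : R) (F : R -> set (set Omega)) (Y : R -> Omega -> 'cV[R]_k) :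
  0 <= T -> progressive T F Y -> forall w i,
  measurable_fun `[0, T]%classic (fun s => Y s w i 0).
Proof.
move=> T0 /(_ T T0 (lexx T)) pY w i _ B mB.
pose sec (C : set (R * Omega)) := [set s | C (s, w)].
have H : <<s `[0, T]%classic `*` setT,
    [set A `*` B | A in [set A : set R | measurable A /\ A `<=` `[0, T]%classic]
                 & B in F T] >> `<=` [set C | measurable (sec C)].
  apply: smallest_sub.
    split=> /=.
    - by rewrite /sec; exact: measurable0.
    - move=> C mC; rewrite (_ : sec _ = `[0, T]%classic `\` sec C).
        exact: measurableD.
      by apply/seteqP; split=> s /=; [move=> [[? _] ?]|move=> [? ?]].
    - move=> C mC; rewrite (_ : sec _ = \bigcup_j sec (C j)); first exact: bigcupT_measurable.
      by apply/seteqP; split=> s /=.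
  move=> _ [A [mA _]] [E _] <- /=.
  have [Ew|Ew] := pselect (E w).
    by rewrite (_ : sec _ = A)//; apply/seteqP; split=> s /=; [case|].
  by rewrite (_ : sec _ = set0)//; apply/seteqP; split=> s //= [].
have := pY i _ (ex_intro2 _ _ B mB erefl).
move/H => /=; congr measurable.
by apply/seteqP; split => s /= [] => [[? _] ?|? ?].
Qed.

Lemma unif_continuous_path (d : nat) (T : R) (x : R -> 'cV[R]_d) :
  {within `[0, T], continuous x} -> forall e, 0 < e ->
  exists2 delta, 0 < delta & forall s t, `[0, T]%classic s -> `[0, T]%classic t ->
    `|s - t| < delta -> hsnorm (x s - x t) <= e.
Proof.
move=> /subspace_continuousP cx e e0.
have e20 : 0 < e / (2 * (d%:R + 1)) by rewrite divr_gt0// mulr_gt0// ltr_wpDl.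
pose Pr (delta s : R) := `[0, T]%classic s -> forall t, `[0, T]%classic t ->
  `|s - t| < delta -> hsnorm (x s - x t) <= e.
have /compact_near_coveringP cov := @segment_compact R 0 T.
have : \forall delta \near 0^'+, `[0, T]%classic `<=` Pr delta.
  apply: cov => s s0T.
  have := cx s s0T => /cvg_ballP /(_ _ e20).
  rewrite near_withinE => -[r /= r0 rP].
  have nr : 0 < r / 2 by rewrite divr_gt0.
  have loc t : `[0, T]%classic t -> `|s - t| < r -> hsnorm (x s - x t) <= e / 2.
    move=> tT st; have [_ H] := rP t st tT.
    apply: (@le_trans _ _ (d%:R * (e / (2 * (d%:R + 1))))).
      apply: hsnorm_ler_bound; last exact: ltW.
      by move=> i; have := H i 0; rewrite !mxE => /ltW.
    have d1 : (0 : R) < d%:R + 1 by rewrite ltr_wpDl.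
    rewrite mulrA ler_pdivrMr ?mulr_gt0//.
    have -> : e / 2 * (2 * (d%:R + 1)) = (d%:R + 1) * e by field.
    by rewrite ler_wpM2r ?(ltW e0)// lerDl.
  exists ([set u | `|s - u| < r / 2], [set delta | delta < r / 2]).
    split; first by exists (r / 2).
    exact: nbhs_right_lt.
  move=> [u delta] /= [su dr] uT t tT ut.
  have h1 : hsnorm (x s - x u) <= e / 2 by apply: loc => //; apply: lt_le_trans su _; lra.
  have h2 : hsnorm (x s - x t) <= e / 2.
    apply: loc => //; have -> : s - t = (s - u) + (u - t) by ring.
    by apply: le_lt_trans (ler_normD _ _) _; lra.
  have -> : x u - x t = (x s - x t) + (x u - x s) by apply/matrixP => i j; rewrite !mxE; ring.
  apply: le_trans (ler_hsnormD _ _) _; rewrite (hsnormBC (x u)); lra.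
move=> [delta /= d0 H].
exists (delta / 2); first by rewrite divr_gt0.
move=> s t sT tT st; apply: (H (delta / 2)) => //=.
- by rewrite sub0r normrN gtr0_norm ?divr_gt0//; lra.
- by rewrite divr_gt0.
Qed.

End paths.

Section reflection.
Context {R : realType}.

(** The increment of [k] is the integral of [n] over the half-open interval; [n] is integrable
    because it is a unit vector almost everywhere and [mu] is finite. *)
Lemma reflection_increment (d : nat) (T s t om : R)
    (mu : {measure set (measurableTypeR R) -> \bar R}) (n k : R -> 'cV[R]_d)
    (z : 'cV[R]_d) :
  0 <= s -> s <= t -> t <= T ->
  (forall i, measurable_fun `[0, T]%classic (fun u => n u i 0)) ->
  (mu `[0%R, T]%classic < +oo)%E ->
  (forall u, 0 <= u -> u <= T -> k u = integralv mu `[0, u]%classic n) ->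
  {ae mu, forall u, 0 <= u -> u <= T -> hsnorm (n u) = 1} ->
  {ae mu, forall u, s <= u -> u <= t -> dotv z (n u) <= om} ->
  dotv z (k t - k s) <= om * (fine (mu `[0, t]%classic) - fine (mu `[0, s]%classic)).
Proof.
move=> s0 st tT mn muT kE n1 nz.
have mI : measurable (`]s, t]%classic : set (measurableTypeR R)) by exact: measurable_itv.
have FF := ae_filter_ringOfSetsType mu.
have sub0 u : u <= T -> `[0, u]%classic `<=` `[0, T]%classic.
  by move=> uT v /=; rewrite !in_itv/= => /andP[-> /= vu]; apply: le_trans uT.
have subst' : `]s, t]%classic `<=` `[0, T]%classic.
  move=> v /=; rewrite !in_itv/= => /andP[sv vt].
  by rewrite (le_trans s0 (ltW sv)) (le_trans vt tT).
have splitE : `[0, t]%classic = `[0, s]%classic `|` `]s, t]%classic.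
  by rewrite (@itv_bndbnd_setU _ _ _ (BRight s)) ?bnd_simp.
have disj : [disjoint `[0, s]%classic & `]s, t]%classic].
  apply/disj_setPS => v /=; rewrite !in_itv/= => -[/andP[_ vs] /andP[sv _]].
  by move: (lt_le_trans sv vs); rewrite ltxx.
have int_n i : mu.-integrable `[0, T]%classic (fun u => (n u i 0)%:E).
  apply/integrableP; split; first by apply/measurable_EFinP; exact: mn.
  apply: (@le_lt_trans _ _ (\int[mu]_(u in `[0%R, T]) 1)%E); last first.
    by rewrite integral_cst// mul1e.
  apply: ae_ge0_le_integral => //.
  - by apply: measurableT_comp => //; apply/measurable_EFinP; exact: mn.
  - apply: (@filterS _ _ FF _ _ _ n1) => u H /=; rewrite in_itv/= => /andP[u0 uT].
    by rewrite lee_fin -(H u0 uT) hsnorm_entry.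
have int_nS i (A : set (measurableTypeR R)) : measurable A -> A `<=` `[0, T]%classic ->
    mu.-integrable A (fun u => (n u i 0)%:E).
  by move=> mA AT; apply: integrableS (int_n i).
have fin_mu (A : set (measurableTypeR R)) : measurable A -> A `<=` `[0, T]%classic ->
    (mu A < +oo)%E.
  by move=> mA AT; apply: le_lt_trans muT; apply: le_measure; rewrite ?inE.
have kts i : (k t - k s) i 0 = \int[mu]_(u in `]s, t]) n u i 0.
  rewrite !mxE kE ?(le_trans s0 st)// kE ?(le_trans st tT)// !mxE splitE Rintegral_setU//.
    by rewrite addrC addKr.
  by rewrite -splitE; apply: int_nS => //; exact: sub0.
have mut : fine (mu `[0, t]%classic) - fine (mu `[0, s]%classic) = fine (mu `]s, t]%classic).
  rewrite splitE measureU//; last by apply/eqP; rewrite -disj_set2E.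
  rewrite fineD ?ge0_fin_numE//; first by rewrite addrC addKr.
  - by apply: fin_mu => //; apply: sub0; exact: le_trans tT.
  - exact: fin_mu.
have mst : mu `]s, t]%classic = (fine (mu `]s, t]%classic))%:E.
  by rewrite fineK// ge0_fin_numE// fin_mu.
pose f u := dotv z (n u).
have int_f : mu.-integrable `]s, t]%classic (fun u => (f u)%:E).
  rewrite (_ : (fun u => _) = (fun u => \sum_i (z i 0)%:E * (n u i 0)%:E)%E); last first.
    by apply/funext => u; rewrite /f /dotv sumEFin.
  by apply: integrable_sum => // i _; apply: integrableZl => //; exact: int_nS.
have int_c (c : R) : mu.-integrable `]s, t]%classic (fun=> c%:E).
  apply/integrableP; split => //.
  by rewrite integral_cst//= mst -EFinM ltry.
have fE : ((dotv z (k t - k s))%:E = \int[mu]_(u in `]s, t]) (f u)%:E)%E.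
  rewrite /dotv -sumEFin.
  under [RHS]eq_integral => u _ do rewrite /f /dotv -sumEFin.
  rewrite integral_sum//; last first.
    move=> i; apply: (@eq_integrable _ _ _ mu _ _ (fun u => (z i 0%R)%:E * (n u i 0%R)%:E)%E) => //.
    by apply: integrableZl => //; exact: int_nS.
  apply: eq_bigr => i _.
  under eq_integral do rewrite EFinM.
  rewrite integralZl//; last exact: int_nS.
  by rewrite kts EFinM fineK//; apply: integrable_fin_num => //; exact: int_nS.
rewrite mut -lee_fin fE EFinM -mst -integral_cst//.
(* The truncation agrees with [f] almost everywhere and is below [om] everywhere, as the
   monotonicity of the integral of signed functions requires. *)
pose f' u := Num.min (f u) om.
have int_f' : mu.-integrable `]s, t]%classic (fun u => (f' u)%:E).
  have mf : measurable_fun `]s, t]%classic f.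
    by apply/measurable_EFinP; exact: measurable_int int_f.
  have := integrableD mI (integrable_abse int_f) (integrable_abse (int_c om)).
  apply: le_integrable => //.
    by apply/measurable_EFinP; apply: measurable_minr.
  move=> u _; rewrite /f' /= lee_fin [leRHS]ger0_norm ?addr_ge0//.
  by rewrite minEle; case: ifP => _; rewrite ?lerDl ?lerDr.
apply: (@le_trans _ _ (\int[mu]_(u in `]s, t]) (f' u)%:E)%E).
  rewrite le_eqVlt; apply/orP; left; apply/eqP; apply: ae_eq_integral => //.
  - exact: measurable_int int_f.
  - exact: measurable_int int_f'.
  - apply: (@filterS _ _ FF _ _ _ nz) => u H /=; rewrite in_itv/= => /andP[/ltW su ut].
    by rewrite /f' min_l//; exact: H.
apply: le_integral => //; first exact: int_c.
by move=> u _; rewrite lee_fin /f' ge_min lexx orbT.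
Qed.

Lemma kappa_step (h u : R) (k : nat) : 0 < h -> k%:R * h <= u -> u < k.+1%:R * h ->
  kappa h u = k%:R * h.
Proof.
move=> h0 ku uk; rewrite /kappa; congr (_ * _).
have -> : Num.floor (u / h) = k%:Z; last by [].
apply: floor_def; rewrite ler_pdivlMr// ltr_pdivrMr// intrD ku/=.
by move: uk; rewrite -natr1.
Qed.

Lemma kappa_grid (h : R) (k : nat) : 0 < h -> kappa h (k%:R * h) = k%:R * h.
Proof. by move=> h0; apply: kappa_step => //; rewrite ltr_pM2r// ltr_nat. Qed.

Lemma step_integrable (N : nat) (h t : R) (g : R -> R) :
  0 < h -> 0 <= t -> t <= N%:R * h ->
  (@lebesgue_measure R).-integrable `[0, t]%classic (fun u => (g (kappa h u))%:E).
Proof.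
move=> h0 t0 tN.
pose I (l : nat) : set R := `[l%:R * h, l.+1%:R * h[%classic.
(* There are [N + 1] intervals because at the right end [u = N h] the value of [kappa h u] is [N h],
   the start of a step beyond the last one. *)
have E u : `[0, t]%classic u ->
    g (kappa h u) = \sum_(l < N.+1) g (l%:R * h) * \1_(I l) u.
  rewrite /= in_itv/= => /andP[u0 ut].
  pose l0 := Num.truncn (u / h).
  have uh0 : 0 <= u / h by rewrite divr_ge0// ltW.
  have /andP[l1 l2] := truncn_itv uh0.
  have lN : (l0 < N.+1)%N.
    rewrite ltnS -(@ler_nat R) (le_trans l1)// ler_pdivrMr// (le_trans ut)//.
  have l1' : l0%:R * h <= u by rewrite -ler_pdivlMr.
  have l2' : u < l0.+1%:R * h by rewrite -ltr_pdivrMr.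
  rewrite (bigD1 (Ordinal lN))//= [X in _ + X]big1 ?addr0.
    by rewrite indicE mem_set ?mulr1 ?(kappa_step h0 l1' l2')// /I/= in_itv/= l1' l2'.
  move=> l ll; rewrite indicE memNset ?mulr0// /I/= in_itv/= => /andP[k1 k2].
  have a1 : (l < l0.+1)%N by rewrite -(@ltr_nat R) -(ltr_pM2r h0) (le_lt_trans k1).
  have a2 : (l0 < l.+1)%N by rewrite -(@ltr_nat R) -(ltr_pM2r h0) (le_lt_trans l1').
  by case/eqP: ll; apply/val_inj/eqP; rewrite /= eqn_leq -ltnS a1 -ltnS a2.
apply: (@eq_integrable _ (measurableTypeR R) R lebesgue_measure _ (measurable_itv _)
    (fun u => (\sum_(l < N.+1) g (l%:R * h) * \1_(I l) u)%:E)) => //.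
  by move=> u /set_mem /E ->.
rewrite (_ : (fun u => _) =
    (fun u => \sum_(l < N.+1) ((g (l%:R * h))%:E * (\1_(I l) u)%:E))%E); last first.
  by apply/funext => u; rewrite -sumEFin.
apply: integrable_sum => // l _; apply: integrableZl => //.
have ii := integrable_indic_itv (l%:R * h) (l.+1%:R * h) true true.
by apply: integrableS ii => //; exact: measurable_itv.
Qed.

Lemma drift_increment (d N : nat) (h s t : R) (k : nat) (g : R -> 'cV[R]_d) :
  0 < h -> (k < N)%N -> k%:R * h <= s -> s <= t -> t <= k.+1%:R * h ->
  integralv lebesgue_measure `[0, t]%classic (fun u => g (kappa h u)) -
  integralv lebesgue_measure `[0, s]%classic (fun u => g (kappa h u)) =
  (t - s) *: g (k%:R * h).
Proof.
move=> h0 kN ks st tk; apply/matrixP => i j; rewrite !mxE (ord1 j).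
have ks0 : 0 <= k%:R * h by rewrite mulr_ge0// ltW.
have s0 : 0 <= s by apply: le_trans ks.
have t0 : 0 <= t by apply: le_trans st.
have tN : t <= N%:R * h by apply: le_trans tk _; rewrite ler_pM2r// ler_nat.
have int0 := step_integrable (fun v => g v i 0) h0 t0 tN.
rewrite (@Rintegral_itvB _ _ _ _ s)//.
(* The right end is dropped: if [t = (k + 1) h], it already belongs to the next step. *)
rewrite -Rintegral_itv_bndo_bndc; last first.
  apply: integrableS int0 => //.
  by move=> u /=; rewrite !in_itv/= => /andP[su ut]; rewrite (le_trans s0 (ltW su)) ltW.
transitivity (\int[lebesgue_measure]_(u in `]s, t[) g (k%:R * h) i 0).
  apply: eq_Rintegral => u; rewrite inE/= in_itv/= => /andP[su ut].
  rewrite (@kappa_step _ _ k)//; first by rewrite (le_trans ks)// ltW.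
  exact: lt_le_trans ut tk.
rewrite Rintegral_cst; last exact: measurable_itv.
rewrite mulrC; congr (_ * _); rewrite /= lebesgue_measure_itv/= lte_fin.
by case: ltP => // ts; apply/eqP; rewrite /= eq_sym subr_eq0 eq_le ts st.
Qed.

(** During step [k] the earlier summands have stopped and the later ones have not begun. *)
Lemma ito_increment (d m N : nat) (h s t : R) (k : nat) (Z : R -> 'M[R]_(d, m))
    (W : R -> 'cV[R]_m) :
  0 < h -> (k < N)%N -> k%:R * h <= s -> s <= t -> t <= k.+1%:R * h ->
  simple_ito h N Z W t - simple_ito h N Z W s = Z (k%:R * h) *m (W t - W s).
Proof.
move=> h0 kN ks st tk; rewrite /simple_ito -sumrB.
rewrite (bigD1 (Ordinal kN))//= [X in _ + X]big1 ?addr0.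
  have ks1 : s <= k.+1%:R * h by apply: le_trans st tk.
  have kt : k%:R * h <= t by apply: le_trans ks st.
  by rewrite -mulmxBr !(min_l tk) !(min_l ks1) !(min_r kt) !(min_r ks) opprB addrA subrK.
move=> l lk; rewrite -mulmxBr.
have [lk1|kl] := ltnP l k.
  have H u j : k%:R * h <= u -> (j <= k)%N -> Num.min u (j%:R * h) = j%:R * h.
    move=> ku jk; apply: min_r; apply: le_trans ku.
    by rewrite ler_pM2r// ler_nat.
  have kt : k%:R * h <= t by apply: le_trans ks st.
  by rewrite !H ?subrr ?mulmx0// ltnW.
have {}kl : (k < l)%N.
  by rewrite ltn_neqAle kl andbT; apply: contra lk => /eqP e; apply/eqP/val_inj; rewrite /= e.
have H u j : u <= k.+1%:R * h -> (k < j)%N -> Num.min u (j%:R * h) = u.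
  by move=> uk kj; apply: min_l; apply: le_trans uk _; rewrite ler_pM2r// ler_nat.
by rewrite !H ?subrr ?mulmx0 ?(le_trans st tk)// ltnW.
Qed.

End reflection.

(** * Tamed coefficients *)

Section scheme.
Context {R : realType} {d m : nat}.
Variables (b : 'cV[R]_d -> 'cV[R]_d) (sigma : 'cV[R]_d -> 'M[R]_(d, m)).
Implicit Types (x y z u : 'cV[R]_d) (h kap eps r theta : R).

Lemma growth_ge0 x : 0 <= growth b sigma x.
Proof. by rewrite addr_ge0 ?hsnorm_ge0 ?sqr_ge0. Qed.

Lemma taming_gt0 h x : 0 < taming b sigma h x.
Proof. by rewrite invr_gt0 ltr_wpDr// mulr_ge0 ?sqrtr_ge0 ?growth_ge0. Qed.

Lemma taming_le1 h x : taming b sigma h x <= 1.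
Proof. by rewrite invf_le1 ?lerDl ?mulr_ge0 ?sqrtr_ge0 ?growth_ge0// -invr_gt0 taming_gt0. Qed.

Lemma taming_growth h x : taming b sigma h x * (Num.sqrt h * growth b sigma x) <= 1.
Proof.
have := taming_gt0 h x; rewrite /taming invr_gt0; set D := 1 + _ => D0.
by rewrite mulrC ler_pdivrMr// mul1r /D lerDr.
Qed.

Lemma tamed_drift_le h x : Num.sqrt h * hsnorm (tamed_drift b sigma h x) <= 1.
Proof.
rewrite hsnormZ gtr0_norm ?taming_gt0//; apply: le_trans (taming_growth h x).
rewrite mulrCA; apply: ler_wpM2l; first exact/ltW/taming_gt0.
by rewrite ler_wpM2l ?sqrtr_ge0// lerDl sqr_ge0.
Qed.

Lemma sqr_tamed_diffusion h x : hsnorm (tamed_diffusion b sigma h x) ^+ 2 =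
  taming b sigma h x * hsnorm (sigma x) ^+ 2.
Proof.
by rewrite hsnormZ exprMn real_normK ?num_real// sqr_sqrtr// ltW// taming_gt0.
Qed.

Lemma tamed_diffusion_le h x :
  Num.sqrt h * hsnorm (tamed_diffusion b sigma h x) ^+ 2 <= 1.
Proof.
rewrite sqr_tamed_diffusion; apply: le_trans (taming_growth h x).
rewrite mulrCA; apply: ler_wpM2l; first exact/ltW/taming_gt0.
by rewrite ler_wpM2l ?sqrtr_ge0// lerDr hsnorm_ge0.
Qed.

Lemma sqr_hsnorm_young eps (A B : 'M[R]_(d, m)) : 0 < eps ->
  hsnorm A ^+ 2 <= (1 + eps) * hsnorm (A - B) ^+ 2 + (1 + eps^-1) * hsnorm B ^+ 2.
Proof.
move=> e0; rewrite !sqr_hsnorm !mulr_sumr -big_split; apply: ler_sum => i _ /=.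
rewrite !mulr_sumr -big_split; apply: ler_sum => j _ /=; rewrite !mxE.
set s := A i j; set t := B i j; rewrite -subr_ge0.
have -> : (1 + eps) * (s - t) ^+ 2 + (1 + eps^-1) * t ^+ 2 - s ^+ 2 =
   (eps * (s - t) - t) ^+ 2 / eps by field; rewrite gt_eqF.
by rewrite mulr_ge0 ?sqr_ge0// invr_ge0 ltW.
Qed.

Lemma lyapunov_ge1 (xs x : 'cV[R]_d) : 1 <= lyapunov xs x.
Proof. by rewrite lerDl sqr_ge0. Qed.

(** The condition is used at [y = xs]. Young's inequality with [kap (1 + eps) = 2 eta] separates
    [sigma x] from [sigma xs]; a positive [eps] exists because [kap < 2 eta] is strict. *)
Lemma monotone_coercive (L eta kap : R) xs : 0 < L -> 0 < kap -> kap < 2 * eta ->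
  (forall x y, dotv (x - y) (b x - b y) + eta * hsnorm (sigma x - sigma y) ^+ 2
     <= L * hsnorm (x - y) ^+ 2) ->
  exists2 C : R, 0 <= C & forall x,
    2 * dotv (x - xs) (b x) + kap * hsnorm (sigma x) ^+ 2 <= C * lyapunov xs x.
Proof.
move=> L0 k0 ke mono.
pose eps := 2 * eta / kap - 1.
have e0 : 0 < eps by rewrite subr_gt0 ltr_pdivlMr// mul1r.
have ek : kap * (1 + eps) = 2 * eta.
  by rewrite /eps addrCA subrr addr0 mulrC divfK// gt_eqF.
pose c1 := hsnorm (b xs) ^+ 2; pose c2 := kap * (1 + eps^-1) * hsnorm (sigma xs) ^+ 2.
have c10 : 0 <= c1 by exact: sqr_ge0.
have c20 : 0 <= c2.
  by rewrite /c2 mulr_ge0 ?sqr_ge0// mulr_ge0 ?(ltW k0)// addr_ge0// invr_ge0 ltW.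
exists (2 * L + 1 + c1 + c2); first by rewrite !addr_ge0// mulr_ge0// ltW.
move=> x; have := mono x xs; rewrite dotvBr /lyapunov.
have := sqr_hsnorm_young (sigma x) (sigma xs) e0.
move/(ler_wpM2l (ltW k0)); rewrite mulrDr (mulrA kap (1 + eps)) ek (mulrA kap (1 + eps^-1)) -/c2.
have := le_trans (ler_norm _) (ler_norm_dotv (x - xs) (b xs)).
have : 2 * (hsnorm (x - xs) * hsnorm (b xs)) <= hsnorm (x - xs) ^+ 2 + c1.
  by have := sqr_ge0 (hsnorm (x - xs) - hsnorm (b xs)); rewrite /c1; lra.
have := sqr_ge0 (hsnorm (x - xs)).
set n2 := hsnorm (x - xs) ^+ 2; set s2 := hsnorm (sigma x - sigma xs) ^+ 2.
set D := dotv _ _; set D' := dotv _ _; set q := _ * hsnorm (b xs).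
move=> n20 qc Dq Y H.
have : 0 <= (c1 + c2) * n2 by rewrite mulr_ge0// addr_ge0.
lra.
Qed.

(** The coupling of the taming is used here: drift and squared diffusion carry the same factor, at
    most 1, so the inequality is only rescaled. *)
Lemma tamed_coercive (C kap h : R) xs x : 0 <= C ->
  2 * dotv (x - xs) (b x) + kap * hsnorm (sigma x) ^+ 2 <= C * lyapunov xs x ->
  2 * dotv (x - xs) (tamed_drift b sigma h x) +
    kap * hsnorm (tamed_diffusion b sigma h x) ^+ 2 <= C * lyapunov xs x.
Proof.
move=> C0 H; rewrite sqr_tamed_diffusion dotvZr.
set l := taming b sigma h x.
have -> : 2 * (l * dotv (x - xs) (b x)) + kap * (l * hsnorm (sigma x) ^+ 2) =
   l * (2 * dotv (x - xs) (b x) + kap * hsnorm (sigma x) ^+ 2) by ring.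
apply: le_trans (ler_wpM2l (ltW (taming_gt0 h x)) H) _.
rewrite ler_piMl ?taming_le1// mulr_ge0//.
exact: le_trans ler01 (lyapunov_ge1 _ _).
Qed.

(* At the start of a step the centre jumps from [xs] to [xs - theta h a]. Only
   when the step is shorter than [r ^ 2] ([theta = 1]) is the full look-ahead
   used; otherwise the coefficients are bounded by [1 / r]. *)
Lemma start_of_step (C kap h r : R) (y a : 'cV[R]_d) (S : 'M[R]_(d, m)) (theta : R) :
  0 < h -> h <= 1 -> 0 < r -> 0 <= C -> 0 <= kap ->
  theta = (if Num.sqrt h <= r then 1 else 0) ->
  Num.sqrt h * hsnorm a <= 1 -> Num.sqrt h * hsnorm S ^+ 2 <= 1 ->
  2 * dotv y a + kap * hsnorm S ^+ 2 <= C * (1 + hsnorm y ^+ 2) ->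
  1 + hsnorm (y + (theta * h) *: a) ^+ 2 + kap * h * hsnorm S ^+ 2
    <= (1 + (C + 1 + kap / r) * h) * (1 + hsnorm y ^+ 2).
Proof.
move=> h0 h1 r0 C0 k0 -> ha hS coer.
have hh : Num.sqrt h ^+ 2 = h by rewrite sqr_sqrtr// ltW.
have s0 : 0 < Num.sqrt h by rewrite sqrtr_gt0.
have n0 := sqr_ge0 (hsnorm y).
have kr : 0 <= kap / r by rewrite divr_ge0// ltW.
have krh : 0 <= kap / r * h * (1 + hsnorm y ^+ 2).
  by apply: mulr_ge0; [apply: mulr_ge0 => //; exact: ltW|exact: addr_ge0].
case: ifPn => [_|]; last rewrite -ltNge => rs.
  rewrite mul1r sqr_hsnormD dotvZr hsnormZ exprMn real_normK ?num_real//.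
  (* Squaring the taming bound gives [h |a|^2 <= 1]. *)
  have h2a : h ^+ 2 * hsnorm a ^+ 2 <= h.
    rewrite -{1}hh -[leRHS]mulr1 -exprM.
    have -> : Num.sqrt h ^+ (2 * 2) * hsnorm a ^+ 2 = h * (Num.sqrt h * hsnorm a) ^+ 2.
      by rewrite -{2}hh; ring.
    by rewrite ler_wpM2l ?(ltW h0)// exprn_ile1// mulr_ge0 ?hsnorm_ge0 ?(ltW s0).
  move/(ler_wpM2l (ltW h0)) : coer.
  have : 0 <= h * hsnorm y ^+ 2 by rewrite mulr_ge0// ltW.
  set n := hsnorm y ^+ 2 in n0 krh *; set D := dotv y a; set q := hsnorm S ^+ 2.
  set k' := kap / r in kr krh *; set ha2 := _ * hsnorm a ^+ 2 in h2a *.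
  move=> hn; lra.
rewrite mul0r scale0r addr0.
(* Now [r < sqrt h], so [kap h |S|^2 <= kap sqrt h <= kap h / r]. *)
have : kap * h * hsnorm S ^+ 2 <= kap / r * h.
  have -> : kap * h * hsnorm S ^+ 2 = kap * Num.sqrt h * (Num.sqrt h * hsnorm S ^+ 2).
    by rewrite -[in LHS]hh; ring.
  apply: (@le_trans _ _ (kap * Num.sqrt h * 1)).
    by rewrite ler_wpM2l// mulr_ge0// ltW.
  have -> : kap / r * h = kap * Num.sqrt h * (Num.sqrt h / r).
    by rewrite -[in LHS]hh; field; rewrite gt_eqF.
  by rewrite ler_wpM2l ?mulr_ge0 ?(ltW s0)// ler_pdivlMr// mul1r ltW.
have : 0 <= (C + 1) * h * (1 + hsnorm y ^+ 2).
  by apply: mulr_ge0; [apply: mulr_ge0; [exact: addr_ge0|exact: ltW]|exact: addr_ge0].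
have : 0 <= kap / r * h * hsnorm y ^+ 2.
  by apply: mulr_ge0 => //; apply: mulr_ge0 => //; exact: ltW.
set n := hsnorm y ^+ 2 in n0 krh *; set k' := kap / r in kr krh *.
set q := _ * hsnorm S ^+ 2.
lra.
Qed.

(** For drift that the centre does not cancel: [2 |u| t <= t (1 + |u|^2)], and the 1 is covered by
    [c]. *)
Lemma drift_absorb (t c : R) (u a : 'cV[R]_d) : 0 <= t -> 1 <= c -> hsnorm a <= t ->
  c + hsnorm (u + a) ^+ 2 <= (1 + t) ^+ 2 * (c + hsnorm u ^+ 2).
Proof.
move=> t0 c1 at_; rewrite sqr_hsnormD.
have a0 := hsnorm_ge0 a; have u0 := hsnorm_ge0 u.
have : dotv u a <= hsnorm u * t by apply: le_trans (ler_dotv u a) _; rewrite ler_wpM2l.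
have : hsnorm a ^+ 2 <= t ^+ 2 by rewrite ler_sqr ?nnegrE.
have : 2 * (hsnorm u * t) <= t * (1 + hsnorm u ^+ 2).
  by have := mulr_ge0 t0 (sqr_ge0 (hsnorm u - 1)); lra.
have t2 : 0 <= t ^+ 2 by exact: sqr_ge0.
have : 0 <= (2 * t + t ^+ 2) * (c - 1).
  by apply: mulr_ge0; [apply: addr_ge0 => //; exact: mulr_ge0|rewrite subr_ge0].
have : 0 <= (t + t ^+ 2) * hsnorm u ^+ 2.
  by apply: mulr_ge0; [exact: addr_ge0|exact: sqr_ge0].
set n := hsnorm u ^+ 2; set D := dotv u a; set na := hsnorm a ^+ 2; set nt := hsnorm u * t.
move=> *; lra.
Qed.

Section measurability.
Context {dO : measure_display} {Omega : measurableType dO}.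
Variables (G : set (set Omega)) (X : Omega -> 'cV[R]_d) (h : R).
Hypotheses (b_cont : continuous b) (sigma_cont : continuous sigma).
Hypothesis mX : forall i, measurable_wrt G (fun w => X w i 0).

Let mb i : measurable_wrt G (fun w => b (X w) i 0).
Proof.
apply: (@measurable_wrt_continuous _ _ _ G d (fun x => b x i 0)) => //.
move=> x; apply: (@continuous_comp _ _ _ b (fun y : 'cV[R]_d => y i 0)).
  exact: b_cont.
exact: coord_continuous.
Qed.

Let ms i j : measurable_wrt G (fun w => sigma (X w) i j).
Proof.
apply: (@measurable_wrt_continuous _ _ _ G d (fun x => sigma x i j)) => //.
move=> x; apply: (@continuous_comp _ _ _ sigma (fun y : 'M[R]_(d, m) => y i j)).
  exact: sigma_cont.
exact: coord_continuous.
Qed.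

Let mt : measurable_wrt G (fun w => taming b sigma h (X w)).
Proof.
rewrite (_ : (fun w => _) = fun w => (1 + Num.sqrt h *
    ((hsnorm (b (X w)) ^+ 2) `^ 2^-1 + hsnorm (sigma (X w)) ^+ 2)) `^ (-1)).
  apply: measurable_wrt_powR; apply: measurable_wrtD; first exact: measurable_wrt_cst.
  apply: measurable_wrtM; first exact: measurable_wrt_cst.
  apply: measurable_wrtD; last exact: measurable_wrt_sqr_hsnorm.
  apply: measurable_wrt_powR; apply: measurable_wrt_sqr_hsnorm => i j.
  by rewrite (ord1 j).
apply/funext => w; rewrite powR12_sqrt ?sqr_ge0// sqrtr_sqr ger0_norm ?hsnorm_ge0//.
by rewrite powR_inv1// addr_ge0// mulr_ge0 ?sqrtr_ge0 ?(growth_ge0 (X w)).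
Qed.

Lemma measurable_tamed_drift i : measurable_wrt G (fun w => tamed_drift b sigma h (X w) i 0).
Proof.
rewrite (_ : (fun w => _) = fun w => taming b sigma h (X w) * b (X w) i 0).
  exact: measurable_wrtM.
by apply/funext => w; rewrite mxE.
Qed.

Lemma measurable_tamed_diffusion i j :
  measurable_wrt G (fun w => tamed_diffusion b sigma h (X w) i j).
Proof.
rewrite (_ : (fun w => _) = fun w => taming b sigma h (X w) `^ 2^-1 * sigma (X w) i j).
  by apply: measurable_wrtM => //; exact: measurable_wrt_powR.
by apply/funext => w; rewrite mxE powR12_sqrt// ltW// taming_gt0.
Qed.

End measurability.
End scheme.

(** * The refined grid *)

Section grid.
Context {R : realType} {d m : nat} {Omega : Type}.
Variables (b : 'cV[R]_d -> 'cV[R]_d) (sigma : 'cV[R]_d -> 'M[R]_(d, m)).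
Variables (xs : 'cV[R]_d) (X : R -> Omega -> 'cV[R]_d) (W : R -> Omega -> 'cV[R]_m).
Variables (h : R) (M : nat) (theta kap : R).

Definition mesh : R := h / M%:R.
Definition grid_time (i : nat) : R := i%:R * mesh.
(** Time left in the current step, whose index is [i %/ M]. It is [h], not 0, when [M] divides [i]:
    such a point is counted with the step that it opens. *)
Definition grid_rem (i : nat) : R := h - (i %% M)%:R * mesh.
Definition grid_drift i w := tamed_drift b sigma h (X ((i %/ M)%:R * h) w).
Definition grid_diffusion i w := tamed_diffusion b sigma h (X ((i %/ M)%:R * h) w).

(* Position relative to the centre [xs - theta (t_(k+1) - t) a], which moves with
   the frozen drift [a] and returns to [xs] at the end of the step. *)
Definition lookahead i w :=
  X (grid_time i) w - xs + (theta * grid_rem i) *: grid_drift i w.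

Definition lookahead_next i w :=
  X (grid_time i.+1) w - xs + (theta * (grid_rem i - mesh)) *: grid_drift i w.

Definition noise i w := W (grid_time i.+1) w - W (grid_time i) w.

(* [lookahead_next] without the contribution of the reflection. *)
Definition unreflected i w :=
  lookahead i w + grid_diffusion i w *m noise i w
    + ((1 - theta) * mesh) *: grid_drift i w.

(** What the reflection adds to the squared distance over one piece. It can be positive because the
    normals belong to intermediate positions of the path, not to the one at the right end. *)
Definition defect i w : R :=
  Num.max 0 (hsnorm (lookahead_next i w) ^+ 2 - hsnorm (unreflected i w) ^+ 2).

Definition total_defect i w : R := \sum_(l < i) defect l w.

Definition small_defect i w : bool := total_defect i w <= 1.

(** Starts at 2 and is reduced by every defect. The cut-off at 1 keeps the energy at least 1 on all
    of [Omega], also where the defects are large. *)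
Definition budget i w : R := Num.max 1 (2 - total_defect i w).

Definition energy i w : R :=
  budget i w + hsnorm (lookahead i w) ^+ 2
    + kap * grid_rem i * hsnorm (grid_diffusion i w) ^+ 2.

Lemma defect_ge0 i w : 0 <= defect i w.
Proof. by rewrite le_max lexx. Qed.

Lemma total_defectS i w : total_defect i.+1 w = total_defect i w + defect i w.
Proof. by rewrite /total_defect big_ord_recr. Qed.

Lemma small_defectS i w : small_defect i.+1 w -> small_defect i w.
Proof.
by apply: le_trans; rewrite total_defectS lerDl defect_ge0.
Qed.

Lemma budget_ge1 i w : 1 <= budget i w.
Proof. by rewrite le_max lexx. Qed.

Hypotheses (h_gt0 : 0 < h) (M_gt0 : (0 < M)%N).

Lemma mesh_gt0 : 0 < mesh.
Proof. by rewrite divr_gt0// ltr0n. Qed.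

Lemma mulr_mesh : M%:R * mesh = h.
Proof. by rewrite mulrCA divff ?mulr1// pnatr_eq0 -lt0n. Qed.

Lemma step_time k : k%:R * h = (k * M)%:R * mesh.
Proof. by rewrite natrM -mulrA mulr_mesh. Qed.

Lemma grid_rem_ge i : mesh <= grid_rem i.
Proof.
rewrite lerBrDl -mulr_mesh -[X in _ + X]mul1r -mulrDl ler_pM2r ?mesh_gt0//.
by rewrite natr1 ler_nat ltn_pmod.
Qed.

Lemma grid_rem_le i : grid_rem i <= h.
Proof. by rewrite gerBl mulr_ge0// ltW// mesh_gt0. Qed.

Lemma grid_rem_ge0 i : 0 <= grid_rem i.
Proof. exact: le_trans (ltW mesh_gt0) (grid_rem_ge i). Qed.

Lemma energy_ge1 i w : 0 <= kap -> 1 <= energy i w.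
Proof.
move=> k0; rewrite /energy -addrA; apply: le_trans (budget_ge1 i w) _.
by rewrite lerDl addr_ge0 ?sqr_ge0// !mulr_ge0 ?grid_rem_ge0 ?hsnorm_ge0.
Qed.

Lemma grid_time_step i : (i %/ M)%:R * h <= grid_time i /\
  grid_time i.+1 <= (i %/ M).+1%:R * h.
Proof.
rewrite /grid_time !step_time !(ler_pM2r mesh_gt0) !ler_nat.
split; first exact: leq_divM.
by rewrite ltn_ceil.
Qed.

(** The budget pays for the defect, and [1 + l mesh] for the drift that the centre does not cancel.
    If a new step opens at [i + 1], the old quadratic variation is used up and [start] pays for the
    new look-ahead and the new quadratic variation; the boolean exponent switches this factor on. *)
Lemma energy_step (l C : R) i w : 0 <= l -> 0 <= C -> 0 <= kap ->
  (forall x, hsnorm ((1 - theta) *: tamed_drift b sigma h x) <= l) ->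
  (forall x, 1 + hsnorm (x - xs + (theta * h) *: tamed_drift b sigma h x) ^+ 2
      + kap * h * hsnorm (tamed_diffusion b sigma h x) ^+ 2
    <= (1 + C * h) * (1 + hsnorm (x - xs) ^+ 2)) ->
  small_defect i.+1 w ->
  energy i.+1 w <= (1 + l * mesh) ^+ 2 * (1 + C * h) ^+ (M %| i.+1) *
    (budget i w + kap * (grid_rem i - mesh) * hsnorm (grid_diffusion i w) ^+ 2
     + hsnorm (lookahead i w + grid_diffusion i w *m noise i w) ^+ 2).
Proof.
move=> l0 C0 k0 al start sd.
have sd' := small_defectS sd.
have bE j : small_defect j w -> budget j w = 2 - total_defect j w.
  by move=> H; rewrite /budget max_r// lerBrDr -lerBrDl; move: H; rewrite /small_defect; lra.
have c1 := budget_ge1 i.+1 w.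
set S2 := hsnorm (grid_diffusion i w) ^+ 2.
have rm0 : 0 <= kap * (grid_rem i - mesh) * S2.
  by rewrite mulr_ge0 ?sqr_ge0// mulr_ge0// subr_ge0 grid_rem_ge.
have next_le : hsnorm (lookahead_next i w) ^+ 2 <=
    hsnorm (unreflected i w) ^+ 2 + defect i w.
  by rewrite -lerBlDl le_max lexx orbT.
have bS : budget i.+1 w + defect i w = budget i w.
  by rewrite !bE// total_defectS; ring.
have absorb : budget i w + kap * (grid_rem i - mesh) * S2 + hsnorm (unreflected i w) ^+ 2
    <= (1 + l * mesh) ^+ 2 * (budget i w + kap * (grid_rem i - mesh) * S2
       + hsnorm (lookahead i w + grid_diffusion i w *m noise i w) ^+ 2).
  apply: drift_absorb.
  - by rewrite mulr_ge0// ltW// mesh_gt0.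
  - by rewrite -[leLHS]addr0 lerD ?budget_ge1.
  - rewrite (mulrC (1 - theta)) -scalerA hsnormZ (gtr0_norm mesh_gt0) (mulrC mesh).
    by apply: (ler_wpM2r (ltW mesh_gt0)); exact: al.
set rhs := budget i w + _ + hsnorm (lookahead i w + _) ^+ 2 in absorb *.
have main : budget i.+1 w + hsnorm (lookahead_next i w) ^+ 2
    + kap * (grid_rem i - mesh) * S2 <= (1 + l * mesh) ^+ 2 * rhs.
  apply: le_trans absorb; rewrite -bS; lra.
have [Mi|Mi] := boolP (M %| i.+1)%N; last first.
  rewrite expr0 mulr1; apply: le_trans main.
  have E1 : (i.+1 %/ M = i %/ M)%N by rewrite divnS// (negbTE Mi).
  have E2 : (i.+1 %% M = (i %% M).+1)%N by rewrite modnS (negbTE Mi).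
  have E3 : grid_rem i.+1 = grid_rem i - mesh.
    by rewrite /grid_rem E2 -natr1 mulrDl mul1r opprD addrA.
  by rewrite /energy /lookahead /grid_drift /grid_diffusion E1 E3.
rewrite expr1.
have E1 : (i.+1 %/ M = (i %/ M).+1)%N by rewrite divnS// Mi.
have E2 : (i.+1 %% M = 0)%N by rewrite modnS Mi.
have E3 : grid_rem i.+1 = h by rewrite /grid_rem E2 mul0r subr0.
have E4 : grid_rem i = mesh.
  have : ((i %% M).+1 = M)%N.
    have := divn_eq i.+1 M; rewrite E1 E2 addn0 mulSn [in LHS](divn_eq i M).
    by rewrite -addnS addnC => /addIn.
  move=> iM; rewrite /grid_rem -[X in X - _]mulr_mesh -[in X in X - _]iM.
  by rewrite -natr1 mulrDl mul1r addrAC subrr add0r.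
have E5 : grid_time i.+1 = (i.+1 %/ M)%:R * h.
  by rewrite /grid_time step_time divnK.
have E6 : lookahead_next i w = X (grid_time i.+1) w - xs.
  by rewrite /lookahead_next E4 subrr mulr0 scale0r addr0.
rewrite E6 E4 subrr mulr0 mul0r addr0 in main.
rewrite mulrAC mulrC; apply: le_trans (ler_wpM2l _ main); last first.
  by rewrite addr_ge0// mulr_ge0// ltW.
rewrite /energy /lookahead /grid_drift /grid_diffusion E3 E5.
have := start (X ((i.+1 %/ M)%:R * h) w).
set A := hsnorm _ ^+ 2; set B := kap * h * _; set Y := hsnorm (_ - xs) ^+ 2.
(* [start] has the constant 1 in place of the budget; the excess of the budget over 1 only helps. *)
have : 0 <= C * h * (budget i.+1 w - 1).
  by rewrite mulr_ge0 ?subr_ge0// mulr_ge0// ltW.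
lra.
Qed.

(** The centre stays within distance 1 of [xs], because [h |a| <= sqrt h <= 1]; the budget covers
    the constants. *)
Lemma lyapunov_le_energy i w : h <= 1 -> 0 <= theta <= 1 -> 0 <= kap ->
  lyapunov xs (X (grid_time i) w) <= 3 * energy i w.
Proof.
move=> h1 /andP[t0 t1] k0.
set a := grid_drift i w.
have ah : hsnorm ((theta * grid_rem i) *: a) <= 1.
  rewrite hsnormZ ger0_norm ?mulr_ge0 ?grid_rem_ge0//.
  have s0 := sqrtr_ge0 h; have s1 : Num.sqrt h <= 1.
    by have := ler_wsqrtr h1; rewrite sqrtr1.
  have a0 := hsnorm_ge0 a.
  apply: (@le_trans _ _ (h * hsnorm a)).
    rewrite ler_wpM2r//; apply: le_trans (grid_rem_le i).
    by rewrite ler_piMl ?grid_rem_ge0.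
  apply: le_trans (tamed_drift_le b sigma h (X ((i %/ M)%:R * h) w)).
  rewrite ler_wpM2r// -{1}(sqr_sqrtr (ltW h_gt0)) expr2.
  by rewrite ler_piMl.
have E : X (grid_time i) w - xs = lookahead i w - (theta * grid_rem i) *: a.
  by rewrite /lookahead addrK.
rewrite /lyapunov E /energy.
have := ler_sqr_hsnormD (lookahead i w) (- ((theta * grid_rem i) *: a)).
rewrite hsnormN.
have : hsnorm ((theta * grid_rem i) *: a) ^+ 2 <= 1 by rewrite exprn_ile1 ?hsnorm_ge0.
have := budget_ge1 i w; have := sqr_ge0 (hsnorm (lookahead i w)).
have : 0 <= kap * grid_rem i * hsnorm (grid_diffusion i w) ^+ 2.
  by rewrite mulr_ge0 ?sqr_ge0// mulr_ge0 ?grid_rem_ge0.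
set n := hsnorm (lookahead i w) ^+ 2; set q := hsnorm (_ *: a) ^+ 2.
set S2 := kap * grid_rem i * _; set nn := hsnorm (_ - _) ^+ 2.
lra.
Qed.

End grid.

Lemma adapted_measurable_wrt {R : realType} {dO : measure_display}
    {Omega : measurableType dO} (k : nat) (J : set R) (F : R -> set (set Omega))
    (Y : R -> Omega -> 'cV[R]_k) t i :
  adapted J F Y -> J t -> measurable_wrt (F t) (fun w => Y t w i 0).
Proof.
move=> aY Jt _ B mB; apply: sub_sigma_algebra; apply: (aY t Jt).
by apply: sub_sigma_algebra; exists i => //; exists B.
Qed.

(** * Measurability along the grid and the integrated one-step estimate *)

Section grid_process.
Context {R : realType} {d m : nat} {dO : measure_display} {Omega : measurableType dO}.
Variables (Pr : probability Omega R) (F : R -> set (set Omega)).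
Variables (b : 'cV[R]_d -> 'cV[R]_d) (sigma : 'cV[R]_d -> 'M[R]_(d, m)).
Variables (xs : 'cV[R]_d) (X : R -> Omega -> 'cV[R]_d) (W : R -> Omega -> 'cV[R]_m).
Variables (T h : R) (N M : nat) (theta kap : R).
Hypotheses (b_cont : continuous b) (sigma_cont : continuous sigma).
Hypotheses (FP : usual_conditions Pr F) (WP : brownian_motion Pr F W).
Hypothesis aX : adapted `[0, T]%classic F X.
Hypotheses (h_gt0 : 0 < h) (M_gt0 : (0 < M)%N) (NhT : N%:R * h = T).

Local Notation mesh := (mesh h M).
Local Notation time := (grid_time h M).
Local Notation drift := (grid_drift b sigma X h M).
Local Notation diffusion := (grid_diffusion b sigma X h M).
Local Notation lookahead := (lookahead b sigma xs X h M theta).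
Local Notation noise := (noise W h M).
Local Notation defect := (defect b sigma xs X W h M theta).
Local Notation total_defect := (total_defect b sigma xs X W h M theta).
Local Notation budget := (budget b sigma xs X W h M theta).
Local Notation en := (energy b sigma xs X W h M theta kap).
Local Notation small_defect := (small_defect b sigma xs X W h M theta).

Lemma grid_time_ge0 i : 0 <= time i.
Proof. by rewrite mulr_ge0// ltW// mesh_gt0. Qed.

Lemma ler_grid_time i j : (i <= j)%N -> time i <= time j.
Proof. by move=> ij; rewrite ler_wpM2r ?ler_nat// ltW// mesh_gt0. Qed.

Lemma grid_time_le i : (i <= N * M)%N -> time i <= T.
Proof.
move=> iN; rewrite -NhT (@step_time _ h M M_gt0).
by rewrite ler_wpM2r ?ler_nat// ltW// mesh_gt0.
Qed.

Lemma F_mono i j : (i <= j)%N -> F (time i) `<=` F (time j).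
Proof.
by move=> ij; have [_ _ Fm _ _] := FP; apply: Fm; rewrite ?grid_time_ge0 ?ler_grid_time.
Qed.

Lemma F_measurable i : F (time i) `<=` measurable.
Proof. by have [_ Fm _ _ _] := FP; have [] := Fm _ (grid_time_ge0 i). Qed.

Lemma F_sigma i : sigma_algebra setT (F (time i)).
Proof. by have [_ Fm _ _ _] := FP; have [] := Fm _ (grid_time_ge0 i). Qed.

Lemma measurable_position i j k : (i <= N * M)%N -> (i <= j)%N ->
  measurable_wrt (F (time j)) (fun w => X (time i) w k 0).
Proof.
move=> iN ij; apply: (sub_measurable_wrt (F_mono ij)).
apply: adapted_measurable_wrt aX _.
by rewrite /= in_itv/= grid_time_ge0 grid_time_le.
Qed.

Lemma measurable_frozen i k : (i <= N * M)%N ->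
  measurable_wrt (F (time i)) (fun w => X ((i %/ M)%:R * h) w k 0).
Proof.
move=> iN; have ii : ((i %/ M) * M <= i)%N by exact: leq_divM.
rewrite (@step_time _ h M M_gt0 (i %/ M)).
exact: (measurable_position k (leq_trans ii iN) ii).
Qed.

Lemma measurable_noise i k : measurable_wrt (F (time i.+1)) (fun w => noise i w k 0).
Proof.
have [aW _ _ _] := WP.
rewrite (_ : (fun w => _) = fun w => W (time i.+1) w k 0 - W (time i) w k 0); last first.
  by apply/funext => w; rewrite !mxE.
apply: measurable_wrtB.
  by apply: adapted_measurable_wrt aW _; exact: grid_time_ge0.
apply: (sub_measurable_wrt (F_mono (leqnSn i))).
by apply: adapted_measurable_wrt aW _; exact: grid_time_ge0.
Qed.

Lemma measurable_drift i k : (i <= N * M)%N ->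
  measurable_wrt (F (time i)) (fun w => drift i w k 0).
Proof. by move=> iN; apply: measurable_tamed_drift => // j; exact: measurable_frozen. Qed.

Lemma measurable_diffusion i k l : (i <= N * M)%N ->
  measurable_wrt (F (time i)) (fun w => diffusion i w k l).
Proof. by move=> iN; apply: measurable_tamed_diffusion => // j; exact: measurable_frozen. Qed.

Lemma measurable_centred i j k c : (i <= j)%N -> (j <= N * M)%N ->
  measurable_wrt (F (time j)) (fun w => (X (time j) w - xs + c *: drift i w) k 0).
Proof.
move=> ij jN.
rewrite (_ : (fun w => _) = fun w => X (time j) w k 0 - xs k 0 + c * drift i w k 0);
  last by apply/funext => w; rewrite !mxE.
apply: measurable_wrtD.
  by apply: measurable_wrtB; [exact: measurable_position|exact: measurable_wrt_cst].
apply: measurable_wrtM; first exact: measurable_wrt_cst.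
exact: (sub_measurable_wrt (F_mono ij) (measurable_drift k (leq_trans ij jN))).
Qed.

Lemma measurable_lookahead i k : (i <= N * M)%N ->
  measurable_wrt (F (time i)) (fun w => lookahead i w k 0).
Proof. exact: measurable_centred. Qed.

Lemma measurable_defect i : (i < N * M)%N ->
  measurable_wrt (F (time i.+1)) (defect i).
Proof.
move=> iN; have ii := leqnSn i; have iN' := ltnW iN.
apply: measurable_wrt_max; first exact: measurable_wrt_cst.
apply: measurable_wrtB; apply: measurable_wrt_sqr_hsnorm => k j; rewrite (ord1 j).
  exact: measurable_centred.
rewrite (_ : (fun w => _) = fun w => lookahead i w k 0 +
    (diffusion i w *m noise i w) k 0 + ((1 - theta) * mesh) * drift i w k 0);
  last by apply/funext => w; rewrite [LHS]mxE [X in X + _]mxE [X in _ + X]mxE.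
have up Y := @sub_measurable_wrt R dO Omega _ _ Y (F_mono ii).
apply: measurable_wrtD.
  apply: measurable_wrtD; first by apply: up; exact: measurable_lookahead.
  apply: measurable_wrt_mulmx; last by move=> l; exact: measurable_noise.
  by move=> l l'; apply: up; exact: measurable_diffusion.
by apply: measurable_wrtM; [exact: measurable_wrt_cst|by apply: up; exact: measurable_drift].
Qed.

Lemma measurable_total_defect i : (i <= N * M)%N ->
  measurable_wrt (F (time i)) (total_defect i).
Proof.
elim: i => [_|i IH iN].
  rewrite (_ : total_defect 0 = fun=> 0); first exact: measurable_wrt_cst.
  by apply/funext => w; exact: big_ord0.
rewrite (_ : total_defect i.+1 = fun w => total_defect i w + defect i w).
  apply: measurable_wrtD; last exact: measurable_defect.
  exact: (sub_measurable_wrt (F_mono (leqnSn i)) (IH (ltnW iN))).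
by apply/funext => w; rewrite total_defectS.
Qed.

Lemma measurable_small_defect i : (i <= N * M)%N ->
  measurable_wrt (F (time i)) (fun w => (small_defect i w)%:R : R).
Proof.
move=> iN.
have mI : measurable_fun setT (fun x : R => ((x <= 1)%R)%:R : R).
  rewrite (_ : (fun x => _) = \1_(`]-oo, 1]%classic : set R)).
    by apply: measurable_indic; exact: measurable_itv.
  by apply/funext => x; rewrite indicE mem_setE in_itv/=.
exact: (measurable_wrt_comp mI (measurable_total_defect iN)).
Qed.

Lemma measurable_budget i : (i <= N * M)%N -> measurable_wrt (F (time i)) (budget i).
Proof.
move=> iN; apply: measurable_wrt_max; first exact: measurable_wrt_cst.
by apply: measurable_wrtB; [exact: measurable_wrt_cst|exact: measurable_total_defect].
Qed.

Lemma measurable_energy i : (i <= N * M)%N -> measurable_wrt (F (time i)) (en i).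
Proof.
move=> iN; apply: measurable_wrtD.
  apply: measurable_wrtD; first exact: measurable_budget.
  apply: measurable_wrt_sqr_hsnorm => k j; rewrite (ord1 j).
  exact: measurable_lookahead.
apply: measurable_wrtM; first exact: measurable_wrt_cst.
by apply: measurable_wrt_sqr_hsnorm => k j; exact: measurable_diffusion.
Qed.

Lemma grid_step_integral (P eta sig C l C1 : R) i (Q : Omega -> R) :
  (i < N * M)%N -> 2 <= P -> 0 <= sig -> 0 <= eta -> 0 <= l -> 0 <= C1 ->
  kap = (2 * P - 1) * (1 + eta) ->
  (\int[normal_prob 0 (Num.sqrt mesh)]_x
     (x ^+ 2 * ((1 + sig * m%:R * `|x|) `^ (2 * P - 2) - 1))%:E
    <= (C * Num.sqrt mesh ^+ 3)%:E)%E ->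
  m%:R ^+ 3 * C * Num.sqrt mesh <= eta ->
  (forall x, hsnorm (tamed_diffusion b sigma h x) <= sig) ->
  (forall x, hsnorm ((1 - theta) *: tamed_drift b sigma h x) <= l) ->
  (forall x, 1 + hsnorm (x - xs + (theta * h) *: tamed_drift b sigma h x) ^+ 2
      + kap * h * hsnorm (tamed_diffusion b sigma h x) ^+ 2
    <= (1 + C1 * h) * (1 + hsnorm (x - xs) ^+ 2)) ->
  measurable_wrt (F (time i)) Q -> (forall w, 0 <= Q w) ->
  (\int[Pr]_w (Q w * ((small_defect i.+1 w)%:R * en i.+1 w `^ P))%:E <=
   (((1 + l * mesh) ^+ 2 * (1 + C1 * h) ^+ (M %| i.+1)) `^ P)%:E *
   \int[Pr]_w (Q w * en i w `^ P)%:E)%E.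
Proof.
move=> iN P2 sig0 eta0 l0 C10 kapE cubic small Ssig al start mQ Q0.
have iN' := ltnW iN.
have m0 : 0 < mesh by exact: mesh_gt0.
have k0 : 0 <= kap by rewrite kapE; apply: mulr_ge0; [lra|exact: addr_ge0].
set g := (1 + l * mesh) ^+ 2 * (1 + C1 * h) ^+ (M %| i.+1).
have g0 : 0 <= g.
  rewrite mulr_ge0 ?sqr_ge0// exprn_ge0// addr_ge0// mulr_ge0//.
  exact: ltW.
have [_ _ lawW indW] := WP.
have tt : time i.+1 - time i = mesh.
  by rewrite /grid_time -natr1 mulrDl mul1r addrAC subrr add0r.
have t_lt : time i < time i.+1 by rewrite -subr_gt0 tt.
pose k w := budget i w + kap * (grid_rem h M i - mesh) * hsnorm (diffusion i w) ^+ 2.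
have mk : measurable_wrt (F (time i)) k.
  apply: measurable_wrtD; first exact: measurable_budget.
  apply: measurable_wrtM; first exact: measurable_wrt_cst.
  by apply: measurable_wrt_sqr_hsnorm => ? ?; exact: measurable_diffusion.
have k1 w : 1 <= k w.
  rewrite -[leLHS]addr0 lerD ?budget_ge1// mulr_ge0 ?sqr_ge0// mulr_ge0//.
  by rewrite subr_ge0 grid_rem_ge.
have s0 : 0 < Num.sqrt mesh by rewrite sqrtr_gt0.
have mD j : measurable_fun setT (fun w => noise i w j 0).
  apply: (@measurable_wrt_measurable _ _ _ (F (time i.+1))); first exact: F_measurable.
  exact: measurable_noise.
have law (A : 'I_m -> set R) : (forall i, measurable (A i)) ->
    Pr [set w | forall j, A j (noise i w j 0)] =
    (\prod_(j < m) normal_prob 0%R (Num.sqrt mesh) (A j))%E.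
  by rewrite -tt => mA; exact: (lawW _ _ (grid_time_ge0 i) t_lt A mA).
have ind A B : F (time i) A -> sigma_vec (noise i) B -> Pr (A `&` B) = (Pr A * Pr B)%E.
  exact: (indW _ _ (grid_time_ge0 i) t_lt).
have mz j : measurable_wrt (F (time i)) (fun w => lookahead i w j 0).
  exact: measurable_lookahead.
have mS j j' : measurable_wrt (F (time i)) (fun w => diffusion i w j j').
  exact: measurable_diffusion.
have S_le w : hsnorm (diffusion i w) <= sig by exact: Ssig.
have := @one_step_le R dO Omega Pr (F (time i)) m (noise i) (Num.sqrt mesh)
  (@F_sigma i) (@F_measurable i) s0 mD law ind d P eta sig C Q k (lookahead i)
  (diffusion i) P2 sig0 eta0 cubic small mQ mk mz mS Q0 k1 S_le.
(* The Gaussian step adds [kap mesh |S|^2], exactly the quadratic variation that the piece uses up.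
   This is why the remaining time carries the weight [kap]. *)
have kE w : k w + hsnorm (lookahead i w) ^+ 2 +
    (2 * P - 1) * (1 + eta) * Num.sqrt mesh ^+ 2 * hsnorm (diffusion i w) ^+ 2 = en i w.
  by rewrite sqr_sqrtr ?(ltW m0)// -kapE /k /energy; ring.
under [X in (_ <= X)%E -> _]eq_integral do rewrite kE.
move=> H.
have gP : (0%:E <= (g `^ P)%:E)%E by rewrite lee_fin powR_ge0.
apply: le_trans (lee_wpmul2l gP H).
have kz w : 0 <= k w + hsnorm (lookahead i w + diffusion i w *m noise i w) ^+ 2.
  by rewrite addr_ge0 ?sqr_ge0// (le_trans ler01).
have mkz : measurable_wrt (F (time i.+1))
    (fun w => Q w * (k w + hsnorm (lookahead i w + diffusion i w *m noise i w) ^+ 2) `^ P).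
  have up Y := @sub_measurable_wrt R dO Omega _ _ Y (F_mono (leqnSn i)).
  apply: measurable_wrtM; first exact: up.
  apply: measurable_wrt_powR; apply: measurable_wrtD; first exact: up.
  apply: measurable_wrt_sqr_hsnorm => j j'; rewrite (ord1 j').
  rewrite (_ : (fun w => _) = fun w => lookahead i w j 0 + (diffusion i w *m noise i w) j 0);
    last by apply/funext => w; rewrite [LHS]mxE.
  apply: measurable_wrtD; first exact: up.
  apply: measurable_wrt_mulmx; last by move=> ?; exact: measurable_noise.
  by move=> ? ?; exact: up.
rewrite -ge0_integralZl_EFin//=; last 2 first.
- by move=> w _; rewrite lee_fin mulr_ge0// powR_ge0.
- by apply/measurable_EFinP; exact: (measurable_wrt_measurable (@F_measurable i.+1) mkz).
apply: ge0_le_integral => //.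
- by move=> w _; rewrite lee_fin mulr_ge0// mulr_ge0// powR_ge0.
- apply/measurable_EFinP; apply: (measurable_wrt_measurable (@F_measurable i.+1)).
  apply: measurable_wrtM; first exact: (sub_measurable_wrt (F_mono (leqnSn i)) mQ).
  apply: measurable_wrtM; first exact: measurable_small_defect.
  by apply: measurable_wrt_powR; exact: measurable_energy.
- apply: measurable_funeM; apply/measurable_EFinP.
  exact: (measurable_wrt_measurable (@F_measurable i.+1) mkz).
- move=> w _; rewrite -EFinM lee_fin.
  rewrite [leRHS]mulrCA; apply: ler_wpM2l => //.
  case E : (small_defect i.+1 w); last by rewrite mul0r mulr_ge0 ?powR_ge0.
  rewrite mul1r -powRM//; apply: ge0_ler_powR; rewrite ?nnegrE.
  + lra.
  + by apply: le_trans ler01 _; exact: energy_ge1.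
  + exact: mulr_ge0.
  + exact: (energy_step h_gt0 M_gt0 l0 C10 k0 al start E).
Qed.

End grid_process.

(** * Product of the step factors and vanishing of the defect *)

Section defect.
Context {R : realType} {d m : nat} {Omega : Type}.
Variables (b : 'cV[R]_d -> 'cV[R]_d) (sigma : 'cV[R]_d -> 'M[R]_(d, m)).

(** Among the first [n] pieces, [n %/ M] are followed by the opening of a step. For [n = N M] and
    [delta = h / M] the exponent becomes [P (2 l + C) T], free of [h] and [M]. *)
Lemma prod_step_factor (l C h delta P : R) (M n : nat) :
  0 <= l -> 0 <= C -> 0 <= h -> 0 <= delta -> 0 <= P -> (0 < M)%N ->
  \prod_(i < n) (((1 + l * delta) ^+ 2 * (1 + C * h) ^+ (M %| i.+1)) `^ P)
    <= expR (P * (2 * l * delta * n%:R + C * h * (n %/ M)%:R)).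
Proof.
move=> l0 C0 h0 d0 P0 M0; elim: n => [|n IH].
  by rewrite big_ord0 div0n !mulr0 addr0 mulr0 expR0.
rewrite big_ord_recr/=.
have ld : 0 <= l * delta by exact: mulr_ge0.
have Ch : 0 <= C * h by exact: mulr_ge0.
set k : nat := (M %| n.+1)%N.
have f0 : 0 <= (1 + l * delta) ^+ 2 * (1 + C * h) ^+ k.
  by rewrite mulr_ge0 ?sqr_ge0// exprn_ge0// addr_ge0.
have step : (1 + l * delta) ^+ 2 * (1 + C * h) ^+ k <=
    expR (2 * l * delta + C * h * k%:R).
  rewrite expRD; apply: ler_pM; rewrite ?sqr_ge0 ?exprn_ge0 ?addr_ge0//.
    rewrite -mulrA expRM_natl ler_sqr ?nnegrE ?expR_ge0 ?addr_ge0//.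
    exact: expR_ge1Dx.
  by rewrite (mulrC (C * h)) expRM_natl lerXn2r ?nnegrE ?expR_ge0 ?addr_ge0// expR_ge1Dx.
apply: le_trans (ler_pM _ _ IH (ge0_ler_powR P0 f0 (expR_ge0 _) step)) _.
- by apply: prodr_ge0 => i _; exact: powR_ge0.
- exact: powR_ge0.
rewrite -expRM -expRD ler_expR divnS// natrD -natr1 /k.
by rewrite le_eqVlt; apply/orP; left; apply/eqP; ring.
Qed.

Lemma energy0_le (xs x0 : 'cV[R]_d) (X : R -> Omega -> 'cV[R]_d)
    (W : R -> Omega -> 'cV[R]_m) (h theta kap C : R) (M : nat) w :
  0 <= h -> h <= 1 -> 0 <= C -> X 0 w = x0 ->
  1 + hsnorm (x0 - xs + (theta * h) *: tamed_drift b sigma h x0) ^+ 2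
      + kap * h * hsnorm (tamed_diffusion b sigma h x0) ^+ 2
    <= (1 + C * h) * (1 + hsnorm (x0 - xs) ^+ 2) ->
  energy b sigma xs X W h M theta kap 0 w <= (2 + C) * lyapunov xs x0.
Proof.
move=> h0 h1 C0 Xx0 H.
have t0 : grid_time h M 0 = 0 by rewrite /grid_time mul0r.
have r0 : grid_rem h M 0 = h by rewrite /grid_rem mod0n mul0r subr0.
rewrite /energy /lookahead /grid_drift /grid_diffusion t0 r0 div0n mul0r Xx0.
have -> : budget b sigma xs X W h M theta 0 w = 2.
  by rewrite /budget /total_defect big_ord0 subr0 max_r// ler1n.
have := lyapunov_ge1 xs x0; rewrite /lyapunov in H *.
set V := 1 + hsnorm (x0 - xs) ^+ 2 in H * => V1.
have : C * h * V <= C * V by rewrite ler_wpM2r ?(le_trans ler01)// ler_piMr.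
move: H; set A := hsnorm _ ^+ 2; set B := kap * h * _; lra.
Qed.

(** Each defect is at most [2 om] times the variation of the reflection over its piece, with [om] a
    bound for the oscillation of the path at the scale of the mesh, and these bounds telescope. The
    threshold [M0] depends on [w], so the grid cannot be fixed beforehand. *)
Lemma eventually_small_defect (D : set 'cV[R]_d) (xs x0 : 'cV[R]_d)
    (X K n : R -> Omega -> 'cV[R]_d) (W : R -> Omega -> 'cV[R]_m)
    (T h theta r : R) (N : nat) w :
  convex_set (M := 'cV[R]_d) D -> 0 < r -> (forall y, hsnorm (y - xs) <= r -> D y) ->
  0 < h -> N%:R * h = T -> theta = (if Num.sqrt h <= r then 1 else 0) ->
  (forall i, measurable_fun `[0, T]%classic (fun s => n s w i 0)) ->
  reflected_path D T (X ^~ w) (K ^~ w) (n ^~ w) ->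
  (forall t, 0 <= t -> t <= T ->
     X t w = x0
       + integralv lebesgue_measure `[0, t]
           (fun s => tamed_drift b sigma h (X (kappa h s) w))
       + simple_ito h N (fun s => tamed_diffusion b sigma h (X (kappa h s) w))
           (W ^~ w) t
       + K t w) ->
  exists M0, forall M, (M0 <= M)%N -> (0 < M)%N ->
    small_defect b sigma xs X W h M theta (N * M) w.
Proof.
move=> cD r0 ballD h0 NhT thE mn [Xc XD [Kc K0] KV [mu [[muout muV] KE nN _]]] XE.
have T0 : 0 <= T by rewrite -NhT mulr_ge0// ltW.
have muT : (mu `[0%R, T]%classic < +oo)%E by rewrite muV.
have sub0 t : t <= T -> `[0, t]%classic `<=` `[0, T]%classic.
  by move=> tT u /=; rewrite !in_itv/= => /andP[-> ut]; exact: le_trans tT.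
have mfin t : t <= T -> (mu `[0%R, t]%classic < +oo)%E.
  move=> tT; apply: le_lt_trans muT; apply: le_measure; rewrite ?inE//.
  exact: sub0.
pose v t := fine (mu `[0, t]%classic).
have v0 t : 0 <= v t by rewrite fine_ge0.
have vmono s t : s <= t -> t <= T -> v s <= v t.
  move=> st tT; apply: fine_le; rewrite ?ge0_fin_numE ?mfin ?(le_trans st)//.
  apply: le_measure; rewrite ?inE//.
  by move=> u /=; rewrite !in_itv/= => /andP[-> us]; exact: le_trans us st.
(* Small enough for [2 om v T <= 1]. *)
pose om := (2 * v T + 1)^-1.
have om0 : 0 < om by rewrite invr_gt0 ltr_wpDl// mulr_ge0.
have [del del0 unif] := unif_continuous_path Xc om0.
exists (Num.truncn (h / del)).+1 => M M0 M_gt0.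
have mesh0 : 0 < mesh h M by exact: mesh_gt0.
have mesh_del : mesh h M < del.
  have hd : 0 <= h / del by rewrite divr_ge0// ltW.
  have /andP[_ lt1] := truncn_itv hd.
  rewrite /mesh ltr_pdivrMr ?ltr0n// mulrC -ltr_pdivrMr//.
  by apply: lt_le_trans lt1 _; rewrite ler_nat.
have time_le i : (i <= N * M)%N -> grid_time h M i <= T.
  move=> iN; rewrite -NhT (@step_time _ h M M_gt0).
  by rewrite ler_wpM2r ?ler_nat// ltW.
have time_ge0 i : 0 <= grid_time h M i by rewrite mulr_ge0// ltW.
have timeS i : grid_time h M i.+1 = grid_time h M i + mesh h M.
  by rewrite /grid_time -natr1 mulrDl mul1r.
have th01 : 0 <= theta <= 1 by rewrite thE; case: ifP => _; rewrite ?lexx ler01.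
have defect_le i : (i < N * M)%N -> defect b sigma xs X W h M theta i w <=
    2 * om * (v (grid_time h M i.+1) - v (grid_time h M i)).
  move=> iN.
  set s := grid_time h M i; set t := grid_time h M i.+1.
  have st : s <= t by rewrite /t timeS lerDl ltW.
  have s0 : 0 <= s by exact: time_ge0.
  have tT : t <= T by exact: time_le.
  have rhs0 : 0 <= 2 * om * (v t - v s).
    by rewrite mulr_ge0 ?subr_ge0 ?vmono// mulr_ge0// ltW.
  set a := grid_drift b sigma X h M i w.
  set nx := lookahead_next b sigma xs X h M theta i w.
  set un := unreflected b sigma xs X W h M theta i w.
  (* Over a piece inside one step the scheme integrates drift and noise exactly, so only the
     increment of [K] separates the two positions. *)
  have unE : un = nx - (K t w - K s w).
    have [ks tk] := @grid_time_step _ h M h0 M_gt0 i.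
    have kN : (i %/ M < N)%N by rewrite ltn_divLR.
    have DI := @drift_increment R d N h s t (i %/ M)
      (fun u => tamed_drift b sigma h (X u w)) h0 kN ks st tk.
    have II := @ito_increment R d m N h s t (i %/ M)
      (fun u => tamed_diffusion b sigma h (X (kappa h u) w)) (W ^~ w) h0 kN ks st tk.
    rewrite (kappa_grid _ h0) in II.
    have XtE := XE t (le_trans s0 st) tT; have XsE := XE s s0 (le_trans st tT).
    have ts : t - s = mesh h M by rewrite /t timeS addrAC subrr add0r.
    rewrite ts in DI.
    have KE' : K t w - K s w = X t w - X s w - mesh h M *: a
        - grid_diffusion b sigma X h M i w *m noise W h M i w.
      rewrite /a /grid_drift /grid_diffusion /noise -/s -/t -DI -II {1}XtE {1}XsE.
      set I1 := integralv _ _ _; set I2 := integralv _ _ _.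
      set J1 := simple_ito _ _ _ _ t; set J2 := simple_ito _ _ _ _ s.
      by apply/matrixP => p q; rewrite !mxE; ring.
    rewrite KE' /un /nx /unreflected /lookahead /lookahead_next -/a -/s -/t.
    set SN := _ *m _.
    by apply/matrixP => p q; rewrite !mxE; ring.
  rewrite /defect ge_max rhs0 /= -/nx -/un unE sqr_hsnormB.
  set KK := K t w - K s w.
  have : dotv nx KK <= om * (v t - v s).
    apply: (@reflection_increment R d T s t om mu (n ^~ w) (K ^~ w) nx s0 st tT) => //.
      move: nN; apply: (@filterS _ _ (ae_filter_ringOfSetsType mu)) => u H u0 uT.
      by have [rr _ [n1 _]] := H u0 uT.
    move: nN; apply: (@filterS _ _ (ae_filter_ringOfSetsType mu)) => u H su ut.
    have u0 := le_trans s0 su; have uT := le_trans ut tT.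
    have nu := H u0 uT.
    have nu1 : hsnorm (n u w) = 1 by have [rr _ [n1 _]] := nu.
    (* The centre at the right end of the piece. It lies in [D], so [<X u - c, n u> <= 0]; replacing
       [X u] by [X t] costs the oscillation [om]. *)
    pose c := xs - (theta * (grid_rem h M i - mesh h M)) *: a.
    have Dc : D c.
      apply: ballD; rewrite /c addrAC subrr add0r hsnormN hsnormZ.
      have rem0 : 0 <= grid_rem h M i - mesh h M by rewrite subr_ge0 grid_rem_ge.
      have rem1 : grid_rem h M i - mesh h M <= h.
        by apply: le_trans (grid_rem_le h0 M_gt0 i); rewrite gerBl ltW.
      have a0 := hsnorm_ge0 a.
      rewrite thE; case: ifPn => hr; last by rewrite mul0r normr0 mul0r ltW.
      rewrite mul1r ger0_norm//; apply: le_trans hr.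
      apply: (@le_trans _ _ (h * hsnorm a)); first by rewrite ler_wpM2r.
      rewrite -{1}(sqr_sqrtr (ltW h0)) expr2 -mulrA ler_piMr ?sqrtr_ge0//.
      exact: tamed_drift_le.
    have nxE : nx = (X t w - X u w) + (X u w - c).
      rewrite /nx /c /lookahead_next -/t -/a.
      by apply/matrixP => p q; rewrite !mxE; ring.
    rewrite nxE dotvDl.
    have := inward_normals_dotv cD (XD u u0 uT) Dc nu.
    have : dotv (X t w - X u w) (n u w) <= om.
      apply: le_trans (ler_dotv _ _) _; rewrite nu1 mulr1; apply: unif.
      - by rewrite /= in_itv/= tT (le_trans s0 st).
      - by rewrite /= in_itv/= u0 uT.
      - rewrite ger0_norm ?subr_ge0//; apply: le_lt_trans mesh_del.
        by rewrite lerBlDr -lerBlDl; move: su; rewrite /t timeS -/s; lra.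
    lra.
  have := sqr_ge0 (hsnorm KK).
  set q := hsnorm KK ^+ 2; set dk := dotv nx KK; set vv := v t - v s.
  lra.
have total i : (i <= N * M)%N -> total_defect b sigma xs X W h M theta i w <=
    2 * om * (v (grid_time h M i) - v 0).
  elim: i => [_|i IH iN].
    by rewrite /total_defect big_ord0 /grid_time mul0r subrr mulr0.
  rewrite total_defectS; have := IH (ltnW iN); have := defect_le i iN; lra.
rewrite /small_defect; apply: le_trans (total _ (leqnn _)) _.
have vle : v (grid_time h M (N * M)) <= v T by apply: vmono => //; exact: time_le.
apply: (@le_trans _ _ (om * (2 * v T))).
  rewrite (mulrC 2) -mulrA ler_wpM2l// ?(ltW om0)//.
  by have := v0 0; lra.
rewrite mulrC ler_pdivrMr; last by rewrite ltr_wpDl// mulr_ge0.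
by rewrite mul1r lerDl.
Qed.

End defect.

(** * Moment bound *)

Section limn_einf_bounds.
Context {R : realType}.
Implicit Types (u : nat -> \bar R) (c : \bar R).

Lemma le_limn_einf u c n0 : (forall n, (n0 <= n)%N -> (c <= u n)%E) ->
  (c <= limn_einf u)%E.
Proof.
move=> cu; rewrite limn_einf_lim; apply: lime_ge; first exact: is_cvg_einfs.
exists n0 => // n /= n0n; apply: le_ereal_inf_tmp => _ [k /= nk <-].
by apply: cu; exact: leq_trans n0n nk.
Qed.

Lemma limn_einf_le u c : (forall n, (u n <= c)%E) -> (limn_einf u <= c)%E.
Proof.
move=> uc; rewrite limn_einf_lim; apply: lime_le; first exact: is_cvg_einfs.
apply: nearW => n; apply: ge_ereal_inf; exists (u n) => //.
by exists n => /=.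
Qed.

Lemma measurable_limn_einf (dT : measure_display) (T : measurableType dT)
    (f : nat -> T -> \bar R) : (forall n, measurable_fun setT (f n)) ->
  measurable_fun setT (fun w => limn_einf (f ^~ w)).
Proof.
move=> mf; rewrite /limn_einf; apply: measurableT_comp => //.
by apply: measurable_fun_limn_esup => n; apply: measurableT_comp.
Qed.

End limn_einf_bounds.

Section moment_bound.
Context {R : realType} {d m : nat} (D : set 'cV[R]_d) (xs : 'cV[R]_d).
Variables (b : 'cV[R]_d -> 'cV[R]_d) (sigma : 'cV[R]_d -> 'M[R]_(d, m)).

Lemma open_hsnorm_ball : open D -> D xs ->
  exists2 r : R, 0 < r & forall y, hsnorm (y - xs) <= r -> D y.
Proof.
move=> oD Dx; have /nbhs_ballP[e /= e0 eD] := open_nbhs_nbhs (conj oD Dx).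
exists (e / 2); first by rewrite divr_gt0.
move=> y yx; apply: eD; split => // i j; rewrite (ord1 j) /ball/=.
have := le_trans (hsnorm_entry (y - xs) i 0) yx; rewrite !mxE distrC.
by move=> H; apply: le_lt_trans H _; rewrite ltr_pdivrMr// ltr_pMr// ltr1n.
Qed.

Lemma tamed_euler_peano0 (dO : measure_display) (Omega : measurableType dO)
    (x0 : 'cV[R]_d) (X K : R -> Omega -> 'cV[R]_d) (W : R -> Omega -> 'cV[R]_m)
    (T h : R) (N : nat) w : 0 <= T -> 0 < h -> K 0 w = 0 ->
  (forall t, 0 <= t -> t <= T ->
     X t w = x0
       + integralv lebesgue_measure `[0, t]
           (fun s => tamed_drift b sigma h (X (kappa h s) w))
       + simple_ito h N (fun s => tamed_diffusion b sigma h (X (kappa h s) w))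
           (W ^~ w) t
       + K t w) -> X 0 w = x0.
Proof.
move=> T0 h0 K0 XE; rewrite XE// K0 addr0.
have -> : integralv lebesgue_measure `[0, 0]
    (fun s => tamed_drift b sigma h (X (kappa h s) w)) = 0.
  by apply/matrixP => i j; rewrite !mxE set_itv1 Rintegral_set1.
rewrite addr0 /simple_ito big1 ?addr0// => k _.
by rewrite !min_l ?mulr_ge0 ?(ltW h0)// subrr mulmx0.
Qed.

Variables (L eta p P T : R).
Hypotheses (D_open : open D) (D_convex : convex_set (M := 'cV[R]_d) D) (D_xs : D xs).
Hypotheses (b_cont : continuous b) (sigma_cont : continuous sigma).
Hypothesis L_gt0 : 0 < L.
Hypothesis monotone : forall x y : 'cV[R]_d,
  dotv (x - y) (b x - b y) + eta * hsnorm (sigma x - sigma y) ^+ 2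
  <= L * hsnorm (x - y) ^+ 2.
Hypotheses (p_ge1 : 1 <= p) (P_ge2 : 2 <= P) (pP : p < P) (P_lt : P < eta + 2^-1).
Hypothesis T_gt0 : 0 < T.

(** The supremum over time is controlled through a measurable majorant [g], as its own measurability
    is not at hand. [g] is a lower limit over the grids: almost every path has a small defect on all
    sufficiently fine grids, while the integral bound holds on each of them. *)
Lemma tamed_euler_peano_dominated : exists2 C : R, 0 < C &
  forall (x0 : 'cV[R]_d) (dO : measure_display) (Omega : measurableType dO)
    (Pr : probability Omega R) (F : R -> set (set Omega))
    (W : R -> Omega -> 'cV[R]_m) (N : nat) (X K : R -> Omega -> 'cV[R]_d),
  usual_conditions Pr F -> brownian_motion Pr F W -> admissible_steps T N ->
  tamed_euler_peano b sigma Pr F W D x0 T N X K ->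
  exists g : Omega -> \bar R, [/\ measurable_fun setT g, (forall w, (0 <= g w)%E),
    {ae Pr, forall w, forall t, 0 <= t -> t <= T ->
       ((lyapunov xs (X t w) `^ p)%:E <= g w)%E} &
    (\int[Pr]_w g w <= (C * lyapunov xs x0 `^ p)%:E)%E].
Proof.
have P1_gt0 : 0 < 2 * P - 1 by have := P_ge2; lra.
(* The midpoint of [2 P - 1] and [2 eta]. *)
pose kap := P - 2^-1 + eta.
have kap_gt : 2 * P - 1 < kap by have := P_lt; rewrite /kap; lra.
have kap_lt : kap < 2 * eta by have := P_lt; rewrite /kap; lra.
have kap_gt0 : 0 < kap by exact: lt_trans kap_gt.
have kap_ge0 := ltW kap_gt0.
pose eps := kap / (2 * P - 1) - 1.
have eps_gt0 : 0 < eps by rewrite subr_gt0 ltr_pdivlMr// mul1r.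
have kapE : kap = (2 * P - 1) * (1 + eps).
  by rewrite /eps addrCA subrr addr0 mulrCA divff ?mulr1// gt_eqF.
have [Cc Cc0 coer] := @monotone_coercive R d m b sigma L eta kap xs L_gt0 kap_gt0 kap_lt monotone.
have [r r0 ballD] := open_hsnorm_ball D_open D_xs.
pose l := r^-1.
have l0 : 0 <= l by rewrite invr_ge0 ltW.
pose C1 := Cc + 1 + kap / r.
have C10 : 0 <= C1.
  by rewrite /C1; apply: addr_ge0; [exact: addr_ge0|rewrite divr_ge0// ltW].
pose cc := p / (P - p).
have p0 : 0 <= p by exact: le_trans ler01 p_ge1.
have P0 : 0 <= P by apply: le_trans p0 _; exact: ltW.
have cc0 : 0 <= cc by rewrite divr_ge0// subr_ge0 ltW.
pose Gam := expR (P * (2 * l * T + C1 * T)).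
(* One factor 3 of the 9 bounds [V] by the energy at a grid point, the other passes from an
   arbitrary time to a grid point. [Gam] bounds the product of the step factors. *)
pose C := 9 `^ p * (Gam * ((1 + cc) * (2 + C1) `^ p)).
exists C.
  rewrite /C mulr_gt0 ?powR_gt0// mulr_gt0 ?expR_gt0// mulr_gt0 ?powR_gt0//.
    by rewrite ltr_pwDl.
  by rewrite ltr_pwDl.
move=> x0 dO Omega Pr F W N X K FP WP [/= N_gt0 h1] [n [aX _ pn aeX]].
pose h := T / N%:R.
have h_gt0 : 0 < h by rewrite divr_gt0// ltr0n.
have NhT : N%:R * h = T by rewrite /h mulrCA divff ?mulr1// pnatr_eq0 -lt0n.
have T_ge0 := ltW T_gt0.
pose theta : R := if Num.sqrt h <= r then 1 else 0.
have th01 : 0 <= theta <= 1 by rewrite /theta; case: ifP => _; rewrite ?lexx ler01.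
(* This bound of order [h^(-1/4)] is not uniform in [h], but it only decides how fine the grid must
   be and does not enter [C]. *)
pose sig := Num.sqrt (Num.sqrt h)^-1.
have sig0 : 0 <= sig by exact: sqrtr_ge0.
have sh0 : 0 < Num.sqrt h by rewrite sqrtr_gt0.
have Ssig x : hsnorm (tamed_diffusion b sigma h x) <= sig.
  rewrite -(ger0_norm (hsnorm_ge0 _)) -sqrtr_sqr ler_wsqrtr//.
  by rewrite -div1r ler_pdivlMr// mulrC tamed_diffusion_le.
have al x : hsnorm ((1 - theta) *: tamed_drift b sigma h x) <= l.
  rewrite /theta; case: ifPn => [_|]; first by rewrite subrr scale0r hsnorm0.
  rewrite -ltNge subr0 scale1r => rh.
  rewrite /l -div1r ler_pdivlMr//; apply: le_trans (tamed_drift_le b sigma h x).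
  by rewrite mulrC ler_wpM2r ?hsnorm_ge0// ltW.
have start x : 1 + hsnorm (x - xs + (theta * h) *: tamed_drift b sigma h x) ^+ 2
      + kap * h * hsnorm (tamed_diffusion b sigma h x) ^+ 2
    <= (1 + C1 * h) * (1 + hsnorm (x - xs) ^+ 2).
  apply: start_of_step => //; first exact: tamed_drift_le.
    exact: tamed_diffusion_le.
  exact: (tamed_coercive h Cc0 (coer x)).
have q0 : 0 <= 2 * P - 2 by have := P_ge2; lra.
have a0 : 0 <= sig * m%:R by exact: mulr_ge0.
have [CN [CN0 cubic]] := normal_prob_cubic q0 a0.
have mCN0 : 0 <= m%:R ^+ 3 * CN by rewrite mulr_ge0// exprn_ge0.
pose rho := eps / (m%:R ^+ 3 * CN + 1).
have rho0 : 0 < rho by rewrite divr_gt0// ltr_pwDr.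
(* From [M1] on, the third-order error of a Gaussian step fits into the slack [eps]. *)
pose M1 := (Num.truncn (h / rho ^+ 2)).+1.
have mesh_small M : (M1 <= M)%N -> [/\ (0 < M)%N, 0 < mesh h M, Num.sqrt (mesh h M) <= 1 &
    m%:R ^+ 3 * CN * Num.sqrt (mesh h M) <= eps].
  move=> M1M; have M_gt0 : (0 < M)%N by exact: leq_trans M1M.
  have me0 : 0 < mesh h M by exact: mesh_gt0.
  have me1 : mesh h M <= 1.
    apply: le_trans h1; rewrite -/h /mesh ler_pdivrMr ?ltr0n// ler_peMr ?(ltW h_gt0)//.
    by rewrite ler1n.
  split => //; first by have := ler_wsqrtr me1; rewrite sqrtr1.
  have mer : mesh h M <= rho ^+ 2.
    have hr : 0 <= h / rho ^+ 2 by rewrite divr_ge0 ?sqr_ge0// ltW.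
    have /andP[_ lt1] := truncn_itv hr.
    rewrite /mesh ler_pdivrMr ?ltr0n// mulrC -ler_pdivrMr ?exprn_gt0//.
    by apply: ltW; apply: lt_le_trans lt1 _; rewrite ler_nat.
  have : Num.sqrt (mesh h M) <= rho.
    by have := ler_wsqrtr mer; rewrite sqrtr_sqr gtr0_norm.
  move/(ler_wpM2l mCN0) => /le_trans; apply.
  rewrite /rho mulrA ler_pdivrMr ?ltr_pwDr// mulrC ler_wpM2l ?(ltW eps_gt0)//.
  by rewrite lerDl.
pose en M := energy b sigma xs X W h M theta kap.
pose sd M := small_defect b sigma xs X W h M theta.
pose f M w : R := (sd M (N * M)%N w)%:R * running_max (en M ^~ w) (N * M) `^ p.
pose V0 := lyapunov xs x0.
have V01 : 1 <= V0 by exact: lyapunov_ge1.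
pose B := Gam * ((1 + cc) * ((2 + C1) * V0) `^ p).
have X0 : {ae Pr, forall w, X 0 w = x0}.
  move: aeX; apply: filterS => w [[_ _ [_ K0] _ _] XE].
  exact: (@tamed_euler_peano0 _ _ x0 X K W T h N w T_ge0 h_gt0 K0 XE).
have en_ge1 M i w : (0 < M)%N -> 1 <= en M i w by move=> M_gt0; exact: energy_ge1.
have f_int M : (M1 <= M)%N -> (\int[Pr]_w (f M w)%:E <= B%:E)%E.
  move=> M1M; have [M_gt0 me0 me1 small] := mesh_small M M1M.
  have fm i : F (grid_time h M i) `<=` measurable by exact: (F_measurable FP h_gt0 M_gt0).
  pose g i := ((1 + l * mesh h M) ^+ 2 * (1 + C1 * h) ^+ (M %| i.+1)%N) `^ P.
  have g1 i : 1 <= g i.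
    have f1 : 1 <= (1 + l * mesh h M) ^+ 2 * (1 + C1 * h) ^+ (M %| i.+1)%N.
      rewrite -[leLHS](mulr1 1).
      have e1 : 0 <= l * mesh h M := mulr_ge0 l0 (ltW me0).
      have e2 : 0 <= C1 * h := mulr_ge0 C10 (ltW h_gt0).
      by apply: ler_pM => //; apply: exprn_ege1; rewrite lerDl.
    by have := ge0_ler_powR P0 ler01 (le_trans ler01 f1) f1; rewrite powR1.
  have step i : (i < N * M)%N -> forall Q : Omega -> R,
      measurable_wrt (F (grid_time h M i)) Q -> (forall w, 0 <= Q w) ->
      (\int[Pr]_w (Q w * ((sd M i.+1 w)%:R * en M i.+1 w `^ P))%:E <=
       (g i)%:E * \int[Pr]_w (Q w * en M i w `^ P)%:E)%E.
    move=> iN Q mQ Q0.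
    apply: (@grid_step_integral R d m dO Omega Pr F b sigma xs X W T h N M theta kap
      b_cont sigma_cont FP WP aX h_gt0 M_gt0 NhT P eps sig CN l C1 i Q) => //.
    - exact: ltW.
    - by apply: cubic; rewrite sqrtr_gt0 me0 me1.
  have := @running_max_bound R dO Omega Pr (fun i => F (grid_time h M i)) (N * M)
    (sd M) (en M) g p P.
  move=> /(_ (fun i _ => F_mono FP h_gt0 M_gt0 (leqnSn i)) (fun i _ => fm i)).
  move=> /(_ (fun i iN => measurable_small_defect xs theta b_cont sigma_cont FP WP aX
    h_gt0 M_gt0 NhT iN)).
  move=> /(_ (fun i iN => measurable_energy xs theta kap b_cont sigma_cont FP WP aX
    h_gt0 M_gt0 NhT iN)).
  move=> /(_ (fun i w => @small_defectS _ _ _ _ _ _ _ _ _ _ _ _ i w)).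
  move=> /(_ (fun i w => en_ge1 M i w M_gt0) g1 p_ge1 pP step) H.
  apply: le_trans H _.
  have Gle : \prod_(i < N * M) g i <= Gam.
    apply: le_trans (prod_step_factor (N * M) l0 C10 (ltW h_gt0) (ltW me0) P0 M_gt0) _.
    have mT : mesh h M * (N * M)%:R = T by rewrite mulrC -step_time.
    by rewrite mulnK// -(mulrA (2 * l)) mT -(mulrA C1) (mulrC h) NhT.
  have E0 : (\int[Pr]_w ((1 + p / (P - p)) * en M 0%N w `^ p)%:E <=
      ((1 + cc) * ((2 + C1) * V0) `^ p)%:E)%E.
    apply: (@le_trans _ _ (\int[Pr]_w ((1 + cc) * ((2 + C1) * V0) `^ p)%:E)%E); last first.
      by rewrite integral_cst//= (@probability_setT _ _ _ Pr) mule1.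
    have nn : 0 <= 1 + cc by exact: addr_ge0.
    apply: ae_ge0_le_integralT => //.
    - by move=> w; rewrite lee_fin; apply: mulr_ge0; [exact: nn|exact: powR_ge0].
    - by move=> w; rewrite lee_fin; apply: mulr_ge0; [exact: nn|exact: powR_ge0].
    move: X0; apply: filterS => w Xw; rewrite lee_fin ler_wpM2l//.
    apply: ge0_ler_powR; rewrite ?nnegrE//.
    - exact: le_trans ler01 (en_ge1 M 0%N w M_gt0).
    - by apply: mulr_ge0; [exact: addr_ge0|exact: le_trans ler01 V01].
    - exact: (energy0_le _ _ (ltW h_gt0) h1 C10 Xw (start x0)).
  rewrite /B EFinM; apply: lee_pmul => //.
  - by rewrite lee_fin prodr_ge0// => i _; exact: powR_ge0.
  - apply: integral_ge0 => w _; rewrite lee_fin.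
    by apply: mulr_ge0; [exact: addr_ge0|exact: powR_ge0].
have mf M : (M1 <= M)%N -> measurable_fun setT (fun w => (f M w)%:E).
  move=> M1M; have [M_gt0 me0 _ _] := mesh_small M M1M.
  apply/measurable_EFinP.
  apply: (@measurable_wrt_measurable _ _ _ (F (grid_time h M (N * M)))).
    exact: (F_measurable FP h_gt0 M_gt0).
  apply: measurable_wrtM.
    exact: (measurable_small_defect xs theta b_cont sigma_cont FP WP aX h_gt0 M_gt0 NhT).
  apply: measurable_wrt_powR.
  have mrm i : (i <= N * M)%N -> measurable_wrt (F (grid_time h M i))
      (fun w => running_max (en M ^~ w) i).
    elim: i => [|i IH] iN.
      exact: (measurable_energy xs theta kap b_cont sigma_cont FP WP aX h_gt0 M_gt0 NhT iN).
    apply: measurable_wrt_max.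
      apply: (sub_measurable_wrt (F_mono FP h_gt0 M_gt0 (leqnSn i))).
      exact: IH (ltnW iN).
    exact: (measurable_energy xs theta kap b_cont sigma_cont FP WP aX h_gt0 M_gt0 NhT iN).
  exact: mrm.
have f0 M w : 0 <= f M w by rewrite mulr_ge0// powR_ge0.
(* Shifted by [M1], so that every term, and not only almost all of them, satisfies measurability and
   the integral bound. *)
pose u k w := (f (k + M1)%N w)%:E.
have mu k : measurable_fun setT (u k) by apply: mf; rewrite leq_addl.
have mlim : measurable_fun setT (fun w => limn_einf (u ^~ w)) by exact: measurable_limn_einf.
have lim0 w : (0 <= limn_einf (u ^~ w))%E.
  by apply: (@le_limn_einf _ _ _ 0%N) => k _; rewrite lee_fin.
have n9 : (0 <= (9 `^ p)%:E :> \bar R)%E by rewrite lee_fin powR_ge0.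
exists (fun w => (9 `^ p)%:E * limn_einf (u ^~ w))%E; split.
- exact: measurable_funeM.
- by move=> w; rewrite mule_ge0.
- move: aeX; apply: filterS => w [rp XE] t t0 tT.
  have mn i : measurable_fun `[0, T]%classic (fun s => n s w i 0).
    exact: (progressive_section T_ge0 pn).
  have [M0 sdM] := @eventually_small_defect R d m Omega b sigma D xs x0 X K n W T h theta r N w
    D_convex r0 ballD h_gt0 NhT erefl mn rp XE.
  have [Xc _ _ _ _] := rp.
  have [del del0 unif] := unif_continuous_path Xc (ltr01 : (0 : R) < 1).
  pose M2 := (Num.truncn (h / del)).+1.
  have main M : (M1 <= M)%N -> (M0 <= M)%N -> (M2 <= M)%N ->
      lyapunov xs (X t w) `^ p <= 9 `^ p * f M w.
    move=> M1M M0M M2M; have [M_gt0 me0 _ _] := mesh_small M M1M.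
    rewrite /f /sd sdM// mul1r -powRM//; last first.
      apply: le_trans (le_running_max _ (leq0n _)).
      exact: le_trans ler01 (en_ge1 M 0%N w M_gt0).
    have tm0 : 0 <= t / mesh h M by rewrite divr_ge0// ltW.
    have /andP[i1 i2] := truncn_itv tm0.
    set i := Num.truncn (t / mesh h M) in i1 i2.
    have it : grid_time h M i <= t by rewrite /grid_time -ler_pdivlMr.
    have ti : t < grid_time h M i + mesh h M.
      by move: i2; rewrite ltr_pdivrMr// -natr1 mulrDl mul1r.
    have iN : (i <= N * M)%N.
      rewrite -(@ler_nat R) (le_trans i1)// ler_pdivrMr// -(step_time h M_gt0 N) NhT//.
    have md : mesh h M < del.
      have hd : 0 <= h / del by rewrite divr_ge0// ltW.
      have /andP[_ lt1] := truncn_itv hd.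
      rewrite /mesh ltr_pdivrMr ?ltr0n// mulrC -ltr_pdivrMr//.
      by apply: lt_le_trans lt1 _; rewrite ler_nat.
    have gt0 : 0 <= grid_time h M i by rewrite mulr_ge0// ltW.
    have dist : hsnorm (X t w - X (grid_time h M i) w) <= 1.
      apply: unif; rewrite /= ?in_itv/= ?t0 ?tT ?gt0 ?(le_trans it tT)//.
      rewrite ger0_norm ?subr_ge0//; apply: lt_trans md.
      by rewrite ltrBlDl.
    apply: ge0_ler_powR; rewrite ?nnegrE//.
    + exact: le_trans ler01 (lyapunov_ge1 _ _).
    + rewrite mulr_ge0// (le_trans ler01)//.
      by apply: le_trans (en_ge1 M i w M_gt0) _; exact: (@le_running_max _ (en M ^~ w)).
    have e1 : lyapunov xs (X (grid_time h M i) w) <= 3 * en M i w.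
      exact: lyapunov_le_energy.
    have e2 : en M i w <= running_max (en M ^~ w) (N * M).
      exact: (@le_running_max _ (en M ^~ w)).
    have e3 : lyapunov xs (X t w) <= 3 * lyapunov xs (X (grid_time h M i) w).
      rewrite /lyapunov.
      have -> : X t w - xs = (X t w - X (grid_time h M i) w) + (X (grid_time h M i) w - xs).
        by rewrite addrA subrK.
      have := ler_sqr_hsnormD (X t w - X (grid_time h M i) w) (X (grid_time h M i) w - xs).
      have : hsnorm (X t w - X (grid_time h M i) w) ^+ 2 <= 1 by rewrite exprn_ile1 ?hsnorm_ge0.
      have := sqr_ge0 (hsnorm (X (grid_time h M i) w - xs)).
      set z1 := hsnorm (X t w - _) ^+ 2; set z2 := hsnorm (_ - xs) ^+ 2.
      set z3 := hsnorm (_ + _) ^+ 2; lra.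
    move: e1 e2 e3; set y1 := lyapunov _ _; set y2 := lyapunov _ _; set y3 := running_max _ _.
    set y4 := en M i w; lra.
  have nn9 : 0 < 9 `^ p :> R by rewrite powR_gt0.
  have le1 : ((lyapunov xs (X t w) `^ p / 9 `^ p)%:E <= limn_einf (u ^~ w))%E.
    apply: (@le_limn_einf _ _ _ (M0 + M2)%N) => k kM.
    rewrite lee_fin ler_pdivrMr// mulrC; apply: main.
    + exact: leq_addl.
    + by apply: leq_trans (leq_addr _ _); apply: leq_trans kM; exact: leq_addr.
    + by apply: leq_trans (leq_addr _ _); apply: leq_trans kM; exact: leq_addl.
  apply: le_trans (lee_wpmul2l n9 le1); rewrite -EFinM lee_fin.
  by rewrite mulrCA divff ?mulr1// gt_eqF.
- rewrite ge0_integralZl_EFin//.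
  apply: (@le_trans _ _ ((9 `^ p)%:E * B%:E)%E).
    apply: lee_wpmul2l => //; apply: le_trans (fatou Pr measurableT mu _) _.
      by move=> k w _; rewrite lee_fin.
    by apply: limn_einf_le => k; apply: f_int; rewrite leq_addl.
  rewrite -EFinM lee_fin /C /B (powRM p (addr_ge0 (ler0n _ 2) C10) (le_trans ler01 V01)).
  by rewrite le_eqVlt; apply/orP; left; apply/eqP; ring.
Qed.

End moment_bound.

(** * Comparison of the Lyapunov function with the Euclidean norm *)

Section lyapunov_hsnorm.
Context {R : realType} {d : nat}.
Implicit Types (xs x : 'cV[R]_d) (p : R).

Lemma powR_hsnorm2M x p : hsnorm x `^ (2 * p) = (hsnorm x ^+ 2) `^ p.
Proof. by rewrite powRrM -powR_mulrn// hsnorm_ge0. Qed.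

Lemma sqr_hsnorm_le_lyapunov xs x :
  hsnorm x ^+ 2 <= 2 * (1 + hsnorm xs ^+ 2) * lyapunov xs x.
Proof.
have := ler_sqr_hsnormD (x - xs) xs; rewrite subrK /lyapunov.
have := sqr_ge0 (hsnorm xs); have := sqr_ge0 (hsnorm (x - xs)).
set u := hsnorm (x - xs) ^+ 2; set v := hsnorm xs ^+ 2 => u0 v0.
by have := mulr_ge0 u0 v0; set y := hsnorm x ^+ 2; lra.
Qed.

Lemma lyapunov_le_sqr_hsnorm xs x :
  lyapunov xs x <= 2 * (1 + hsnorm xs ^+ 2) * (1 + hsnorm x ^+ 2).
Proof.
have := ler_sqr_hsnormD x (- xs); rewrite hsnormN /lyapunov.
have := sqr_ge0 (hsnorm xs); have := sqr_ge0 (hsnorm x).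
set u := hsnorm x ^+ 2; set v := hsnorm xs ^+ 2 => u0 v0.
by have := mulr_ge0 u0 v0; set y := hsnorm (x - xs) ^+ 2; lra.
Qed.

Lemma powR1D_le (y p : R) : 0 <= y -> 0 <= p -> (1 + y) `^ p <= 2 `^ p * (1 + y `^ p).
Proof.
move=> y0 p0; have [y1|/ltW y1] := leP y 1.
  apply: (@le_trans _ _ (2 `^ p)).
    by apply: ge0_ler_powR; rewrite ?nnegrE// ?addr_ge0//; lra.
  by rewrite ler_peMr ?powR_ge0// lerDl powR_ge0.
apply: (@le_trans _ _ ((2 * y) `^ p)).
  by apply: ge0_ler_powR; rewrite ?nnegrE ?addr_ge0 ?mulr_ge0//; lra.
by rewrite powRM// ler_wpM2l ?powR_ge0// lerDr.
Qed.

End lyapunov_hsnorm.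

(** Only the majorant needs to be measurable. The supremum is nonnegative because the time 0 belongs
    to the interval. *)
Lemma expected_sup_le {R : realType} {dO : measure_display} {Omega : measurableType dO}
    (Pr : probability Omega R) (T c : R) (Y : R -> Omega -> R) (g : Omega -> \bar R) :
  0 <= T -> 0 <= c -> (forall t w, 0 <= Y t w) ->
  measurable_fun setT g -> (forall w, (0 <= g w)%E) ->
  {ae Pr, forall w, forall t, 0 <= t -> t <= T -> ((Y t w)%:E <= c%:E * g w)%E} ->
  (expected_sup Pr T Y <= c%:E * \int[Pr]_w g w)%E.
Proof.
move=> T0 c0 Y0 mg g0 Yg; rewrite -ge0_integralZl_EFin//.
apply: ae_ge0_le_integralT.
- move=> w; apply: (@le_trans _ _ (Y 0 w)%:E); first by rewrite lee_fin.
  by apply: ereal_sup_ubound; exists 0; rewrite //= in_itv/= lexx.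
- by move=> w; rewrite mule_ge0.
- exact: measurable_funeM.
apply: filterS Yg => w Yw; apply: ge_ereal_sup => _ [t /= + <-].
by rewrite in_itv/= => /andP[t0 tT]; exact: Yw.
Qed.

Theorem proposition3p11 (R : realType) (d m : nat)
    (D : set 'cV[R]_d) (xs : 'cV[R]_d)
    (b : 'cV[R]_d -> 'cV[R]_d) (sigma : 'cV[R]_d -> 'M[R]_(d, m))
    (L eta qb qsigma : R) (p P : R)
    (D_neq0 : D !=set0) (D_open : open D)
    (D_convex : convex_set (M := 'cV[R]_d) D)
    (D_frontier : frontier D !=set0) (D_xs : D xs)
    (b_cont : continuous b) (sigma_cont : continuous sigma)
    (L_gt0 : 0 < L) (eta_gt : 2^-1 < eta)
    (qb_ge0 : 0 <= qb) (qsigma_ge0 : 0 <= qsigma)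
    (monotone : forall x y : 'cV[R]_d,
       dotv (x - y) (b x - b y) + eta * hsnorm (sigma x - sigma y) ^+ 2
       <= L * hsnorm (x - y) ^+ 2)
    (b_growth : forall x y : 'cV[R]_d,
       hsnorm (b x - b y)
       <= L * (1 + hsnorm x `^ qb + hsnorm y `^ qb) * hsnorm (x - y))
    (sigma_growth : forall x y : 'cV[R]_d,
       hsnorm (sigma x - sigma y)
       <= L * (1 + hsnorm x `^ qsigma + hsnorm y `^ qsigma) * hsnorm (x - y))
    (p_ge1 : 1 <= p) (P_gt : Num.max p 2 < P) (P_lt : P < eta + 2^-1) :
  forall T : R, 0 < T ->
  exists C : R, 0 < C /\
  forall x0 : 'cV[R]_d, closure D x0 ->
  forall (dO : measure_display) (Omega : measurableType dO)
    (Pr : probability Omega R) (F : R -> set (set Omega))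
    (W : R -> Omega -> 'cV[R]_m),
    usual_conditions Pr F -> brownian_motion Pr F W ->
  forall X K : nat -> R -> Omega -> 'cV[R]_d,
    (forall N, admissible_steps T N ->
       tamed_euler_peano b sigma Pr F W D x0 T N (X N) (K N)) ->
    (ereal_sup [set expected_sup Pr T (fun t w => lyapunov xs (X N t w) `^ p)%R
               | N in admissible_steps T]
     <= (C * lyapunov xs x0 `^ p)%R%:E)%E
    /\
    (ereal_sup [set expected_sup Pr T (fun t w => hsnorm (X N t w) `^ (2 * p))%R
               | N in admissible_steps T]
     <= (C * (1 + hsnorm x0 `^ (2 * p)))%R%:E)%E.
Proof.
move=> T T_gt0.
have P_ge2 : 2 <= P by apply: ltW; apply: le_lt_trans P_gt; rewrite le_max lexx orbT.
have pP : p < P by apply: le_lt_trans P_gt; rewrite le_max lexx.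
have p0 : 0 <= p := le_trans ler01 p_ge1.
have [C C0 dominated] := tamed_euler_peano_dominated D_open D_convex D_xs b_cont sigma_cont
  L_gt0 monotone p_ge1 P_ge2 pP P_lt T_gt0.
(* Both [|x|^2 <= A V(x)] and [V(x) <= A (1 + |x|^2)] hold; [B] collects the cost of the two
   passages, and [1 + B] lets one constant serve both bounds. *)
pose A := 2 * (1 + hsnorm xs ^+ 2).
have A0 : 0 <= A by rewrite mulr_ge0// addr_ge0// sqr_ge0.
pose B := A `^ p * (A `^ p * 2 `^ p).
have B0 : 0 <= B by rewrite !mulr_ge0// powR_ge0.
exists (C * (1 + B)); split; first by rewrite mulr_gt0// ltr_pwDl.
move=> x0 _ dO Omega Pr F W FP WP X K XK.
have T0 := ltW T_gt0.
split; apply: ge_ereal_sup => _ [N NT <-];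
  have [g [mg g0 Xg gC]] := dominated x0 _ _ _ _ _ _ _ _ FP WP NT (XK N NT).
  apply: le_trans (expected_sup_le T0 (ler01 : (0 : R) <= 1) _ mg g0 _) _.
  - by move=> t w; exact: powR_ge0.
  - by apply: filterS Xg => w Xw t t0 tT; rewrite mul1e; exact: Xw.
  rewrite mul1e; apply: le_trans gC _; rewrite lee_fin.
  by rewrite ler_wpM2r ?powR_ge0// ler_peMr ?(ltW C0)// lerDl.
apply: le_trans (expected_sup_le T0 (powR_ge0 A p) _ mg g0 _) _.
- by move=> t w; exact: powR_ge0.
- apply: filterS Xg => w Xw t t0 tT.
  apply: le_trans (lee_wpmul2l _ (Xw t t0 tT)); last by rewrite lee_fin powR_ge0.
  have V0 : 0 <= lyapunov xs (X N t w) := le_trans ler01 (lyapunov_ge1 _ _).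
  rewrite -EFinM lee_fin powR_hsnorm2M -powRM//.
  by apply: ge0_ler_powR; rewrite ?nnegrE ?sqr_ge0 ?sqr_hsnorm_le_lyapunov ?(mulr_ge0 A0 V0).
apply: le_trans (lee_wpmul2l _ gC) _; first by rewrite lee_fin powR_ge0.
rewrite -EFinM lee_fin powR_hsnorm2M.
set y := hsnorm x0 ^+ 2.
have y0 : 0 <= y by exact: sqr_ge0.
have V0 : 0 <= lyapunov xs x0 := le_trans ler01 (lyapunov_ge1 _ _).
have V0le : lyapunov xs x0 `^ p <= A `^ p * (2 `^ p * (1 + y `^ p)).
  apply: (@le_trans _ _ ((A * (1 + y)) `^ p)).
    apply: ge0_ler_powR; rewrite ?nnegrE//; last exact: lyapunov_le_sqr_hsnorm.
    by rewrite mulr_ge0// addr_ge0.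
  rewrite powRM//; last exact: addr_ge0.
  by apply: ler_wpM2l; [exact: powR_ge0|exact: powR1D_le].
have Ap0 := powR_ge0 A p.
apply: (@le_trans _ _ (A `^ p * (C * (A `^ p * (2 `^ p * (1 + y `^ p)))))).
  by rewrite ler_wpM2l// ler_wpM2l// ltW.
have -> : A `^ p * (C * (A `^ p * (2 `^ p * (1 + y `^ p)))) = C * B * (1 + y `^ p).
  by rewrite /B; ring.
rewrite ler_wpM2r ?addr_ge0 ?powR_ge0// ler_wpM2l ?(ltW C0)//.
by rewrite lerDr.
Qed.
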